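(* Assume that $\alpha$ and $Q$ satisfy the standing assumptions (i) and (ii) of the context, and let $p^\lambda$ ($\lambda>0$) be the rescaled family of probability measures defined in the context. Then for each $f\in L^1(0,\infty;C_b(\mathbb R^N))$, $$\lim_{\lambda\to\infty}\int_0^\infty\int_{\mathbb R^N}f(t,x)\,p^\lambda(t,dx)\,dt=\int_0^\infty\int_{\mathbb R^N}f(t,x)\,\Pi(t,dx)\,dt,$$ where $\Pi=\Pi(t,dx)\in C([0,\infty);\mathcal P(\mathbb R^N))$ is the solution of $$\partial_t\Pi-\frac12\,\mathrm{div}\left(\frac{1}{1+\Gamma}D_0\nabla\Pi\right)=\delta_{t=0}\otimes\delta_0.$$
   Context: $N\ge1$ is an integer, $S=[-1,0]\times\mathbb R^N$, $\mathcal P(\mathbb R^N)$ is the set of Borel probability measures on $\mathbb R^N$ with the narrow topology, $C_b(\mathbb R^N)$ the bounded continuous functions, $Q$ a Borel probability measure on $S$. Standing assumptions: (i) $\alpha:[0,\infty)\times[-1,0]\to(0,\infty)$ is bounded and continuous, and there exist $M>0$, $\beta>0$ and a continuous function $\alpha_\infty:[-1,0]\to(0,\infty)$ with $|\alpha(t,\theta)-\alpha_\infty(\theta)|\le Me^{-\beta t}$ for all $t\ge0$, $\theta\in[-1,0]$; (ii) $\int_S|x|^2Q(d\theta,dx)<\infty$. Fix $u^0\in C([-1,0];\mathcal P(\mathbb R^N))$ and let $\mu\in C([-1,\infty);\mathcal P(\mathbb R^N))$ be the unique solution of the delay equation: $\mu(\theta,\cdot)=u^0(\theta,\cdot)$ for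 $\theta\in[-1,0]$ and, for every $f\in C_b(\mathbb R^N)$, $t\mapsto\int f\,d\mu(t,\cdot)$ is $C^1$ on $(0,\infty)$ with, for all $t>0$, $$\frac{d}{dt}\int f(x)\mu(t,dx)=\int_S\alpha(t,\theta)\left[\int_{\mathbb R^N}f(x+z)\mu(t+\theta,dx)\right]Q(d\theta,dz)-\int f(x)\mu(t,dx)\int_S\alpha(t,\theta)Q(d\theta,dz).$$ Set $\Gamma=\int_S(-\theta)\alpha_\infty(\theta)Q(d\theta,dz)$, $\mathbf K=\frac1{1+\Gamma}\int_S\alpha_\infty(\theta)zQ(d\theta,dz)$, $D_0=\int_S\alpha_\infty(\theta)[z+\theta\mathbf K][z+\theta\mathbf K]^TQ(d\theta,dz)$, and $$H(t)=-\frac1{1+\Gamma}\int_0^t\int_S\alpha(s,\theta)\,x\,Q(d\theta,dx)\,ds\in\mathbb R^N,\quad t\ge0.$$ For $\lambda>0$ and $t\ge0$, $p^\lambda(t,dx)\in\mathcal P(\mathbb R^N)$ is defined by $\int\varphi(x)p^\lambda(t,dx)=\int\varphi\left(\frac{x+H(\lambda^2t)}{\lambda}\right)\mu(\lambda^2t,dx)$ for all $\varphi\in C_b(\mathbb R^N)$. The equation for $\Pi$ is understood in the tempered distribution sense: for every Schwartz function $\phi$ on $[0,\infty)\times\mathbb R^N$ (restriction of a Schwartz function on $\mathbb R\times\mathbb R^N$), $\int_0^\infty\int\left[\partial_t\phi+\frac12\mathrm{div}\left(\frac{D_0}{1+\Gamma}\nabla\phi\right)\right]\Pi(t,dx)\,dt=-\phi(0,0)$;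 this solution is unique. *)

(* Defs.v *)
From HB Require Import structures.
From mathcomp Require Import all_boot all_order all_algebra.
From mathcomp Require Import all_classical all_reals all_analysis.
Set Implicit Arguments.
Unset Strict Implicit.
Unset Printing Implicit Defensive.
Import Order.TTheory GRing.Theory Num.Theory.
Import numFieldNormedType.Exports.
Local Open Scope classical_set_scope.
Local Open Scope ring_scope.

Notation Borel T := (g_sigma_algebraType (@open T)).

Definition is_Cb (R : realType) (T : topologicalType) (f : T -> R) : Prop :=
  continuous f /\ exists M : R, forall x, `|f x| <= M.

Definition Cb (R : realType) (T : topologicalType) : Type :=
  {f : T -> R | is_Cb f}.

HB.instance Definition _ (R : realType) (T : topologicalType) :=
  gen_eqMixin (Cb R T).
HB.instance Definition _ (R : realType) (T : topologicalType) :=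
  gen_choiceMixin (Cb R T).

Definition Cb_norm (R : realType) (T : topologicalType) (f : T -> R) : R :=
  sup (range (fun x => `|f x|)).

Definition bprob (R : realType) (T : ptopologicalType) : Type :=
  probability (Borel T) R.

HB.instance Definition _ (R : realType) (T : ptopologicalType) :=
  gen_eqMixin (bprob R T).
HB.instance Definition _ (R : realType) (T : ptopologicalType) :=
  gen_choiceMixin (bprob R T).

Definition narrow_ev (R : realType) (T : ptopologicalType) (P : bprob R T) :
    {ptws Cb R T -> R} :=
  fun f => \int[(P : probability (Borel T) R)]_x (proj1_sig f x).

(* Borel probability measures with the coarsest topology making
   P |-> \int f dP continuous for every bounded continuous f. *)
Definition narrow (R : realType) (T : ptopologicalType) : Type :=
  initial_topology (@narrow_ev R T).

HB.instance Definition _ (R : realType) (T : ptopologicalType) :=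
  Topological.on (narrow R T).

Definition narrow_probability (R : realType) (T : ptopologicalType)
  (P : narrow R T) : probability (Borel T) R := P.
Coercion narrow_probability : narrow >-> probability.

(* Vectors of R^N are row vectors; the library norm of 'rV[R]_N is the sup
   norm, whence the explicit Euclidean square. *)
Definition sqr_enorm (R : realType) (N : nat) (x : 'rV[R]_N) : R :=
  \sum_(i < N) x 0 i ^+ 2.

(* The set [-1,0] x R^N.  A probability measure on it is a Borel probability
   measure on R x R^N giving it mass 1. *)
Definition strip (R : realType) (N : nat) : set (R * 'rV[R]_N) :=
  [set p | -1 <= p.1 <= 0].

Definition standing_alpha (R : realType) (alpha : R -> R -> R)
    (alpha_oo : R -> R) : Prop :=
  [/\ forall t theta : R, 0 <= t -> -1 <= theta <= 0 -> 0 < alpha t theta,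
      exists B : R,
        forall t theta : R, 0 <= t -> -1 <= theta <= 0 -> `|alpha t theta| <= B,
      {within [set p : R * R | 0 <= p.1 /\ -1 <= p.2 <= 0],
        continuous (fun p : R * R => alpha p.1 p.2)},
      (forall theta : R, -1 <= theta <= 0 -> 0 < alpha_oo theta) /\
      {within `[-1, 0], continuous alpha_oo} &
      exists M beta : R, [/\ 0 < M, 0 < beta &
        forall t theta : R, 0 <= t -> -1 <= theta <= 0 ->
          `|alpha t theta - alpha_oo theta| <= M * expR (- beta * t)]].

Section delay_equation.
Context (R : realType) (N : nat) (Q : probability (Borel (R * 'rV[R]_N)%type) R).
Local Notation S := (@strip R N).

Definition standing_Q : Prop :=
  (\int[Q]_(p in S) (sqr_enorm p.2)%:E < +oo)%E.

Definition delay_rhs (alpha : R -> R -> R) (mu : R -> narrow R 'rV[R]_N)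
    (f : 'rV[R]_N -> R) (t : R) : R :=
  \int[Q]_(p in S) (alpha t p.1 * \int[mu (t + p.1)]_x f (x + p.2))
  - (\int[mu t]_x f x) * \int[Q]_(p in S) alpha t p.1.

Definition delay_solution (alpha : R -> R -> R)
    (u0 mu : R -> narrow R 'rV[R]_N) : Prop :=
  [/\ {within `[-1, +oo[, continuous mu},
      forall theta : R, -1 <= theta <= 0 ->
        forall A : set (Borel 'rV[R]_N), measurable A -> mu theta A = u0 theta A &
      forall f : 'rV[R]_N -> R, is_Cb f ->
        let F := fun t => \int[mu t]_x f x in
        [/\ forall t : R, 0 < t -> derivable F t 1,
            {in `]0, +oo[, continuous (derive1 F)} &
            forall t : R, 0 < t -> derive1 F t = delay_rhs alpha mu f t]].

Definition Gam (alpha_oo : R -> R) : R :=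
  \int[Q]_(p in S) (- p.1 * alpha_oo p.1).

Definition drift (alpha_oo : R -> R) : 'rV[R]_N :=
  (1 + Gam alpha_oo)^-1 *: \row_i \int[Q]_(p in S) (alpha_oo p.1 * p.2 0 i).

Definition D0 (alpha_oo : R -> R) : 'M[R]_N :=
  \matrix_(i, j) \int[Q]_(p in S)
    let w := p.2 + p.1 *: drift alpha_oo in
    alpha_oo p.1 * (w^T *m w) i j.

Definition Hshift (alpha : R -> R -> R) (alpha_oo : R -> R) (t : R) : 'rV[R]_N :=
  - (1 + Gam alpha_oo)^-1 *:
    \row_i \int[@lebesgue_measure R]_(s in `[0, t])
             \int[Q]_(p in S) (alpha s p.1 * p.2 0 i).

Definition rescaled (H : R -> 'rV[R]_N) (mu : R -> narrow R 'rV[R]_N)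
    (p : R -> R -> narrow R 'rV[R]_N) : Prop :=
  forall lambda t : R, 0 < lambda -> 0 <= t ->
  forall phi : 'rV[R]_N -> R, is_Cb phi ->
    \int[p lambda t]_x phi x =
    \int[mu (lambda ^+ 2 * t)]_x
      phi (lambda^-1 *: (x + H (lambda ^+ 2 * t))).

End delay_equation.

Section diffusion.
Context (R : realType) (N : nat).

(* None is the time direction, Some i the i-th space direction. *)
Definition basis_dir (i : option 'I_N) : R * 'rV[R]_N :=
  if i is Some i then (0, delta_mx 0 i) else (1, 0).

Definition partials (s : seq (option 'I_N)) (phi : R * 'rV[R]_N -> R) :
    R * 'rV[R]_N -> R :=
  foldr (fun i g => 'D_(basis_dir i) g) phi s.

Definition schwartz (phi : R * 'rV[R]_N -> R) : Prop :=
  [/\ forall s, continuous (partials s phi),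
      forall s i (p : R * 'rV[R]_N), derivable (partials s phi) p (basis_dir i) &
      forall (k : nat) s, exists C : R, forall p : R * 'rV[R]_N,
        (1 + `|p|) ^+ k * `|partials s phi p| <= C].

Definition grad (g : 'rV[R]_N -> R) (x : 'rV[R]_N) : 'rV[R]_N :=
  \row_i 'D_(delta_mx 0 i) g x.

Definition divergence (F : 'rV[R]_N -> 'rV[R]_N) (x : 'rV[R]_N) : R :=
  \sum_(i < N) 'D_(delta_mx 0 i) (fun y => F y 0 i) x.

(* Pi solves d_t Pi - 1/2 div (A grad Pi) = delta_{t=0} (x) delta_0 in the
   sense of tempered distributions; the transpose accounts for gradients being
   row vectors. *)
Definition diffusion_solution (A : 'M[R]_N) (Pi : R -> narrow R 'rV[R]_N) :
    Prop :=
  {within `[0, +oo[, continuous Pi} /\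
  forall phi, schwartz phi ->
    \int[@lebesgue_measure R]_(t in `[0, +oo[) \int[Pi t]_x
      (derive1 (fun s => phi (s, x)) t +
       2^-1 * divergence (fun y => grad (fun z => phi (t, z)) y *m A^T) x)
    = - phi (0, 0).

End diffusion.

Section L1_Cb.
Context (R : realType) (T : topologicalType).

Definition simple_Cb (s : R -> T -> R) : Prop :=
  exists (k : nat) (A : 'I_k -> set R) (h : 'I_k -> T -> R),
    [/\ forall i, measurable (A i), forall i, is_Cb (h i) &
        forall t x, s t x = \sum_(i < k) \1_(A i) t * h i x].

Definition strongly_measurable_Cb (D : set R) (f : R -> T -> R) : Prop :=
  exists s : nat -> R -> T -> R, (forall n, simple_Cb (s n)) /\
    {ae @lebesgue_measure R, forall t, D t ->
      Cb_norm (s n t \- f t) @[n --> \oo] --> (0 : R)}.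

Definition L1_Cb (D : set R) (f : R -> T -> R) : Prop :=
  [/\ forall t, D t -> is_Cb (f t),
      strongly_measurable_Cb D f &
      (\int[@lebesgue_measure R]_(t in D) (Cb_norm (f t))%:E < +oo)%E].

End L1_Cb.

(* Main.v *)
Require Import Defs.
From HB Require Import structures.
From mathcomp Require Import all_boot all_order all_algebra.
From mathcomp Require Import all_classical all_reals all_analysis.
From mathcomp Require Import measurable_realfun ring lra.
Set Implicit Arguments.
Unset Strict Implicit.
Unset Printing Implicit Defensive.
Import Order.TTheory GRing.Theory Num.Theory.
Import numFieldNormedType.Exports.
Local Open Scope classical_set_scope.
Local Open Scope ring_scope.

(* Test the delay equation on ridge functions k (zeta . x / lambda - kappa t), which
   follow the drift K t, and take the Laplace transform in time at a / lambda^2.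
   A second-order Taylor expansion of k, in which the delay contributes the factor
   1 + Gamma, shows that the transforms L of the rescaled laws satisfy, as lambda
   tends to infinity,
     a (1 + Gamma) L(k) - (zeta^T D0 zeta / 2) L(k'') --> (1 + Gamma) k 0.
   The shift H differs from - K t by a bounded amount, hence is harmless after
   rescaling.  Testing the diffusion equation with Gaussian approximations of
   e^(- a t) k (zeta . x) gives the same relation, with equality, for Pi.  With
   k = cos and k = sin this identifies the limits on trigonometric functions; with
   k = y^2 / (1 + y^2) it gives tightness.  Trigonometric approximation then covers
   all bounded continuous functions of x, Weierstrass approximation in e^(- t)
   covers indicators in time, and simple functions cover L^1(0, oo; C_b). *)

(** * Integration and Laplace transforms *)

(** Laplace transformation makes the delay tractable: a shift by theta becomes the factor exp (b
    theta) plus an integral over [theta, 0], and both have explicit limits as b = a / lambda^2 tends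
    to 0. The transforms themselves grow like lambda^2, so the relation is a balance at order 1 in
    which the terms of order lambda must cancel exactly; this is why the centre moves along the
    straight line K t, for which a delayed jump z reads z + theta K, rather than along H. Q has only
    second moments, so the Taylor remainder is bounded twice: quadratically in the jump, to be
    dominated under Q, and cubically, to vanish at each jump. For cos and sin the second derivative
    is the opposite of the function, so the relation is a scalar equation with positive coefficient
    and is solved for L; no subsequence is extracted. Tightness uses a nonnegative profile that
    vanishes at 0, dilated by a large r: the quadratic form then shrinks like r^-2. Neither e^(- a
    t) on the whole line nor a ridge function is of Schwartz class, hence the Gaussian damping,
    removed by dominated convergence. *)

Section measure_facts.
Context {R : realType}.

Section continuity.
Context {T : topologicalType}.
Implicit Types f g : T -> R.

Lemma ctsD f g : continuous f -> continuous g -> continuous (fun x => f x + g x).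
Proof. by move=> cf cg x; apply: cvgD; [exact: cf|exact: cg]. Qed.

Lemma ctsM f g : continuous f -> continuous g -> continuous (fun x => f x * g x).
Proof. by move=> cf cg x; apply: cvgM; [exact: cf|exact: cg]. Qed.

Lemma ctsN f : continuous f -> continuous (fun x => - f x).
Proof. by move=> cf x; apply: cvgN; exact: cf. Qed.

Lemma ctsB f g : continuous f -> continuous g -> continuous (fun x => f x - g x).
Proof. by move=> cf cg x; apply: cvgB; [exact: cf|exact: cg]. Qed.

Lemma cts_sum (I : Type) (r : seq I) (P : pred I) (F : I -> T -> R) :
  (forall i, P i -> continuous (F i)) ->
  continuous (fun x => \sum_(i <- r | P i) F i x).
Proof. by move=> cF; apply: continuous_big => //; exact: add_continuous. Qed.

Lemma cts_comp (h : R -> R) f : continuous h -> continuous f ->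
  continuous (fun x => h (f x)).
Proof. by move=> ch cf x; apply: continuous_comp; [exact: cf|exact: ch]. Qed.

Lemma cts_cst (c : R) : continuous (fun _ : T => c).
Proof. by move=> x; exact: cst_continuous. Qed.

End continuity.

Lemma g_sigma_measurable (T : pointedType) (G : set (set T)) (f : T -> R) :
  (forall O, open O -> G (f @^-1` O)) ->
  measurable_fun [set: g_sigma_algebraType G] f.
Proof.
move=> fG; apply: (measurability _ (RGenOpens.measurableE R)).
move=> _ [_ [x [y ->]] <-]; rewrite setTI.
by apply: sub_sigma_algebra; apply: fG; exact: interval_open.
Qed.

Lemma borel_measurable (T : ptopologicalType) (f : T -> R) :
  continuous f -> measurable_fun [set: Borel T] f.
Proof. by move=> /continuousP cf; apply: g_sigma_measurable => O; exact: cf. Qed.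

(* The product of two [ptopologicalType]s carries no such structure in the library. *)
Lemma borel_measurable2 N (f : R * 'rV[R]_N -> R) :
  continuous f -> measurable_fun [set: Borel (R * 'rV[R]_N)%type] f.
Proof. by move=> /continuousP cf; apply: g_sigma_measurable => O; exact: cf. Qed.

Lemma bounded_integrable d (T : measurableType d)
    (mu : {finite_measure set T -> \bar R}) (D : set T) (f : T -> R) (M : R) :
  measurable D -> measurable_fun D f -> (forall x, D x -> `|f x| <= M) ->
  mu.-integrable D (EFin \o f).
Proof.
move=> mD mf fM.
apply: (le_integrable mD _ _ (finite_measure_integrable_cst mu M mD)).
  exact/measurable_EFinP.
move=> x Dx /=; rewrite lee_fin (le_trans (fM _ Dx))//.
by rewrite ler_norm.
Qed.

Lemma Rdominated_cvg d (T : measurableType d)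
    (mu : {measure set T -> \bar R}) (D : set T) (f_ : (T -> R)^nat)
    (f g : T -> R) :
  measurable D -> (forall n, measurable_fun D (f_ n)) ->
  (forall x, D x -> f_ n x @[n --> \oo] --> f x) ->
  mu.-integrable D (EFin \o g) ->
  (forall n x, D x -> `|f_ n x| <= g x) ->
  \int[mu]_(x in D) f_ n x @[n --> \oo] --> \int[mu]_(x in D) f x.
Proof.
move=> mD mf_ cf ig fg.
have mf : measurable_fun D f by exact: (measurable_fun_cvg mf_ cf).
have fgx x : D x -> `|f x| <= g x.
  move=> Dx; have /(@cvg_lim _) <- // : `|f_ n x| @[n --> \oo] --> `|f x|.
    by apply: cvg_norm; exact: cf.
  apply: limr_le; first by apply/cvg_ex; exists `|f x|; apply: cvg_norm; exact: cf.
  by apply: nearW => n; exact: fg.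
have If : mu.-integrable D (EFin \o f).
  apply: (le_integrable mD _ _ ig); first exact/measurable_EFinP.
  by move=> x Dx /=; rewrite lee_fin (le_trans (fgx _ Dx))// ler_norm.
apply: fine_cvg; rewrite fineK; last exact: integrable_fin_num.
apply: (@dominated_cvg _ _ _ mu D mD _ _ (EFin \o g)) => //.
- by move=> n; exact/measurable_EFinP.
- by move=> x Dx; apply: cvg_EFin; [exact: nearW|exact: cf].
Qed.

Lemma le_normr_Rintegral_bound d (T : measurableType d)
    (mu : {measure set T -> \bar R}) (D : set T) (f g : T -> R) :
  measurable D -> measurable_fun D f -> mu.-integrable D (EFin \o g) ->
  (forall x, D x -> `|f x| <= g x) ->
  `|\int[mu]_(x in D) f x| <= \int[mu]_(x in D) g x.
Proof.
move=> mD mf ig fg.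
have If : mu.-integrable D (EFin \o f).
  apply: (le_integrable mD _ _ ig); first exact/measurable_EFinP.
  by move=> x Dx /=; rewrite lee_fin (le_trans (fg _ Dx))// ler_norm.
apply: (le_trans (le_normr_Rintegral mD If)).
by apply: le_Rintegral => //; exact: (integrable_norm If).
Qed.

Section probability.
Context d (T : measurableType d) (P : probability T R).
Implicit Types f g : T -> R.

Lemma prob_cst (c : R) : \int[P]_x c = c.
Proof.
rewrite Rintegral_cst// [X in fine X](_ : _ = 1%E) ?mulr1//.
exact: probability_setT.
Qed.

Lemma prob_integrable f M : measurable_fun setT f -> (forall x, `|f x| <= M) ->
  P.-integrable setT (EFin \o f).
Proof.
move=> mf fM; apply: (@bounded_integrable _ _ P setT f M) => //; exact: measurableT.
Qed.

Lemma prob_norm_le f M : measurable_fun setT f -> (forall x, `|f x| <= M) ->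
  `|\int[P]_x f x| <= M.
Proof.
move=> mf fM; rewrite -[leRHS](prob_cst M).
apply: le_normr_Rintegral_bound => //.
exact: finite_measure_integrable_cst.
Qed.

Lemma prob_dist_le f g e :
  P.-integrable setT (EFin \o f) -> P.-integrable setT (EFin \o g) ->
  (forall x, `|f x - g x| <= e) -> `|\int[P]_x f x - \int[P]_x g x| <= e.
Proof.
move=> If Ig fge; rewrite -RintegralB//.
by apply: prob_norm_le => //; apply: measurable_funB;
  apply/measurable_EFinP; [apply: measurable_int If|apply: measurable_int Ig].
Qed.

End probability.

End measure_facts.

Section laplace.
Context {R : realType}.
Notation mu := (@lebesgue_measure R).
Implicit Types (F G : R -> R) (a b c M s : R).

(** At each point the cut at [u n] is eventually inactive, so dominated convergence applies with the
    absolute value of [f]. It carries interval statements, such as the fundamental theorem of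
    calculus and substitution, over to the half-line. *)
Lemma Rintegral_itvcy_cvg (f : R -> R) (c : R) (u : R^nat) :
  mu.-integrable `[c, +oo[ (EFin \o f) -> u n @[n --> \oo] --> +oo ->
  \int[mu]_(x in `[c, u n]) f x @[n --> \oo] --> \int[mu]_(x in `[c, +oo[) f x.
Proof.
move=> If uoo.
have mI (v : R) : measurable `]-oo, v] by [].
have -> : (fun n => \int[mu]_(x in `[c, u n]) f x) =
    (fun n => \int[mu]_(x in `[c, +oo[) (f \_ `]-oo, u n]) x).
  apply/funext => n; rewrite -Rintegral_mkcondr; congr (Rintegral _ _ _).
  by apply/seteqP; split => x /=; rewrite !in_itv /= ?andbT; [move=> /andP[]|move=> [-> ->]].
have /integrableP[mf _] := If.
apply: (@Rdominated_cvg _ _ _ mu `[c, +oo[ (fun n => f \_ `]-oo, u n]) f (fun x => `|f x|)) => //.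
- move=> n; apply: ((measurable_restrict _ (mI (u n)) (measurable_itv `[c, +oo[)).1 _).
  apply: (@measurable_funS _ _ _ _ `[c, +oo[) => //.
  exact/measurable_EFinP.
- move=> x /= _; apply: cvg_near_cst.
  move/cvgryPge : uoo => /(_ x); apply: filterS => n xn.
  by rewrite patchE mem_set//= in_itv/=.
- exact: integrable_norm.
- by move=> n x _; rewrite patchE; case: ifP => // _; rewrite normr0.
Qed.

Lemma integrable_expRN a : 0 < a ->
  mu.-integrable `[0, +oo[ (EFin \o (fun s => expR (- a * s))).
Proof.
move=> a0.
have H : mu.-integrable `[0, +oo[ (EFin \o exponential_pdf a).
  by apply: integrableS (integrable_exponential_pdf a0).
have := integrableZl (mu := mu) (D := `[0, +oo[) _ a^-1 H.
move=> /(_ (measurable_itv _)); apply: eq_integrable => // x.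
rewrite inE /= in_itv /= andbT => x0.
by rewrite exponential_pdfE// -EFinM mulKf// gt_eqF.
Qed.

Definition lap a F := \int[mu]_(s in `[0, +oo[) (expR (- a * s) * F s).

Lemma continuous_expRM a : continuous (fun s : R => expR (a * s)).
Proof.
move=> s; apply: continuous_comp; last exact: continuous_expR.
by apply: continuousM => //; exact: cst_continuous.
Qed.

Lemma measurable_expRM a (D : set R) : measurable_fun D (fun s : R => expR (a * s)).
Proof. by apply: measurable_funTS; apply: continuous_measurable_fun; exact: continuous_expRM. Qed.

Lemma integrable_expRN_cst a M : 0 < a ->
  mu.-integrable `[0, +oo[ (EFin \o (fun s => expR (- a * s) * M)).
Proof.
move=> a0.
have := integrableZl (mu := mu) (D := `[0, +oo[) (measurable_itv _) M (integrable_expRN a0).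
by apply: eq_integrable => // x _ /=; rewrite -EFinM (mulrC M).
Qed.

Lemma lap_integrable a F M : 0 < a -> measurable_fun `[(0 : R), +oo[ F ->
  (forall s, 0 <= s -> `|F s| <= M) ->
  mu.-integrable `[0, +oo[ (EFin \o (fun s => expR (- a * s) * F s)).
Proof.
move=> a0 mF FM; apply: (le_integrable _ _ _ (integrable_expRN_cst M a0)) => //.
  by apply/measurable_EFinP; apply: measurable_funM => //; exact: measurable_expRM.
move=> s /=; rewrite in_itv /= andbT => s0; rewrite lee_fin !normrM ler_wpM2l//.
by rewrite (le_trans (FM _ s0))// ler_norm.
Qed.

Lemma eq_lap a F G : (forall s, 0 <= s -> F s = G s) -> lap a F = lap a G.
Proof.
move=> FG; apply: eq_Rintegral => s; rewrite inE /= in_itv /= andbT => s0.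
by rewrite FG.
Qed.

Lemma lapD a F G M (M' : R) : 0 < a ->
  measurable_fun `[(0 : R), +oo[ F -> (forall s, 0 <= s -> `|F s| <= M) ->
  measurable_fun `[(0 : R), +oo[ G -> (forall s, 0 <= s -> `|G s| <= M') ->
  lap a (fun s => F s + G s) = lap a F + lap a G.
Proof.
move=> a0 mF FM mG GM; rewrite /lap -RintegralD//.
- by apply: eq_Rintegral => s _; rewrite mulrDr.
- exact: (lap_integrable _ _ FM).
- exact: (lap_integrable _ _ GM).
Qed.

Lemma lapZ a F M c : 0 < a ->
  measurable_fun `[(0 : R), +oo[ F -> (forall s, 0 <= s -> `|F s| <= M) ->
  lap a (fun s => c * F s) = c * lap a F.
Proof.
move=> a0 mF FM; rewrite /lap -RintegralZl//.
- by apply: eq_Rintegral => s _; rewrite mulrCA.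
- exact: (lap_integrable _ _ FM).
Qed.

Lemma lapB a F G M (M' : R) : 0 < a ->
  measurable_fun `[(0 : R), +oo[ F -> (forall s, 0 <= s -> `|F s| <= M) ->
  measurable_fun `[(0 : R), +oo[ G -> (forall s, 0 <= s -> `|G s| <= M') ->
  lap a (fun s => F s - G s) = lap a F - lap a G.
Proof.
move=> a0 mF FM mG GM; rewrite /lap -RintegralB//.
- by apply: eq_Rintegral => s _; rewrite mulrBr.
- exact: (lap_integrable _ _ FM).
- exact: (lap_integrable _ _ GM).
Qed.

Lemma lap_cvg a (F_ : (R -> R)^nat) F M : 0 < a ->
  (forall n, measurable_fun `[(0 : R), +oo[ (F_ n)) ->
  (forall n s, 0 <= s -> `|F_ n s| <= M) ->
  (forall s, 0 <= s -> F_ n s @[n --> \oo] --> F s) ->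
  lap a (F_ n) @[n --> \oo] --> lap a F.
Proof.
move=> a0 mF FM cF; apply: (@Rdominated_cvg _ _ _ mu `[(0 : R), +oo[ (fun n s => expR (- a * s) * F_ n s)
  (fun s => expR (- a * s) * F s) (fun s => expR (- a * s) * M)) => //.
- by move=> n; apply: measurable_funM; [exact: measurable_expRM|exact: mF].
- move=> s /=; rewrite in_itv /= andbT => s0.
  by apply: cvgM; [exact: cvg_cst|exact: cF].
- exact: integrable_expRN_cst.
- move=> n s /=; rewrite in_itv /= andbT => s0.
  by rewrite normrM ger0_norm ?expR_ge0// ler_wpM2l ?expR_ge0// FM.
Qed.

Lemma cvg_expRN_nat a : 0 < a -> expR (- a * n%:R) @[n --> \oo] --> (0 : R).
Proof.
move=> a0.
rewrite (_ : (fun n : nat => expR (- a * n%:R)) =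
             (fun z => expR (- z)) \o (fun z => a * z) \o (fun n : nat => n%:R)); last first.
  by apply: eq_fun => x; rewrite /= mulNr.
apply: (@cvg_comp _ _ _ _ _ _ (pinfty_nbhs R)); first exact: cvgr_idn.
apply: (@cvg_comp _ _ _ _ _ _ (pinfty_nbhs R)); last exact: cvgr_expR.
exact: gt0_cvgMry.
Qed.

(** Integration by parts, from the derivative of [expR (- a * s) * G s]; the boundary term at [n]
    dies because [G] is bounded. The derivative is asked for at [s > 0] only, as in the delay
    equation; continuity takes care of the endpoint 0. *)
Lemma lap_deriv a G (g : R -> R) M M' : 0 < a ->
  continuous G -> continuous g ->
  (forall s, 0 <= s -> `|G s| <= M) -> (forall s, 0 <= s -> `|g s| <= M') ->
  (forall s, 0 < s -> is_derive s 1 G (g s)) ->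
  lap a g = a * lap a G - G 0.
Proof.
move=> a0 cG cg GM gM dG.
have mG : measurable_fun `[(0 : R), +oo[ G by apply: measurable_funTS; exact: continuous_measurable_fun.
have mg : measurable_fun `[(0 : R), +oo[ g by apply: measurable_funTS; exact: continuous_measurable_fun.
have aGM s : 0 <= s -> `|a * G s| <= a * M.
  by move=> s0; rewrite normrM gtr0_norm// ler_wpM2l ?GM// ltW.
have maG : measurable_fun `[(0 : R), +oo[ (fun s => a * G s) by exact: measurable_funM.
suff : lap a (fun s => g s - a * G s) = - G 0.
  rewrite (lapB a0 mg gM maG aGM) (lapZ a a0 mG GM) => <-.
  by rewrite addrC subrK.
pose F s := expR (- a * s) * G s.
pose f s := expR (- a * s) * (g s - a * G s).
have cF : continuous F by move=> s; apply: cvgM; [exact: continuous_expRM|exact: cG].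
have cf : continuous f.
  move=> s; apply: cvgM; first exact: continuous_expRM.
  by apply: cvgB; [exact: cg|apply: cvgM; [exact: cvg_cst|exact: cG]].
have dF s : 0 < s -> is_derive s 1 F (f s).
  move=> s0; have ? := dG _ s0.
  apply: is_derive_eq.
  rewrite /f /GRing.scale /=; lra.
have If : mu.-integrable `[0, +oo[ (EFin \o f).
  apply: (@lap_integrable a (fun s => g s - a * G s) (M' + a * M)) => //.
    exact: measurable_funB.
  by move=> s s0; rewrite (le_trans (ler_normB _ _))// lerD// ?gM ?aGM.
have H1 := Rintegral_itvcy_cvg If (@cvgr_idn R).
have H2 : (\int[mu]_(x in `[0, n%:R]) f x) @[n --> \oo] --> - G 0.
  have -> : - G 0 = 0 - G 0 by rewrite sub0r.
  apply: (@cvg_trans _ ((F n%:R - G 0) @[n --> \oo])); last first.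
    apply: cvgB; last exact: cvg_cst.
    apply: (squeeze_cvgr (f := fun n => - (expR (- a * n%:R) * M))
                         (h := fun n => expR (- a * n%:R) * M)).
    + near=> n; rewrite -ler_norml normrM ger0_norm ?expR_ge0// ler_wpM2l ?expR_ge0//.
      exact: GM.
    + rewrite -oppr0; apply: cvgN; rewrite -(mul0r M).
      by apply: cvgM; [exact: cvg_expRN_nat|exact: cvg_cst].
    + by rewrite -(mul0r M); apply: cvgM; [exact: cvg_expRN_nat|exact: cvg_cst].
  apply: near_eq_cvg; near=> n.
  have n0 : 0 < n%:R :> R by rewrite ltr0n; near: n; exists 1%N.
  rewrite /Rintegral (continuous_FTC2 n0 (F := F)) //=.
  - by rewrite /F mulr0 expR0 mul1r.
  - exact: continuous_subspaceT.
  - split.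
    + by move=> x; rewrite in_itv /= => /andP[x0 _]; have := dF _ x0 => -[].
    + by apply: cvg_at_right_filter; exact: cF.
    + by apply: cvg_at_left_filter; exact: cF.
  - move=> x; rewrite in_itv /= => /andP[x0 _].
    by rewrite derive1E; have := dF _ x0 => ?; rewrite derive_val.
exact: (cvg_unique _ H1 H2).
Unshelve. all: by end_near. Qed.

Lemma lap_cst a M : 0 < a -> lap a (fun=> M) = M / a.
Proof.
move=> a0.
have := @lap_deriv a (fun=> M) (fun=> 0) `|M| 0 a0.
move=> /(_ (@cst_continuous _ _ _) (@cst_continuous _ _ _)).
move=> H; have {}H : lap a (fun=> 0) = a * lap a (fun=> M) - M.
  by apply: H => // s _; rewrite ?normr0//; exact: is_derive_cst.
have L0 : lap a (fun=> 0) = 0.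
  rewrite /lap (_ : (fun s => _ * 0) = cst 0); last by apply/funext => s; rewrite mulr0.
  by rewrite /Rintegral integral0.
move: H; rewrite L0 => /esym/eqP; rewrite subr_eq0 => /eqP H.
by apply: (mulfI (lt0r_neq0 a0)); rewrite H mulrCA divff ?mulr1// lt0r_neq0.
Qed.

Lemma lap_norm_le a F M : 0 < a -> measurable_fun `[(0 : R), +oo[ F ->
  (forall s, 0 <= s -> `|F s| <= M) -> `|lap a F| <= M / a.
Proof.
move=> a0 mF FM; rewrite -(lap_cst M a0).
apply: le_normr_Rintegral_bound => //.
- by apply: measurable_funM => //; exact: measurable_expRM.
- exact: integrable_expRN_cst.
- move=> s /=; rewrite in_itv /= andbT => s0.
  by rewrite normrM ger0_norm ?expR_ge0// ler_wpM2l ?expR_ge0// FM.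
Qed.

End laplace.

Section affine.
Context {R : realType}.
Notation mu := (@lebesgue_measure R).
Implicit Types (F G h : R -> R) (a b c d M s : R).

Lemma integrable_disjU dd (T : measurableType dd) (m : {measure set T -> \bar R})
    (A B : set T) (f : T -> R) :
  measurable A -> measurable B -> [disjoint A & B] ->
  m.-integrable A (EFin \o f) -> m.-integrable B (EFin \o f) ->
  m.-integrable (A `|` B) (EFin \o f).
Proof.
move=> mA mB /disj_setPS AB /(integrable_mkcond _ mA) IA /(integrable_mkcond _ mB) IB.
apply/(integrable_mkcond _ (measurableU _ _ mA mB)).
have := integrableD measurableT IA IB; apply: eq_integrable => // x _ /=.
rewrite !patchE; case: (boolP (x \in A)) => xA; case: (boolP (x \in B)) => xB.
- by move: xA xB; rewrite !in_setE => xA xB; have := AB x => /(_ (conj xA xB)).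
- by rewrite in_setU xA adde0.
- by rewrite in_setU xB orbT add0e.
- by rewrite in_setU (negbTE xA) (negbTE xB) adde0.
Qed.

Lemma Rintegral_affine_itv G c d n : 0 < c -> 0 <= n -> continuous G ->
  \int[mu]_(x in `[d, c * n + d]) G x =
  \int[mu]_(s in `[0, n]) (G (c * s + d) * c).
Proof.
move=> c0 n0 cG.
have dF (s : R) : is_derive s 1 (fun s : R => c * s + d) c.
  by apply: is_derive_eq; rewrite /GRing.scale /=; ring.
have F'E : (fun s : R => c * s + d)^`()%classic = fun=> c.
  by apply/funext => s; rewrite derive1E; have ? := dF s; rewrite derive_val.
have cF : continuous (fun s : R => c * s + d).
  by apply: ctsD; [apply: ctsM; [exact: cts_cst|move=> x; exact: cvg_id]|exact: cts_cst].
rewrite /Rintegral; congr fine.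
have := @integration_by_substitution_increasing R (fun s => c * s + d) G 0 n n0.
rewrite F'E mulr0 add0r => ->.
- by [].
- by move=> x y _ _ xy; rewrite ltrD2r ltr_pM2l.
- by move=> x _; exact: cst_continuous.
- exact: is_cvg_cst.
- exact: is_cvg_cst.
- split.
  + by move=> s _; have [] := dF s.
  + by apply: cvg_at_right_filter; exact: cF.
  + by apply: cvg_at_left_filter; exact: cF.
- exact: continuous_subspaceT.
Qed.

Lemma Rintegral_affine G c d : 0 < c -> continuous G ->
  mu.-integrable `[d, +oo[ (EFin \o G) ->
  mu.-integrable `[0, +oo[ (EFin \o (fun s => G (c * s + d) * c)) ->
  \int[mu]_(x in `[d, +oo[) G x = \int[mu]_(s in `[0, +oo[) (G (c * s + d) * c).
Proof.
move=> c0 cG I1 I2.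
have H2 := Rintegral_itvcy_cvg I2 (@cvgr_idn R).
have cu : c * n%:R + d @[n --> \oo] --> +oo.
  apply: (@cvg_comp _ _ _ (fun n : nat => c * n%:R) (fun x => x + d) _ (pinfty_nbhs R)); last exact: cvg_addrr.
  by apply: (@cvg_comp _ _ _ (fun n : nat => n%:R) (fun x => c * x) _ (pinfty_nbhs R));
    [exact: cvgr_idn|exact: gt0_cvgMry].
have H1 := Rintegral_itvcy_cvg I1 cu.
have E : (fun n : nat => \int[mu]_(x in `[d, c * n%:R + d]) G x) =
    (fun n : nat => \int[mu]_(s in `[0, n%:R]) (G (c * s + d) * c)).
  by apply/funext => n; rewrite Rintegral_affine_itv.
rewrite E in H1.
exact: (cvg_unique _ H1 H2).
Qed.

Lemma lap_scale a c F M : 0 < a -> 0 < c -> continuous F ->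
  (forall s, 0 <= s -> `|F s| <= M) ->
  lap (a / c) F = c * lap a (fun s => F (c * s)).
Proof.
move=> a0 c0 cF FM.
have ac0 : 0 < a / c by rewrite divr_gt0.
have cFc : continuous (fun s => F (c * s)).
  move=> s; apply: continuous_comp; last exact: cF.
  by apply: cvgM; [exact: cvg_cst|exact: cvg_id].
have FcM s : 0 <= s -> `|F (c * s)| <= M by move=> s0; rewrite FM// mulr_ge0// ltW.
have mFc : measurable_fun `[(0 : R), +oo[ (fun s => F (c * s)).
  by apply: measurable_funTS; exact: continuous_measurable_fun.
have E s : expR (- (a / c) * (c * s + 0)) * F (c * s + 0) * c =
    c * (expR (- a * s) * F (c * s)).
  rewrite addr0 mulrC; congr (_ * (expR _ * _)).
  by rewrite mulNr mulrA divfK ?mulNr// lt0r_neq0.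
rewrite /lap (@Rintegral_affine _ c 0) //.
- rewrite -RintegralZl//; last exact: (lap_integrable a0 mFc FcM).
  by apply: eq_Rintegral => s _; rewrite E.
- by move=> s; apply: cvgM; [exact: continuous_expRM|exact: cF].
- apply: (lap_integrable _ _ FM) => //.
  by apply: measurable_funTS; exact: continuous_measurable_fun.
- have := integrableZl (mu := mu) (D := `[0, +oo[) (measurable_itv _) c (lap_integrable a0 mFc FcM).
  by apply: eq_integrable => // s _ /=; rewrite E EFinM.
Qed.

(** Substitute r = s + th and cut [[th, +oo[] at 0. The integral over [[th, 0]] is the contribution
    of the past; under the rescaling it tends to [- th] times the value of the profile at 0, and its
    average over Q is the source of Gamma on the right of the limit relation. *)
Lemma lap_shift a th h M : 0 < a -> th <= 0 -> continuous h ->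
  (forall s, th <= s -> `|h s| <= M) ->
  lap a (fun s => h (s + th)) =
  expR (a * th) * (lap a h + \int[mu]_(r in `[th, 0]) (expR (- a * r) * h r)).
Proof.
move=> a0 th0 ch hM.
have hM0 s : 0 <= s -> `|h s| <= M by move=> s0; rewrite hM// (le_trans th0).
have mh D : measurable_fun (D : set R) h.
  by apply: measurable_funTS; exact: continuous_measurable_fun.
pose G r := expR (- a * r) * h r.
have cG : continuous G by move=> s; apply: cvgM; [exact: continuous_expRM|exact: ch].
have I0 : mu.-integrable `[0, +oo[ (EFin \o G) by exact: (lap_integrable a0 (mh _) hM0).
have I1 : mu.-integrable `[th, 0] (EFin \o G).
  by apply: continuous_compact_integrable; [exact: segment_compact|exact: continuous_subspaceT].
have I1' : mu.-integrable `[th, 0[ (EFin \o G).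
  by apply: integrableS I1 => //; apply: subset_itvl; rewrite bnd_simp.
have U : `[th, +oo[%classic = `[th, 0[%classic `|` `[0, +oo[%classic :> set R.
  by rewrite -itv_bndbnd_setU// bnd_simp.
have dis : [disjoint `[th, 0[%classic & `[(0 : R), +oo[%classic].
  apply/disj_setPS => y [/=]; rewrite 2!in_itv/= => /andP[_ y0].
  by rewrite andbT leNgt y0.
have I2 : mu.-integrable `[th, +oo[ (EFin \o G).
  by rewrite U; apply: integrable_disjU.
have Ih : mu.-integrable `[0, +oo[ (EFin \o (fun s => expR (- a * s) * h (s + th))).
  apply: (@lap_integrable _ _ (fun s => h (s + th)) M) => //.
    apply: measurable_funTS; apply: continuous_measurable_fun => s.
    apply: continuous_comp; last exact: ch.
    by apply: cvgD; [exact: cvg_id|exact: cvg_cst].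
  by move=> s s0; rewrite hM// lerDr.
have E s : G (1 * s + th) * 1 = expR (- (a * th)) * (expR (- a * s) * h (s + th)).
  rewrite mulr1 mul1r /G mulrA -expRD; congr (expR _ * _); lra.
have -> : lap a h + \int[mu]_(r in `[th, 0]) (expR (- a * r) * h r) =
    \int[mu]_(x in `[th, +oo[) G x.
  rewrite U Rintegral_setU//; last by rewrite -U.
  by rewrite addrC Rintegral_itv_bndo_bndc.
rewrite (@Rintegral_affine G 1 th)//.
- rewrite (_ : \int[mu]_(s in `[0, +oo[) (G (1 * s + th) * 1) =
      \int[mu]_(s in `[0, +oo[) (expR (- (a * th)) * (expR (- a * s) * h (s + th)))); last first.
    by apply: eq_Rintegral => s _; rewrite E.
  by rewrite RintegralZl// mulrA -expRD subrr expR0 mul1r.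
- have := integrableZl (mu := mu) (D := `[0, +oo[) (measurable_itv _) (expR (- (a * th))) Ih.
  by apply: eq_integrable => // s _ /=; rewrite E EFinM.
Qed.

End affine.

(** * Joint measurability and Fubini's theorem for Laplace transforms *)

Section caratheodory.
Context {R : realType} d (X : measurableType d).
Notation mu := (@lebesgue_measure R).

(** Freezing the time at the point of the grid of step 1/(n+1) just below it gives a function that
    is measurable on each slab; continuity in time makes these functions converge to [F]. *)
Lemma measurable_caratheodory (F : R -> X -> R) :
  (forall t, measurable_fun setT (F t)) -> (forall x, continuous (F ^~ x)) ->
  measurable_fun (`[(0 : R), +oo[ `*` setT) (fun p : R * X => F p.1 p.2).
Proof.
move=> mF cF.
pose E n k : set (R * X) := (`[k%:R / n.+1%:R, k.+1%:R / n.+1%:R[%classic : set R) `*` setT.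
have mE n k : measurable (E n k) by apply: measurableX.
have UE n : `[(0 : R), +oo[%classic `*` [set: X] = \bigcup_k E n k.
  apply/seteqP; split => [[t x] /= [] | [t x] [k _ [/= ]]].
    rewrite in_itv /= andbT => t0 _.
    exists (Num.truncn (t * n.+1%:R)) => //; split => //=.
    have /Num.Theory.truncn_itv /andP[h1 h2] : 0 <= t * n.+1%:R by rewrite mulr_ge0.
    by rewrite in_itv /= ler_pdivrMr// h1 ltr_pdivlMr// h2.
  rewrite !in_itv /= andbT => /andP[h _] _; split => //.
  by apply: le_trans h; rewrite divr_ge0.
pose H n (p : R * X) := F ((Num.truncn (p.1 * n.+1%:R))%:R / n.+1%:R) p.2.
apply: (@measurable_fun_cvg _ _ R _ H) => [n|[t x] /=].
  rewrite (UE n); apply/measurable_fun_bigcup => // k.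
  apply: (@eq_measurable_fun _ _ _ _ _ (fun p : R * X => F (k%:R / n.+1%:R) p.2)).
    move=> [t x]; rewrite inE /= => -[/= + _]; rewrite in_itv /= => /andP[h1 h2].
    rewrite /H /=; congr (F (_%:R / _) _).
    apply/esym/truncn_def.
    by rewrite -ler_pdivrMr// h1 -ltr_pdivlMr.
  by apply: measurable_funTS; apply: measurableT_comp => //; exact: mF.
rewrite in_itv /= andbT => -[t0 _].
rewrite /H /=; apply: (@cvg_comp _ _ _ (fun n => (Num.truncn (t * n.+1%:R))%:R / n.+1%:R)
   (F^~ x) _ (nbhs t)); last exact: cF.
apply: (squeeze_cvgr (f := fun n => t - n.+1%:R^-1) (h := fun=> t)); last 2 first.
- rewrite -[X in _ --> X]subr0; apply: cvgB; first exact: cvg_cst.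
  exact: cvg_harmonic.
- exact: cvg_cst.
apply: nearW => n.
have /Num.Theory.truncn_itv /andP[h1 h2] : 0 <= t * n.+1%:R by rewrite mulr_ge0.
rewrite ler_pdivrMr// h1 andbT ler_pdivlMr// mulrBl mulVf// lerBlDr.
by rewrite natr1 ltW.
Qed.

End caratheodory.

Section fubini_lap.
Context {R : realType} d (X : measurableType d) (P : probability X R).
Notation mu := (@lebesgue_measure R).
Variables (F : R -> X -> R) (M : R).
Hypothesis mF : forall t, measurable_fun setT (F t).
Hypothesis cF : forall x, continuous (F ^~ x).
Hypothesis FM : forall t x, `|F t x| <= M.

Lemma continuous_prob_integral : continuous (fun t => \int[P]_x F t x).
Proof.
move=> t; apply/(@cvg_nbhsP _ R^o) => u ut.
apply: (@Rdominated_cvg _ _ _ P setT (fun n x => F (u n) x) (F t) (cst M)) => //.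
- by move=> x _; have /(@cvg_nbhsP _ R^o) := @cF x t; apply.
- exact: finite_measure_integrable_cst.
Qed.

(** Extension by zero off the half-line, so that Fubini applies on the whole product space. *)
Let Phi a : R * X -> R :=
  (fun p => expR (- a * p.1) * F p.1 p.2) \_ (`[(0 : R), +oo[ `*` setT).

Let mPhi a : measurable_fun setT (Phi a).
Proof.
apply: ((measurable_restrictT _ _).1 _); first exact: measurableX.
apply: measurable_funM; last exact: measurable_caratheodory.
apply: measurable_funTS.
apply: (@measurableT_comp _ _ _ _ _ _ (fun t => expR (- a * t))) => //.
exact: measurable_expRM.
Qed.

Let PhiE a t x : Phi a (t, x) = if 0 <= t then expR (- a * t) * F t x else 0.
Proof.
rewrite /Phi patchE; case: ifPn.
  by rewrite inE /= in_itv /= andbT => -[-> _].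
by rewrite notin_setE /= in_itv /= andbT => /not_andP[/negP/negPf ->|].
Qed.

Let PhiM a t x : `|Phi a (t, x)| <= ((fun s => expR (- a * s) * M) \_ `[0, +oo[) t.
Proof.
rewrite PhiE patchE; case: ifPn => t0.
  by rewrite mem_set /= ?in_itv /= ?t0// normrM ger0_norm ?expR_ge0// ler_wpM2l ?expR_ge0.
by rewrite normr0 memNset//= in_itv /= andbT; exact/negP.
Qed.

Let iPhi a : 0 < a -> (mu \x P)%E.-integrable setT (EFin \o Phi a).
Proof.
move=> a0.
have mE : measurable_fun setT (EFin \o Phi a) by exact/measurable_EFinP.
apply: ((integrable12ltyP mu P mE).2 _).
apply: (@le_lt_trans _ _ (\int[mu]_t (((fun s => expR (- a * s) * M) \_ `[0, +oo[) t)%:E)%E).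
  apply: ge0_le_integral => //.
  - by move=> t _; apply: integral_ge0 => x _; rewrite abse_ge0.
  - apply: (@measurable_fun_fubini_tonelli_F _ _ _ _ _ P (fun p => `|(Phi a p)%:E|%E)) => //.
    by apply: measurableT_comp => //; exact/measurable_EFinP.
  - apply/measurable_EFinP; apply: ((measurable_restrictT _ _).1 _) => //.
    by apply: measurable_funM => //; exact: measurable_expRM.
  - move=> t _; apply: (@le_trans _ _ (\int[P]_x (((fun s => expR (- a * s) * M) \_ `[0, +oo[) t)%:E)%E).
      apply: ge0_le_integral => //.
      + apply: measurableT_comp => //; apply/measurable_EFinP.
        exact: (measurable_fun_pair2 (f := Phi a)).
      + by move=> x _; rewrite lee_fin.
    by rewrite integral_cst// [X in (_ * X)%E](_ : _ = 1%E) ?mule1//; exact: probability_setT.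
have I := integrable_expRN_cst M a0.
have := (@integrable_mkcond _ _ R mu `[(0 : R), +oo[ _ (measurable_itv _)).1 I.
by rewrite restrict_EFin; exact: integrable_lty.
Qed.

Let GE a x : fubini_G mu (EFin \o Phi a) x =
  (\int[mu]_(t in `[0%R, +oo[) (expR (- a * t) * F t x)%:E)%E.
Proof.
rewrite /fubini_G [RHS]integral_mkcond; apply: eq_integral => t _ /=.
rewrite PhiE patchE; case: ifPn => t0.
  by rewrite mem_set//= in_itv/= t0.
by rewrite memNset//= in_itv/= andbT; exact/negP.
Qed.

Lemma measurable_lap a : 0 < a -> measurable_fun setT (fun x => lap a (F ^~ x)).
Proof.
move=> a0; have := measurable_fubini_G (iPhi a0) => /(measurableT_comp (@fine_measurable R setT measurableT)).
by apply: eq_measurable_fun => x _; rewrite /= GE.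
Qed.

Lemma lap_fubini a : 0 < a ->
  lap a (fun t => \int[P]_x F t x) = \int[P]_x lap a (F ^~ x).
Proof.
move=> a0; have mFx x : measurable_fun `[(0 : R), +oo[ (F ^~ x).
  by apply: measurable_funTS; apply: continuous_measurable_fun; exact: cF.
transitivity (fine (\int[mu]_t fubini_F P (EFin \o Phi a) t)%E).
  rewrite /lap /Rintegral integral_mkcond; congr fine; apply: eq_integral => t _.
  rewrite patchE /fubini_F; under [in RHS]eq_integral => x _ do rewrite -[(EFin \o Phi a) (t, x)]/((Phi a (t, x))%:E) PhiE.
  case: (lerP 0 t) => t0.
    rewrite mem_set /= ?in_itv /= ?t0//.
    rewrite EFinM /Rintegral fineK; last first.
      by apply: (integrable_fin_num measurableT (prob_integrable P (mF t) (FM t))).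
    rewrite -integralZl//; last exact: (prob_integrable P (mF t) (FM t)).
  by rewrite memNset ?integral0//= in_itv /= andbT leNgt t0.
rewrite (Fubini (iPhi a0)); congr fine; apply: eq_integral => x _.
rewrite -/(fubini_G mu (EFin \o Phi a) x) GE /lap /Rintegral fineK//.
apply: integrable_fin_num => //.
exact: (lap_integrable a0 (mFx x) (fun t _ => FM t x)).
Qed.

End fubini_lap.

(** * Ridge test functions *)

Section smooth.
Context {R : realType}.
Implicit Types (B d y : R).

Definition dot N (u v : 'rV[R]_N) : R := \sum_i u 0 i * v 0 i.

Lemma dotDr N (u v w : 'rV[R]_N) : dot u (v + w) = dot u v + dot u w.
Proof. by rewrite -big_split; apply: eq_bigr => i _; rewrite mxE mulrDr. Qed.

Lemma dotZr N c (u v : 'rV[R]_N) : dot u (c *: v) = c * dot u v.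
Proof. by rewrite mulr_sumr; apply: eq_bigr => i _; rewrite mxE mulrCA. Qed.

Lemma dotZl N c (u v : 'rV[R]_N) : dot (c *: u) v = c * dot u v.
Proof. by rewrite mulr_sumr; apply: eq_bigr => i _; rewrite mxE mulrA. Qed.

Lemma continuous_dot N (u : 'rV[R]_N) : continuous (dot u).
Proof.
by apply: cts_sum => i _; apply: ctsM; [exact: cts_cst|exact: coord_continuous].
Qed.

(** A single constant keeps the later bounds short. The Lipschitz condition on [k2] replaces a third
    derivative: it is what the cubic form of the Taylor remainder needs. *)
Definition smooth3 B (k k1 k2 : R -> R) : Prop :=
  [/\ forall y, is_derive y 1 k (k1 y), forall y, is_derive y 1 k1 (k2 y),
      (forall y, [/\ `|k y| <= B, `|k1 y| <= B & `|k2 y| <= B]) &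
      forall x y, `|k2 x - k2 y| <= B * `|x - y|].

Lemma is_derive_continuous (f df : R -> R) :
  (forall y, is_derive y 1 f (df y)) -> continuous f.
Proof.
move=> dF y; apply: differentiable_continuous; apply/derivable1_diffP.
by case: (dF y).
Qed.

(** The derivative is bounded only on the interval of radius [|d|], so that the lemma can be
    iterated: a bound growing with the distance to 0 gains one power of [|d|] each time. *)
Lemma mean_value_bound (f df : R -> R) (M d : R) :
  (forall y, is_derive y 1 f (df y)) ->
  (forall y, `|y| <= `|d| -> `|df y| <= M) -> `|f d - f 0| <= M * `|d|.
Proof.
move=> dF dM; have cf := is_derive_continuous dF.
have [d0|d0|->] := ltgtP d 0; last by rewrite subrr !normr0 mulr0.
- have [c] := MVT d0 (fun x _ => dF x) (continuous_subspaceT cf).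
  rewrite in_itv /= => /andP[dc c0] E.
  rewrite distrC E normrM sub0r normrN ler_wpM2r// dM//.
  by rewrite !ltr0_norm// lerN2 ltW.
- have [c] := MVT d0 (fun x _ => dF x) (continuous_subspaceT cf).
  rewrite in_itv /= => /andP[c0 cd] E.
  by rewrite E normrM subr0 ler_wpM2r// dM// !gtr0_norm// ltW.
Qed.

Lemma lipschitz_continuous (f : R -> R) B :
  (forall x y, `|f x - f y| <= B * `|x - y|) -> continuous f.
Proof.
move=> fL x; apply/cvgrPdist_le => e e0; near=> y.
rewrite (le_trans (fL _ _))//.
have B1 : 0 < `|B| + 1 by rewrite ltr_wpDl.
apply: (@le_trans _ _ ((`|B| + 1) * `|x - y|)).
  by rewrite ler_wpM2r// (le_trans (ler_norm _))// lerDl.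
rewrite mulrC -ler_pdivlMr//; near: y.
apply: cvgr_dist_le; first exact: cvg_id.
by rewrite divr_gt0.
Unshelve. all: by end_near. Qed.

Section taylor.
Variables (B : R) (k k1 k2 : R -> R).
Hypothesis hk : smooth3 B k k1 k2.

Let dk y : is_derive y 1 k (k1 y). Proof. by case: hk. Qed.
Let dk1 y : is_derive y 1 k1 (k2 y). Proof. by case: hk. Qed.

Lemma smooth3_ge0 : 0 <= B.
Proof. by case: hk => _ _ /(_ 0)[+ _ _] _; apply: le_trans. Qed.

Lemma is_derive_shift y (f df : R -> R) : (forall y, is_derive y 1 f (df y)) ->
  forall s : R, is_derive s 1 (fun s => f (y + s)) (df (y + s)).
Proof.
move=> dF s; have ? := dF (y + s).
have H : is_derive s (1 : R) (fun s : R => y + s) (1 : R).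
  by apply: is_derive_eq; rewrite add0r mulr1.
by have := is_derive1_comp (dF (y + s)) H; rewrite mulr1.
Qed.

Lemma smooth3_lip x y : `|k x - k y| <= B * `|x - y|.
Proof.
have dK := is_derive_shift y dk.
have := @mean_value_bound (fun s => k (y + s)) (fun s => k1 (y + s)) B (x - y) dK.
by rewrite /= addr0 (addrC y) subrK; apply => s _; case: hk => _ _ /(_ (y + s))[].
Qed.

Lemma smooth3_lip1 x y : `|k1 x - k1 y| <= B * `|x - y|.
Proof.
have dK := is_derive_shift y dk1.
have := @mean_value_bound (fun s => k1 (y + s)) (fun s => k2 (y + s)) B (x - y) dK.
by rewrite /= addr0 (addrC y) subrK; apply => s _; case: hk => _ _ /(_ (y + s))[].
Qed.

Lemma smooth3_taylor1 y d : `|k (y + d) - k y - d * k1 y| <= B * d ^+ 2.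
Proof.
have dK (s : R) : is_derive s 1 (fun s => k (y + s) - s * k1 y) (k1 (y + s) - k1 y).
  have ? := is_derive_shift y dk s.
  by apply: is_derive_eq; rewrite /GRing.scale /=; ring.
have := @mean_value_bound _ _ (B * `|d|) d dK.
rewrite mul0r subr0 addr0 -mulrA -expr2 real_normK ?num_real//.
rewrite addrAC; apply => s sd.
rewrite (le_trans (smooth3_lip1 _ _))// addrAC subrr add0r.
by rewrite ler_wpM2l// smooth3_ge0.
Qed.

(** The first bound uses that [k2] is bounded and is integrable against a law with second moments;
    the second uses that [k2] is Lipschitz and is of higher order for small [d]. Each comes from the
    mean value bound applied to [k1] and then to [k], with the Taylor polynomial subtracted. *)
Lemma smooth3_taylor2 y d :
  `|k (y + d) - k y - d * k1 y - d ^+ 2 / 2 * k2 y| <=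
  Num.min (2 * B * d ^+ 2) (B * `|d| ^+ 3).
Proof.
have dK1 (s : R) : is_derive s 1 (fun s => k1 (y + s) - s * k2 y) (k2 (y + s) - k2 y).
  have ? := is_derive_shift y dk1 s.
  by apply: is_derive_eq; rewrite /GRing.scale /=; ring.
have dK (s : R) : is_derive s 1 (fun s => k (y + s) - s * k1 y - s ^+ 2 / 2 * k2 y)
    (k1 (y + s) - k1 y - s * k2 y).
  have ? := is_derive_shift y dk s.
  by apply: is_derive_eq; rewrite /GRing.scale /=; field.
have B0 := smooth3_ge0.
have E : k (y + d) - k y - d * k1 y - d ^+ 2 / 2 * k2 y =
   (k (y + d) - d * k1 y - d ^+ 2 / 2 * k2 y) -
   (k (y + 0) - 0 * k1 y - 0 ^+ 2 / 2 * k2 y) by rewrite addr0; ring.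
have n2 : d ^+ 2 = `|d| ^+ 2 by rewrite real_normK ?num_real.
have H (v M : R) : (forall u, `|u| <= `|v| -> `|k2 (y + u) - k2 y| <= M) ->
    `|k1 (y + v) - k1 y - v * k2 y| <= M * `|v|.
  move=> hM; have := @mean_value_bound _ _ M v dK1 hM.
  by rewrite mul0r subr0 addr0 addrAC.
rewrite E le_min; apply/andP; split.
- have -> : 2 * B * d ^+ 2 = (2 * B * `|d|) * `|d| by rewrite n2; ring.
  apply: (mean_value_bound dK) => s sd.
  apply: (@le_trans _ _ (2 * B * `|s|)); last by rewrite ler_wpM2l// mulr_ge0.
  have h z : `|k2 z| <= B by case: hk => _ _ /(_ z)[].
  by apply: H => u _; rewrite (le_trans (ler_normB _ _))// mulr_natl mulr2n lerD.
- have -> : B * `|d| ^+ 3 = (B * `|d| * `|d|) * `|d| by ring.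
  apply: (mean_value_bound dK) => s sd.
  apply: (@le_trans _ _ (B * `|s| * `|s|)); last by rewrite ler_pM// ?mulr_ge0// ler_wpM2l.
  apply: H => u us; case: hk => _ _ _ /(_ (y + u) y) h.
  by rewrite (le_trans h)// addrAC subrr add0r ler_wpM2l.
Qed.

Lemma smooth3_continuous : continuous k.
Proof. exact: is_derive_continuous dk. Qed.
Lemma smooth3_continuous1 : continuous k1.
Proof. exact: is_derive_continuous dk1. Qed.
Lemma smooth3_continuous2 : continuous k2.
Proof. by case: hk => _ _ _; exact: lipschitz_continuous. Qed.

End taylor.

Lemma smooth3_cos : smooth3 1 (@cos R) (fun y => - sin y) (fun y => - cos y).
Proof.
have L x y : `|cos x - cos y| <= `|x - y| :> R.
  have dK := is_derive_shift y (fun y => is_derive_cos y).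
  have := @mean_value_bound (fun s => cos (y + s)) (fun s => - sin (y + s)) 1 (x - y) dK.
  rewrite /= addr0 (addrC y) subrK mul1r; apply => s _.
  by rewrite normrN ler_norml sin_geN1 sin_le1.
split.
- by move=> y; exact: is_derive_cos.
- by move=> y; have ? := is_derive_sin y; apply: is_derive_eq.
- by move=> y; rewrite !normrN !ler_norml !cos_geN1 !cos_le1 !sin_geN1 !sin_le1.
- by move=> x y; rewrite mul1r -opprD normrN; exact: L.
Qed.

Lemma smooth3_sin : smooth3 1 (@sin R) cos (fun y => - sin y).
Proof.
have L x y : `|sin x - sin y| <= `|x - y| :> R.
  have dK := is_derive_shift y (fun y => is_derive_sin y).
  have := @mean_value_bound (fun s => sin (y + s)) (fun s => cos (y + s)) 1 (x - y) dK.
  rewrite /= addr0 (addrC y) subrK mul1r; apply => s _.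
  by rewrite ler_norml cos_geN1 cos_le1.
split.
- by move=> y; exact: is_derive_sin.
- by move=> y; exact: is_derive_cos.
- by move=> y; rewrite !normrN !ler_norml !cos_geN1 !cos_le1 !sin_geN1 !sin_le1.
- by move=> x y; rewrite mul1r -opprD normrN; exact: L.
Qed.

End smooth.

Lemma cvg_dist0 {R : realType} T (F : set_system T) (FF : Filter F) (f : T -> R) (l : R) :
  f x @[x --> F] --> l -> `|f x - l| @[x --> F] --> (0 : R).
Proof.
move=> /cvgrPdist_le h; apply/cvgrPdist_le => e e0; apply: filterS (h e e0) => x.
by rewrite sub0r normrN normr_id distrC.
Qed.

Section ridge.
Context {R : realType} {N : nat} (nu : R -> probability (Borel 'rV[R]_N) R).
Hypothesis nu_c : forall f : 'rV[R]_N -> R, is_Cb f ->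
  continuous (fun t => \int[nu t]_x f x).

(* At [y = - dot xi K * t] this tests the law recentred by the drift [K t]. *)
Definition ridge (f : R -> R) (xi : 'rV[R]_N) (t y : R) : R :=
  \int[nu t]_x f (dot xi x + y).

Section ridge_lipschitz.
Variables (f : R -> R) (B L : R).
Hypothesis cf : continuous f.
Hypothesis fB : forall y, `|f y| <= B.

Lemma continuous_ridge xi y : continuous (fun x : 'rV[R]_N => f (dot xi x + y)).
Proof.
apply: cts_comp cf _; apply: ctsD; [exact: continuous_dot|exact: cts_cst].
Qed.

Lemma ridge_Cb xi y : is_Cb (fun x : 'rV[R]_N => f (dot xi x + y)).
Proof. by split; [exact: continuous_ridge|exists B]. Qed.

Lemma ridge_integrable xi t y :
  (nu t).-integrable setT (EFin \o (fun x => f (dot xi x + y))).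
Proof. by apply: (@prob_integrable _ _ _ _ _ B) => //; apply: borel_measurable; exact: continuous_ridge. Qed.

Lemma ridge_bound xi t y : `|ridge f xi t y| <= B.
Proof. by apply: prob_norm_le => //; apply: borel_measurable; exact: continuous_ridge. Qed.

(** The argument of [f] tends to 0 at every [x], so the limit forgets the law [nu t]. This evaluates
    the terms of the equation that are not amplified by the growth of the Laplace transforms. *)
Lemma ridge_dirac0 (zeta : 'rV[R]_N) (c y : R^nat) t :
  c n @[n --> \oo] --> 0 -> y n @[n --> \oo] --> 0 ->
  ridge f (c n *: zeta) t (y n) @[n --> \oo] --> f 0.
Proof.
move=> c0 y0; rewrite -[X in _ --> X](prob_cst (nu t)).
apply: (@Rdominated_cvg _ _ _ (nu t) setT (fun n x => f (dot (c n *: zeta) x + y n)) (cst (f 0)) (cst B)) => //.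
- by move=> n; apply: borel_measurable; exact: continuous_ridge.
- move=> x _; apply: (@cvg_comp _ _ _ (fun n => dot (c n *: zeta) x + y n) f _ (nbhs 0)); last exact: cf.
  have : dot (c n *: zeta) x + y n @[n --> \oo] --> 0 * dot zeta x + 0.
    under eq_fun do rewrite dotZl.
    by apply: cvgD => //; apply: cvgM => //; exact: cvg_cst.
  by rewrite mul0r addr0.
- exact: finite_measure_integrable_cst.
Qed.

Hypothesis fL : forall x y, `|f x - f y| <= L * `|x - y|.

Lemma ridge_lip xi t y y' : `|ridge f xi t y - ridge f xi t y'| <= L * `|y - y'|.
Proof.
apply: prob_dist_le => [||x]; [exact: ridge_integrable|exact: ridge_integrable|].
by rewrite (le_trans (fL _ _))// opprD addrACA subrr add0r.
Qed.

(** Narrow continuity gives the limit in time for a fixed shift [y]; the Lipschitz bound in [y] is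
    uniform in time, so the shift may move as well. *)
Lemma ridge_cvg T (F : set_system T) (FF : Filter F) xi (t_ y_ : T -> R) t y :
  t_ s @[s --> F] --> t -> y_ s @[s --> F] --> y ->
  ridge f xi (t_ s) (y_ s) @[s --> F] --> ridge f xi t y.
Proof.
move=> ct cy.
have -> : (fun s => ridge f xi (t_ s) (y_ s)) =
    (fun s => ridge f xi (t_ s) y + (ridge f xi (t_ s) (y_ s) - ridge f xi (t_ s) y)).
  by apply/funext => s; rewrite addrC subrK.
rewrite -[X in _ --> X]addr0; apply: cvgD.
  apply: (@cvg_comp _ _ _ t_ (fun t => ridge f xi t y) _ (nbhs t)) => //.
  exact: (nu_c (ridge_Cb xi y)).
apply/norm_cvg0P.
apply: (squeeze_cvgr (f := cst 0) (h := fun s => L * `|y_ s - y|)).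
- by apply: nearW => s; rewrite normr_ge0/= ridge_lip.
- exact: cvg_cst.
- rewrite -[X in _ --> X](mulr0 L); apply: cvgM; [exact: cvg_cst|exact: cvg_dist0].
Qed.

Lemma continuous_ridge_t xi (t_ y_ : R -> R) : continuous t_ -> continuous y_ ->
  continuous (fun s => ridge f xi (t_ s) (y_ s)).
Proof. by move=> ct cy s; apply: ridge_cvg; [exact: ct|exact: cy]. Qed.

End ridge_lipschitz.

(** Caratheodory's form of differentiability: continuity of [c] at [t] suffices, which suits a [c]
    built from difference quotients. *)
Lemma is_derive_mul_id (c : R -> R) (t : R) : {for t, continuous c} ->
  is_derive t 1 (fun s => (s - t) * c s) (c t).
Proof.
move=> cc.
have H : (fun h : R => h^-1 *: ((h *: 1 + t - t) * c (h *: 1 + t) - (t - t) * c t)) @ 0^' --> c t.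
  have E : {near (0 : R)^', (fun h => c (h + t)) =1
      (fun h : R => h^-1 *: ((h *: 1 + t - t) * c (h *: 1 + t) - (t - t) * c t))}.
    near=> h; rewrite subrr mul0r subr0 /GRing.scale /= mulr1 addrK mulKf//.
    by near: h; exact: nbhs_dnbhs_neq.
  apply: cvg_trans (near_eq_cvg E) _.
  apply: (@cvg_comp _ _ _ (fun h : R => h + t) c _ (nbhs t)); last exact: cc.
  apply: cvg_within_filter.
  have : h + t @[h --> (0 : R)] --> 0 + t by apply: cvgD; [exact: cvg_id|exact: cvg_cst].
  by rewrite add0r.
apply: DeriveDef; first by apply/cvg_ex; exists (c t).
exact/cvg_lim.
Unshelve. all: by end_near. Qed.

Section ridge_derivative.
Variables (B : R) (k k1 k2 : R -> R).
Hypothesis hk : smooth3 B k k1 k2.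
Let kB y : `|k y| <= B. Proof. by case: hk => _ _ /(_ y)[]. Qed.
Let k1B y : `|k1 y| <= B. Proof. by case: hk => _ _ /(_ y)[]. Qed.
Let k2B y : `|k2 y| <= B. Proof. by case: hk => _ _ /(_ y)[]. Qed.
Let ck := smooth3_continuous hk.
Let ck1 := smooth3_continuous1 hk.
Let ck2 := smooth3_continuous2 hk.

Lemma ridge_taylor1 xi t y d :
  `|ridge k xi t (y + d) - ridge k xi t y - d * ridge k1 xi t y| <= B * d ^+ 2.
Proof.
have I0 y' := ridge_integrable ck kB xi t y'.
have I1 y' := ridge_integrable ck1 k1B xi t y'.
rewrite /ridge -RintegralB// -RintegralZl//.
have Id : (nu t).-integrable setT (EFin \o (fun x => d * k1 (dot xi x + y))).
  have := integrableZl measurableT d (I1 y); apply: eq_integrable => // x _.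
have IB : (nu t).-integrable setT (EFin \o (fun x => k (dot xi x + (y + d)) - k (dot xi x + y))).
  have := integrableB measurableT (I0 (y + d)) (I0 y); apply: eq_integrable => // x _.
rewrite -RintegralB//; apply: prob_norm_le => [|x].
  apply: measurable_funB; apply/measurable_EFinP; [exact: measurable_int IB|exact: measurable_int Id].
by rewrite addrA (smooth3_taylor1 hk).
Qed.

Lemma ridge_taylor2 xi t y d :
  `|ridge k xi t (y + d) - ridge k xi t y - d * ridge k1 xi t y
    - d ^+ 2 / 2 * ridge k2 xi t y| <= Num.min (2 * B * d ^+ 2) (B * `|d| ^+ 3).
Proof.
have I0 y' := ridge_integrable ck kB xi t y'.
have I1 y' := ridge_integrable ck1 k1B xi t y'.
have I2 y' := ridge_integrable ck2 k2B xi t y'.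
have Id : (nu t).-integrable setT (EFin \o (fun x => d * k1 (dot xi x + y))).
  have := integrableZl measurableT d (I1 y); apply: eq_integrable => // x _.
have Id2 : (nu t).-integrable setT (EFin \o (fun x => d ^+ 2 / 2 * k2 (dot xi x + y))).
  have := integrableZl measurableT (d ^+ 2 / 2) (I2 y); apply: eq_integrable => // x _.
have IB : (nu t).-integrable setT (EFin \o (fun x => k (dot xi x + (y + d)) - k (dot xi x + y))).
  have := integrableB measurableT (I0 (y + d)) (I0 y); apply: eq_integrable => // x _.
have IB1 : (nu t).-integrable setT (EFin \o (fun x => k (dot xi x + (y + d)) - k (dot xi x + y)
    - d * k1 (dot xi x + y))).
  have := integrableB measurableT IB Id; apply: eq_integrable => // x _.
have -> : ridge k xi t (y + d) - ridge k xi t y - d * ridge k1 xi t y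
    - d ^+ 2 / 2 * ridge k2 xi t y =
    \int[nu t]_x (k (dot xi x + (y + d)) - k (dot xi x + y)
    - d * k1 (dot xi x + y) - d ^+ 2 / 2 * k2 (dot xi x + y)).
  by rewrite (RintegralB measurableT IB1 Id2) (RintegralB measurableT IB Id)
    (RintegralB measurableT (I0 _) (I0 _)) !RintegralZl.
apply: prob_norm_le => [|x].
  by apply: measurable_funB; apply/measurable_EFinP; [exact: measurable_int IB1|exact: measurable_int Id2].
by rewrite addrA (smooth3_taylor2 hk).
Qed.

(** The delay equation speaks of test functions fixed in time, whereas the recentred one moves. [D]
    is the time derivative with the shift frozen at its value at [t]; only the variation of the
    shift remains to be differentiated. *)
Lemma is_derive_ridge xi (kappa t D : R) :
  is_derive t 1 (fun s => ridge k xi s (- kappa * t)) D ->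
  is_derive t 1 (fun s => ridge k xi s (- kappa * s))
    (- kappa * ridge k1 xi t (- kappa * t) + D).
Proof.
move=> dD; set y0 := - kappa * t.
(* The difference quotient in the shift alone, completed at [t] by its expected limit; by
   [ridge_taylor1] it stays within [B * kappa ^+ 2] times the distance from [s] to [t] of
   [- kappa * ridge k1 xi s y0]. *)
pose c s := if s == t then - kappa * ridge k1 xi t y0
  else (s - t)^-1 * (ridge k xi s (- kappa * s) - ridge k xi s y0).
have E : (fun s => ridge k xi s (- kappa * s)) = (fun s => (s - t) * c s + ridge k xi s y0).
  apply/funext => s; rewrite /c; case: eqP => [->|/eqP st].
    by rewrite subrr mul0r add0r.
  by rewrite mulrA divff ?subr_eq0// mul1r subrK.
have cc : {for t, continuous c}.
  rewrite /prop_for /continuous_at {2}/c eqxx.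
  have H : (- kappa * ridge k1 xi s y0) @[s --> t] --> - kappa * ridge k1 xi t y0.
    apply: cvgM; first exact: cvg_cst.
    by apply: (ridge_cvg ck1 k1B (smooth3_lip1 hk)); [exact: cvg_id|exact: cvg_cst].
  have -> : c = (fun s => - kappa * ridge k1 xi s y0 + (c s - - kappa * ridge k1 xi s y0)).
    by apply/funext => s; rewrite addrC subrK.
  rewrite -[X in _ --> X]addr0; apply: cvgD => //.
  apply/norm_cvg0P.
  apply: (squeeze_cvgr (f := cst 0) (h := fun s => B * kappa ^+ 2 * `|s - t|)).
  - apply: nearW => s; rewrite normr_ge0 /c; case: eqP => [->|/eqP st].
      by rewrite !subrr !normr0 mulr0 lexx.
    have st0 : s - t != 0 by rewrite subr_eq0.
    have := ridge_taylor1 xi s y0 (- kappa * (s - t)).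
    have -> : y0 + - kappa * (s - t) = - kappa * s by rewrite /y0; ring.
    set u := ridge _ _ _ _ - _; set v := ridge k1 _ _ _.
    have -> : (s - t)^-1 * u - - kappa * v = (s - t)^-1 * (u - - kappa * (s - t) * v) by field.
    move=> h; rewrite normrM normfV /= ler_pdivrMl ?normr_gt0//.
    apply: le_trans h _; rewrite exprMn sqrrN.
    have -> : (s - t) ^+ 2 = `|s - t| ^+ 2 by rewrite real_normK ?num_real.
    by rewrite le_eqVlt; apply/orP; left; apply/eqP; ring.
  - exact: cvg_cst.
  - rewrite -[X in _ --> X](mulr0 (B * kappa ^+ 2)); apply: cvgM; [exact: cvg_cst|apply: cvg_dist0; exact: cvg_id].
rewrite E.
have H1 := is_derive_mul_id cc.
have -> : - kappa * ridge k1 xi t y0 = c t by rewrite /c eqxx.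
exact: is_deriveD.
Qed.

End ridge_derivative.
End ridge.

(** * The delay equation tested on ridge functions *)

Section delay_laplace.
Context {R : realType} {N : nat}.
Notation X := (R * 'rV[R]_N)%type.
Context (Q : probability (Borel X) R) (nu : R -> probability (Borel 'rV[R]_N) R).
Variables (al : R -> X -> R) (ai th : X -> R) (A M0 beta : R).
Hypothesis nu_c : forall f : 'rV[R]_N -> R, is_Cb f ->
  continuous (fun t => \int[nu t]_x f x).
Hypothesis al_t : forall p, continuous (al ^~ p).
Hypothesis al_p : forall t, continuous (al t).
Hypothesis al_A : forall t p, `|al t p| <= A.
Hypothesis ai_c : continuous ai.
Hypothesis ai_A : forall p, `|ai p| <= A.
Hypothesis al_ai : forall (t : R) p, 0 <= t -> `|al t p - ai p| <= M0 * expR (- beta * t).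
Hypothesis th_c : continuous th.
Hypothesis th_b : forall p, -1 <= th p <= 0.
Hypothesis beta_gt0 : 0 < beta.
Hypothesis delay_eq : forall (h : R -> R) (C : R), continuous h ->
  (forall y, `|h y| <= C) -> (forall x y, `|h x - h y| <= C * `|x - y|) ->
  forall xi y (t : R), 0 < t -> is_derive t 1 (fun s => ridge nu h xi s y)
    (\int[Q]_p (al t p *
      (ridge nu h xi (t + th p) (dot xi p.2 + y) - ridge nu h xi t y))).

Variables (B : R) (k k1 k2 : R -> R).
Hypothesis hk : smooth3 B k k1 k2.
Let kB y : `|k y| <= B. Proof. by case: hk => _ _ /(_ y)[]. Qed.
Let k1B y : `|k1 y| <= B. Proof. by case: hk => _ _ /(_ y)[]. Qed.
Let k2B y : `|k2 y| <= B. Proof. by case: hk => _ _ /(_ y)[]. Qed.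
Let ck := smooth3_continuous hk.
Let ck1 := smooth3_continuous1 hk.
Let ck2 := smooth3_continuous2 hk.
Let kL := smooth3_lip hk.
Let k1L := smooth3_lip1 hk.
Let k2L x y : `|k2 x - k2 y| <= B * `|x - y|. Proof. by case: hk. Qed.

Definition lap_ridge (f : R -> R) (xi : 'rV[R]_N) (b kappa d : R) : R :=
  lap b (fun t => ridge nu f xi t (- kappa * t + d)).

Let cline (kappa d : R) : continuous (fun t : R => - kappa * t + d).
Proof.
by apply: ctsD; [apply: ctsM; [exact: cts_cst|move=> x; exact: cvg_id]|exact: cts_cst].
Qed.

Let cid : continuous (fun t : R => t). Proof. by move=> x; exact: cvg_id. Qed.

Section profile.
Variables (f : R -> R).
Hypothesis cf : continuous f.
Hypothesis fB : forall y, `|f y| <= B.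
Hypothesis fL : forall x y, `|f x - f y| <= B * `|x - y|.

Lemma continuous_ridge_line xi kappa d :
  continuous (fun t => ridge nu f xi t (- kappa * t + d)).
Proof. by apply: (continuous_ridge_t nu_c cf fB fL). Qed.

Lemma measurable_ridge_line xi kappa d (D : set R) :
  measurable_fun D (fun t => ridge nu f xi t (- kappa * t + d)).
Proof.
by apply: measurable_funTS; apply: continuous_measurable_fun; exact: continuous_ridge_line.
Qed.

Lemma lap_ridge_bound xi b kappa d : 0 < b -> `|lap_ridge f xi b kappa d| <= B / b.
Proof.
move=> b0; apply: lap_norm_le => // [|s _]; first exact: measurable_ridge_line.
exact: ridge_bound.
Qed.

Lemma lap_ridge_lip xi b kappa d d' : 0 < b ->
  `|lap_ridge f xi b kappa d - lap_ridge f xi b kappa d'| <= B / b * `|d - d'|.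
Proof.
move=> b0; have m := @measurable_ridge_line xi kappa.
rewrite /lap_ridge -(lapB b0 (m d _) (fun s _ => ridge_bound nu cf fB xi s _)
  (m d' _) (fun s _ => ridge_bound nu cf fB xi s _)).
have -> : B / b * `|d - d'| = B * `|d - d'| / b by rewrite mulrAC.
apply: lap_norm_le => // [|s _]; first exact: measurable_funB.
apply: le_trans (ridge_lip nu cf fB fL _ _ _ _) _.
by rewrite opprD addrACA subrr add0r.
Qed.

Lemma continuous_lap_ridge xi b kappa : 0 < b -> continuous (lap_ridge f xi b kappa).
Proof.
move=> b0; apply: (@lipschitz_continuous _ _ (B / b)) => x y; exact: lap_ridge_lip.
Qed.

End profile.

Section identity.
Variables (xi : 'rV[R]_N) (kappa b : R).
Hypothesis b0 : 0 < b.

Let P t := ridge nu k xi t (- kappa * t).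
Let PE : P = (fun t => ridge nu k xi t (- kappa * t + 0)).
Proof. by apply/funext => t; rewrite addr0. Qed.
Let cP : continuous P.
Proof. by rewrite PE; exact: continuous_ridge_line. Qed.
Let PB t : `|P t| <= B. Proof. exact: ridge_bound. Qed.

(** The gain term of the delay equation: the law at the delayed time, the profile displaced by the
    jump, and the recentring still that of time [t]. *)
Definition shifted_ridge t (p : X) := ridge nu k xi (t + th p) (- kappa * t + dot xi p.2).
Local Notation S := shifted_ridge.

Let cdot2 (u : 'rV[R]_N) : continuous (fun p : X => dot u p.2).
Proof.
move=> p; apply: (@continuous_comp _ _ _ (fun p : X => p.2) (dot u)).
  exact: cvg_snd.
exact: continuous_dot.
Qed.

Let SB t p : `|S t p| <= B. Proof. exact: ridge_bound. Qed.
Let cS_t p : continuous (S ^~ p).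
Proof.
apply: (continuous_ridge_t nu_c ck kB kL) => //.
by apply: ctsD; [exact: cid|exact: cts_cst].
Qed.
Let cS_p t : continuous (S t).
Proof.
move=> p; apply: (ridge_cvg nu_c ck kB kL).
  by apply: cvgD; [exact: cvg_cst|exact: th_c].
by apply: cvgD; [exact: cvg_cst|exact: cdot2].
Qed.

(* The contribution of [alpha - alpha_oo], which decays exponentially in time. *)
Definition transient t := \int[Q]_p ((al t p - ai p) * (S t p - P t)).

Let B0 : 0 <= B. Proof. exact: smooth3_ge0 hk. Qed.

Let cts_mul_t (a : R -> X -> R) p : continuous (a ^~ p) ->
  continuous (fun t => a t p * (S t p - P t)).
Proof. by move=> ca; apply: ctsM => //; apply: ctsB => //; exact: cS_t. Qed.

Let cts_mul_p (a : R -> X -> R) t : continuous (a t) ->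
  continuous (fun p => a t p * (S t p - P t)).
Proof. by move=> ca; apply: ctsM => //; apply: ctsB; [exact: cS_p|exact: cts_cst]. Qed.

Let mul_bound (c C : R) t p : `|c| <= C -> `|c * (S t p - P t)| <= C * (2 * B).
Proof.
move=> h; rewrite normrM ler_pM// (le_trans (ler_normB _ _))// mulr_natl mulr2n.
by rewrite lerD// ?SB ?PB.
Qed.

Lemma measurable_transient_integrand t :
  measurable_fun setT (fun p : Borel X => (al t p - ai p) * (S t p - P t)).
Proof.
apply: borel_measurable2; apply: (@cts_mul_p (fun t p => al t p - ai p)).
by apply: ctsB => //; exact: al_p.
Qed.

Lemma continuous_transient : continuous transient.
Proof.
apply: (@continuous_prob_integral _ _ _ Q (fun t p => (al t p - ai p) * (S t p - P t)) ((A + A) * (2 * B))).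
- exact: measurable_transient_integrand.
- move=> p; apply: (@cts_mul_t (fun t p => al t p - ai p)).
  by apply: ctsB; [exact: al_t|exact: cts_cst].
- by move=> t p; apply: mul_bound => //; rewrite (le_trans (ler_normB _ _))// lerD.
Qed.

(** Transform of the derivative of the recentred ridge: the moving centre gives the term in [k1],
    and splitting the rate as [ai] plus its deviation isolates [transient], so that the rate in the
    remaining integral is constant in time and passes through the Laplace transform. *)
Lemma lap_identity :
  b * lap_ridge k xi b kappa 0 - ridge nu k xi 0 0 =
  - kappa * lap_ridge k1 xi b kappa 0 + lap b transient +
  \int[Q]_p (ai p * (lap b (S ^~ p) - lap_ridge k xi b kappa 0)).
Proof.
pose U t := \int[Q]_p (ai p * (S t p - P t)).
pose V t := \int[Q]_p (al t p * (S t p - P t)).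
pose W t := - kappa * ridge nu k1 xi t (- kappa * t + 0).
have mb (a : X -> R) t : continuous a -> measurable_fun setT (fun p : Borel X => a p * (S t p - P t)).
  by move=> ca; apply: borel_measurable2; exact: (@cts_mul_p (fun _ => a)).
have Vt : V = (fun t => transient t + U t).
  apply/funext => t; rewrite /V /transient /U -RintegralD//.
  - by apply: eq_Rintegral => p _; ring.
  - apply: (@prob_integrable _ _ _ _ _ ((A + A) * (2 * B))).
      by apply: (mb (fun p => al t p - ai p)); apply: ctsB => //; exact: al_p.
    move=> p; apply: mul_bound => //.
    by rewrite (le_trans (ler_normB _ _))// lerD.
  - apply: (@prob_integrable _ _ _ _ _ (A * (2 * B))); first exact: mb.
    by move=> p; exact: mul_bound.
have cU : continuous U.
  apply: (@continuous_prob_integral _ _ _ Q (fun t p => ai p * (S t p - P t)) (A * (2 * B))).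
  - by move=> t; exact: mb.
  - by move=> p; apply: (@cts_mul_t (fun _ => ai)); exact: cts_cst.
  - by move=> t p; exact: mul_bound.
have cT := continuous_transient.
have cW : continuous W.
  by apply: ctsM; [exact: cts_cst|exact: continuous_ridge_line].
have UB t : `|U t| <= A * (2 * B).
  by apply: prob_norm_le => [|p]; [exact: mb|exact: mul_bound].
have TB t : `|transient t| <= (A + A) * (2 * B).
  apply: prob_norm_le => [|p].
    by apply: (mb (fun p => al t p - ai p)); apply: ctsB => //; exact: al_p.
  by apply: mul_bound => //; rewrite (le_trans (ler_normB _ _))// lerD.
have WB t : `|W t| <= `|kappa| * B.
  by rewrite normrM normrN ler_wpM2l// ridge_bound.
have m (h : R -> R) : continuous h -> measurable_fun `[(0 : R), +oo[ h.
  by move=> ch; apply: measurable_funTS; exact: continuous_measurable_fun.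
have dP (t : R) : 0 < t -> is_derive t 1 P (W t + V t).
  move=> t0; rewrite /W addr0; apply: (is_derive_ridge nu_c hk).
  have E : \int[Q]_p (al t p * (ridge nu k xi (t + th p) (dot xi p.2 + - kappa * t) -
      ridge nu k xi t (- kappa * t))) = V t.
    by apply: eq_Rintegral => p _; congr (_ * (_ - _)); rewrite /shifted_ridge (addrC (dot xi p.2)).
  by move: (delay_eq ck kB kL xi (- kappa * t) t0); rewrite E.
have L := lap_deriv b0 cP (ctsD cW (ctsD cT cU)) (fun s _ => PB s)
  (fun s _ => le_trans (ler_normD _ _) (lerD (WB s) (le_trans (ler_normD _ _) (lerD (TB s) (UB s))))).
rewrite Vt in dP; have {}L := L dP.
have -> : ridge nu k xi 0 0 = P 0 by rewrite /P mulr0.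
have -> : lap_ridge k xi b kappa 0 = lap b P by rewrite PE.
have D1 := lapD b0 (m _ cW) (fun s _ => WB s) (m _ (ctsD cT cU))
  (fun s _ => le_trans (ler_normD _ _) (lerD (TB s) (UB s))).
have D2 := lapD b0 (m _ cT) (fun s _ => TB s) (m _ cU) (fun s _ => UB s).
rewrite -L D1 D2.
rewrite addrA; congr (_ + _ + _).
  rewrite /W (@lapZ _ b _ B)//; first exact: measurable_ridge_line.
  by move=> s _; exact: ridge_bound.
rewrite (@lap_fubini _ _ _ Q (fun t p => ai p * (S t p - P t)) (A * (2 * B)))//.
- apply: eq_Rintegral => p _.
  rewrite (@lapZ _ b _ (B + B))//.
  + by rewrite (@lapB _ b _ _ B B)//; exact: m.
  + by apply: measurable_funB; exact: m.
  + by move=> s _; rewrite (le_trans (ler_normB _ _))// lerD// ?SB ?PB.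
- by move=> t; exact: mb.
- by move=> p; apply: (@cts_mul_t (fun _ => ai)); exact: cts_cst.
- by move=> t p; exact: mul_bound.
Qed.

(** Counted from the delayed time r = t + th p, the recentring [- kappa * t] leaves an extra
    [kappa * th p]. With [kappa = dot xi K] the displacement becomes the product of [xi] with z +
    theta K, the vector of [D0]. *)
Lemma lap_shifted_ridge p :
  lap b (S ^~ p) = expR (b * th p) *
    (lap_ridge k xi b kappa (dot xi p.2 + kappa * th p) +
     \int[@lebesgue_measure R]_(r in `[th p, 0])
       (expR (- b * r) * ridge nu k xi r (- kappa * r + (dot xi p.2 + kappa * th p)))).
Proof.
have /andP[_ th0] := th_b p.
pose d := dot xi p.2 + kappa * th p.
have H := lap_shift b0 th0 (@continuous_ridge_line k ck kB kL xi kappa d)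
  (fun s _ => ridge_bound nu ck kB xi s (- kappa * s + d)).
rewrite -[RHS]H; apply: eq_lap => t _.
by rewrite /shifted_ridge; congr (ridge _ _ _ _ _); rewrite /d; ring.
Qed.

Lemma measurable_lap_shifted : measurable_fun setT (fun p : Borel X => lap b (S ^~ p)).
Proof.
apply: (@measurable_lap _ _ _ Q S B) => //; first by move=> t; exact: borel_measurable2.
Qed.

End identity.

Lemma lap_ridge_taylor2 xi b kappa d : 0 < b ->
  `|lap_ridge k xi b kappa d - lap_ridge k xi b kappa 0 - d * lap_ridge k1 xi b kappa 0
    - d ^+ 2 / 2 * lap_ridge k2 xi b kappa 0| <=
  Num.min (2 * B * d ^+ 2) (B * `|d| ^+ 3) / b.
Proof.
move=> b0.
have m0 y := @measurable_ridge_line k ck kB kL xi kappa y `[0, +oo[.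
have m1 y := @measurable_ridge_line k1 ck1 k1B k1L xi kappa y `[0, +oo[.
have m2 y := @measurable_ridge_line k2 ck2 k2B k2L xi kappa y `[0, +oo[.
have B0 y (s : R) (_ : 0 <= s) := ridge_bound nu ck kB xi s (- kappa * s + y).
have B1 y (s : R) (_ : 0 <= s) := ridge_bound nu ck1 k1B xi s (- kappa * s + y).
have B2 y (s : R) (_ : 0 <= s) := ridge_bound nu ck2 k2B xi s (- kappa * s + y).
have mZ (c : R) (h : R -> R) : measurable_fun `[(0 : R), +oo[ h ->
  measurable_fun `[(0 : R), +oo[ (fun s => c * h s).
  by move=> mh; apply: measurable_funM.
have BZ (c C : R) (h : R -> R) : (forall s : R, 0 <= s -> `|h s| <= C) ->
  forall s : R, 0 <= s -> `|c * h s| <= `|c| * C.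
  by move=> hC s s0; rewrite normrM ler_wpM2l// hC.
have BB (C C' : R) (h h' : R -> R) : (forall s : R, 0 <= s -> `|h s| <= C) ->
  (forall s : R, 0 <= s -> `|h' s| <= C') ->
  forall s : R, 0 <= s -> `|h s - h' s| <= C + C'.
  by move=> hC hC' s s0; rewrite (le_trans (ler_normB _ _))// lerD ?hC ?hC'.
rewrite /lap_ridge.
rewrite -(lapB b0 (m0 d) (B0 d) (m0 0) (B0 0)).
rewrite -(lapZ d b0 (m1 0) (B1 0)) -(lapZ (d ^+ 2 / 2) b0 (m2 0) (B2 0)).
have ma := measurable_funB (m0 d) (m0 0).
have Ba := BB _ _ _ _ (B0 d) (B0 0).
rewrite -(lapB b0 ma Ba (mZ d _ (m1 0)) (BZ d _ _ (B1 0))).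
have mb := measurable_funB ma (mZ d _ (m1 0)).
have Bb := BB _ _ _ _ Ba (BZ d _ _ (B1 0)).
rewrite -(lapB b0 mb Bb (mZ (d ^+ 2 / 2) _ (m2 0)) (BZ (d ^+ 2 / 2) _ _ (B2 0))).
apply: lap_norm_le => // [|s s0].
  exact: measurable_funB mb (mZ (d ^+ 2 / 2) _ (m2 0)).
have := ridge_taylor2 nu hk xi s (- kappa * s + 0) d.
by rewrite (_ : - kappa * s + 0 + d = - kappa * s + d); last by rewrite addr0.
Qed.



End delay_laplace.

(** Read [e] as exp x with x = b theta, [w] as the displacement and [q] as w^2/2: the first bracket
    is the error of the expansion in the delay, the last one the Taylor remainder in space. *)
Lemma exp_taylor_split {R : comPzRingType} (e x w q P P0 P1 P2 : R) :
  e * P - P0 - x * P0 - w * P1 - q * P2 =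
  ((e - 1 - x) * P0 + (e - 1) * (P - P0)) + (P - P0 - w * P1 - q * P2).
Proof. by ring. Qed.

Lemma defect_split {F : fieldType} (A S e P P0 P1 P2 b t l y : F) :
  A * (S - P0) = A * (S - e * P) +
  A * (e * P - P0 - b * t * P0 - l * y * P1 - (l * y) ^+ 2 / 2 * P2) +
  A * t * (b * P0) + A * y * (l * P1) + A * y ^+ 2 * (l ^+ 2 / 2 * P2).
Proof. by ring. Qed.

(** The terms in [P1], of order lambda, cancel here: [- (l * D) * P1] stems from the moving centre,
    [D * (l * P1)] from the mean jump. The term [- G * (b * P0)] moves to the left and turns 1 into
    [1 + G]. *)
Lemma balance {F : realFieldType} (b G D l c P0 P1 P2 r T bd er J : F) :
  b * P0 - r = - (l * D) * P1 + T + J ->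
  J = bd + er + - G * (b * P0) + D * (l * P1) + c * (l ^+ 2 / 2 * P2) ->
  b * (1 + G) * P0 - l ^+ 2 * (c / 2) * P2 = r + T + bd + er.
Proof. by move=> h1 h2; lra. Qed.

(** * Asymptotics of the transforms along a sequence of scales *)

Section delay_asymptotics.
Context {R : realType} {N : nat}.
Notation X := (R * 'rV[R]_N)%type.
Context (Q : probability (Borel X) R) (nu : R -> probability (Borel 'rV[R]_N) R).
Variables (al : R -> X -> R) (ai th : X -> R) (A M0 beta : R).
Hypothesis nu_c : forall f : 'rV[R]_N -> R, is_Cb f ->
  continuous (fun t => \int[nu t]_x f x).
Hypothesis al_t : forall p, continuous (al ^~ p).
Hypothesis al_p : forall t, continuous (al t).
Hypothesis al_A : forall t p, `|al t p| <= A.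
Hypothesis ai_c : continuous ai.
Hypothesis ai_A : forall p, `|ai p| <= A.
Hypothesis al_ai : forall (t : R) p, 0 <= t -> `|al t p - ai p| <= M0 * expR (- beta * t).
Hypothesis th_c : continuous th.
Hypothesis th_b : forall p, -1 <= th p <= 0.
Hypothesis beta_gt0 : 0 < beta.
Hypothesis delay_eq : forall (h : R -> R) (C : R), continuous h ->
  (forall y, `|h y| <= C) -> (forall x y, `|h x - h y| <= C * `|x - y|) ->
  forall xi y (t : R), 0 < t -> is_derive t 1 (fun s => ridge nu h xi s y)
    (\int[Q]_p (al t p *
      (ridge nu h xi (t + th p) (dot xi p.2 + y) - ridge nu h xi t y))).

Variables (B : R) (k k1 k2 : R -> R).
Hypothesis hk : smooth3 B k k1 k2.
Let kB y : `|k y| <= B. Proof. by case: hk => _ _ /(_ y)[]. Qed.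
Let k1B y : `|k1 y| <= B. Proof. by case: hk => _ _ /(_ y)[]. Qed.
Let k2B y : `|k2 y| <= B. Proof. by case: hk => _ _ /(_ y)[]. Qed.
Let ck := smooth3_continuous hk.
Let ck1 := smooth3_continuous1 hk.
Let ck2 := smooth3_continuous2 hk.
Let kL := smooth3_lip hk.
Let k1L := smooth3_lip1 hk.
Let k2L x y : `|k2 x - k2 y| <= B * `|x - y|. Proof. by case: hk. Qed.


Section asymptotics.
Variables (zeta K : 'rV[R]_N) (G a : R) (lam : R^nat).
Hypothesis a0 : 0 < a.
Hypothesis lam1 : forall n, 1 <= lam n.
Hypothesis lam_oo : lam n @[n --> \oo] --> +oo.
Local Notation Y p := (dot zeta (p.2 + th p *: K)).
Hypothesis Y2 : Q.-integrable setT (EFin \o (fun p : X => Y p ^+ 2)).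
Hypothesis hG : \int[Q]_p (ai p * th p) = - G.
Hypothesis hK : \int[Q]_p (ai p * Y p) = dot zeta K.
Let c0 := \int[Q]_p (ai p * Y p ^+ 2).
Let lam0 n : 0 < lam n. Proof. exact: lt_le_trans (lam1 n). Qed.
Let xi n := (lam n)^-1 *: zeta.
Let kap n := dot (xi n) K.
Let b n := a / lam n ^+ 2.
Let b0 n : 0 < b n. Proof. by rewrite divr_gt0// exprn_gt0. Qed.
Let w n (p : X) := (lam n)^-1 * Y p.
Let Psi f n d := lap_ridge nu f (xi n) (b n) (kap n) d.
Let B0 : 0 <= B. Proof. exact: smooth3_ge0 hk. Qed.
Let A0 : 0 <= A.
Proof. by apply: le_trans (ai_A (0, 0)). Qed.

Let wE n p : dot (xi n) p.2 + kap n * th p = w n p.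
Proof. by rewrite /w /kap /xi !dotZl dotDr dotZr; ring. Qed.

Let LRbound n d : `|Psi k n d| <= B / b n.
Proof. exact: (lap_ridge_bound nu_c ck kB kL). Qed.

Let LRlip n d d' : `|Psi k n d - Psi k n d'| <= B / b n * `|d - d'|.
Proof. exact: (lap_ridge_lip nu_c ck kB kL). Qed.

Let LRtaylor n d : `|Psi k n d - Psi k n 0 - d * Psi k1 n 0 - d ^+ 2 / 2 * Psi k2 n 0| <=
  Num.min (2 * B * d ^+ 2) (B * `|d| ^+ 3) / b n.
Proof. exact: (lap_ridge_taylor2 nu_c hk). Qed.

Let LRshift n p : lap (b n) (shifted_ridge nu th k (xi n) (kap n) ^~ p) =
  expR (b n * th p) *
    (lap_ridge nu k (xi n) (b n) (kap n) (dot (xi n) p.2 + kap n * th p) +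
     \int[@lebesgue_measure R]_(r in `[th p, 0])
       (expR (- b n * r) * ridge nu k (xi n) r (- kap n * r + (dot (xi n) p.2 + kap n * th p)))).
Proof. exact: (lap_shifted_ridge nu_c th_b hk). Qed.

Let LRmeas n : measurable_fun setT
  (fun p : Borel X => lap (b n) (shifted_ridge nu th k (xi n) (kap n) ^~ p)).
Proof. exact: (measurable_lap_shifted Q nu_c th_c hk). Qed.

Let LRident n : b n * Psi k n 0 - ridge nu k (xi n) 0 0 =
  - kap n * Psi k1 n 0 + lap (b n) (transient Q nu al ai th k (xi n) (kap n)) +
  \int[Q]_p (ai p * (lap (b n) (shifted_ridge nu th k (xi n) (kap n) ^~ p) - Psi k n 0)).
Proof. exact: (lap_identity nu_c al_t al_p al_A ai_c ai_A th_c delay_eq hk). Qed.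

Let LRmeasT n t : measurable_fun setT (fun p : Borel X => (al t p - ai p) *
   (shifted_ridge nu th k (xi n) (kap n) t p - ridge nu k (xi n) t (- kap n * t))).
Proof. exact: (measurable_transient_integrand nu_c al_p ai_c th_c hk). Qed.

Let LRcontT n : continuous (transient Q nu al ai th k (xi n) (kap n)).
Proof. exact: (continuous_transient nu_c al_t al_p al_A ai_c ai_A th_c hk). Qed.

Let lamV : (lam n)^-1 @[n --> \oo] --> (0 : R).
Proof.
by apply/gtr0_cvgV0; [exact: nearW|].
Qed.

Let lamV1 n : (lam n)^-1 <= 1. Proof. by rewrite invf_le1. Qed.
Let lamV0 n : 0 <= (lam n)^-1. Proof. by rewrite invr_ge0 ltW. Qed.
Let lamV2 n : (lam n)^-1 ^+ 2 <= (lam n)^-1.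
Proof. by rewrite expr2 ler_piMl. Qed.

Let bE n : b n = a * (lam n)^-1 ^+ 2. Proof. by rewrite /b exprVn. Qed.
Let bV : b n @[n --> \oo] --> (0 : R).
Proof.
rewrite (_ : b = fun n => a * ((lam n)^-1 * (lam n)^-1)); last first.
  by apply/funext => n; rewrite bE expr2.
rewrite (_ : 0 = a * (0 * 0)); last by rewrite !mulr0.
by apply: cvgM; [exact: cvg_cst|exact: cvgM].
Qed.

Let ba n : b n <= a.
Proof. by rewrite bE ler_piMr// ?(ltW a0)// (le_trans (lamV2 n)). Qed.

Let cY : continuous (fun p : X => Y p).
Proof.
have -> : (fun p : X => Y p) = (fun p : X => dot zeta p.2 + th p * dot zeta K).
  by apply/funext => p; rewrite dotDr dotZr.
apply: ctsD; last by apply: ctsM => //; exact: cts_cst.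
move=> p; apply: (@continuous_comp _ _ _ (fun p : X => p.2) (dot zeta)).
  exact: cvg_snd.
exact: continuous_dot.
Qed.

Let iY_le (h : X -> R) (C : R) : continuous h ->
  (forall p, `|h p| <= C * (1 + Y p ^+ 2)) -> Q.-integrable setT (EFin \o h).
Proof.
move=> ch hC.
have I1 : Q.-integrable setT (EFin \o (fun p : X => 1 + Y p ^+ 2)).
  have := integrableD measurableT (finite_measure_integrable_cst Q 1 measurableT) Y2.
  by apply: eq_integrable => // p _.
have I2 : Q.-integrable setT (EFin \o (fun p : X => C * (1 + Y p ^+ 2))).
  by have := integrableZl measurableT C I1; apply: eq_integrable => // p _.
apply: (le_integrable measurableT _ _ I2).
  by apply/measurable_EFinP; exact: borel_measurable2.
by move=> p _ /=; rewrite lee_fin (le_trans (hC p))// ler_norm.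
Qed.

Let Y1 p : `|Y p| <= 1 + Y p ^+ 2.
Proof.
rewrite -[in leRHS](real_normK (num_real (Y p))); set z := `|_|.
have z0 : 0 <= z by exact: normr_ge0.
have := sqr_ge0 (z - 1); have -> : (z - 1) ^+ 2 = z ^+ 2 - 2 * z + 1 by ring.
lra.
Qed.

Let aiY_int : Q.-integrable setT (EFin \o (fun p : X => ai p * Y p)).
Proof.
apply: (iY_le (C := A)); first exact: ctsM.
by move=> p; rewrite normrM ler_pM.
Qed.

Let aiY2_int : Q.-integrable setT (EFin \o (fun p : X => ai p * Y p ^+ 2)).
Proof.
apply: (iY_le (C := A)).
  by apply: ctsM => //; apply: (cts_comp (h := fun y => y ^+ 2)) => // y; exact: exprn_continuous.
by move=> p; rewrite normrM ler_pM// ger0_norm ?sqr_ge0// lerDr.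
Qed.

Let aith_int : Q.-integrable setT (EFin \o (fun p : X => ai p * th p)).
Proof.
apply: (@prob_integrable _ _ _ _ _ (A * 1)).
  by apply: borel_measurable2; exact: ctsM.
move=> p; rewrite normrM ler_pM// ler_norml.
by have /andP[-> /le_trans ->] := th_b p.
Qed.

(** The error of expanding [expR (b n * th p) * Psi k n (w n p)] to first order in [b n] and second
    order in [w n p]. As [Psi] may be as large as [B / b n], of order [lam n ^+ 2], the expansion
    errors have to be small even after division by [b n]. *)
Let er n p := ai p * (expR (b n * th p) * Psi k n (w n p) - Psi k n 0
   - b n * th p * Psi k n 0 - w n p * Psi k1 n 0 - w n p ^+ 2 / 2 * Psi k2 n 0).

Let expR_le1 n p : expR (b n * th p) <= 1.
Proof.
by rewrite -expR0 ler_expR; have /andP[_ ?] := th_b p; rewrite mulr_ge0_le0// ltW.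
Qed.

Let expR_bound1 n p : `|expR (b n * th p) - 1| <= b n.
Proof.
have /andP[h1 h2] := th_b p; have := expR_le1 n p; have := b0 n.
have := expR_ge1Dx (b n * th p); move=> h3 h4 h5.
rewrite ler0_norm ?subr_le0// opprB; nra.
Qed.

Let expR_bound2 n p : `|expR (b n * th p) - 1 - b n * th p| <= b n ^+ 2.
Proof.
have /andP[h1 h2] := th_b p; have h4 := b0 n.
set x := b n * th p.
have h3 := expR_ge1Dx x.
rewrite ger0_norm; last by lra.
have x0 : x <= 0 by rewrite /x mulr_ge0_le0// ltW.
have xb : x ^+ 2 <= b n ^+ 2.
  by rewrite -sqrrN ler_sqr ?nnegrE; [rewrite /x; nra|lra|lra].
have h5 := expR_ge1Dx (- x).
have E : expR x * expR (- x) = 1 by rewrite -expRD subrr expR0.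
have h6 := expR_gt0 x.
(* This gives [expR x - 1 - x <= x ^+ 2 / (1 - x)], and [1 - x] is at least 1. *)
have : expR x * (1 - x) <= expR x * expR (- x) by rewrite ler_wpM2l// ltW.
rewrite E; nra.
Qed.

Let er_bound n p (C : R) : Num.min (2 * B * w n p ^+ 2) (B * `|w n p| ^+ 3) <= C ->
  `|er n p| <= A * ((a * B + B * `|Y p|) * (lam n)^-1 + C / b n).
Proof.
move=> hC; rewrite /er.
rewrite exp_taylor_split normrM ler_pM//.
rewrite (le_trans (ler_normD _ _))// lerD//; last first.
  apply: le_trans (LRtaylor _ _) _.
  by rewrite ler_pM2r// invr_gt0.
rewrite [leRHS]mulrDl (le_trans (ler_normD _ _))// lerD//.
  rewrite normrM; apply: (@le_trans _ _ (b n ^+ 2 * (B / b n))).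
    by rewrite ler_pM//; exact: LRbound.
  have -> : b n ^+ 2 * (B / b n) = B * b n by field; exact: lt0r_neq0.
  rewrite bE (mulrC a B) -mulrA ler_wpM2l//.
  by rewrite ler_wpM2l// ltW.
rewrite normrM; apply: (@le_trans _ _ (b n * (B / b n * `|w n p - 0|))).
  by rewrite ler_pM//; exact: LRlip.
have -> : b n * (B / b n * `|w n p - 0|) = B * `|w n p - 0|.
  by field; exact: lt0r_neq0.
by rewrite subr0 /w normrM (ger0_norm (lamV0 n)) -mulrA [X in _ <= _ * X]mulrC.
Qed.

(** The quadratic remainder divided by [b n] is free of [n], because [w n p ^+ 2] carries the factor
    [(lam n)^-1 ^+ 2]: this is the dominating function, integrable by [Y2]. *)
Let er_bound1 n p : `|er n p| <= A * (a * B + B + 2 * B / a) * (1 + Y p ^+ 2).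
Proof.
have lV : 0 < (lam n)^-1 by rewrite invr_gt0.
have H : Num.min (2 * B * w n p ^+ 2) (B * `|w n p| ^+ 3) <= 2 * B * w n p ^+ 2.
  by rewrite ge_min lexx.
apply: (le_trans (er_bound H)).
have -> : 2 * B * w n p ^+ 2 / b n = 2 * B / a * Y p ^+ 2.
  rewrite bE /w exprMn; field.
  by rewrite !lt0r_neq0.
rewrite -[leRHS]mulrA ler_wpM2l//.
have h1 : (a * B + B * `|Y p|) * (lam n)^-1 <= a * B + B * (1 + Y p ^+ 2).
  apply: (@le_trans _ _ (a * B + B * `|Y p|)).
    by rewrite ler_piMr// addr_ge0// mulr_ge0// ltW.
  by rewrite lerD2l ler_wpM2l.
apply: (le_trans (lerD h1 (lexx _))).
have aB : 0 <= a * B by rewrite mulr_ge0// ltW.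
have Ba : 0 <= 2 * B / a by rewrite divr_ge0 ?mulr_ge0// ltW.
have Yp : 0 <= Y p ^+ 2 by rewrite sqr_ge0.
move: (2 * B / a) (a * B) Ba aB => u v u0 v0; nra.
Qed.

(** The cubic remainder keeps one factor [(lam n)^-1] after division by [b n]. The third power of
    [Y p] may fail to be integrable, so this bound serves for the limit at each [p], and [er_bound1]
    for domination. *)
Let er_bound2 n p :
  `|er n p| <= A * (a * B + B * `|Y p| + B / a * `|Y p| ^+ 3) * (lam n)^-1.
Proof.
have lV : 0 < (lam n)^-1 by rewrite invr_gt0.
have H : Num.min (2 * B * w n p ^+ 2) (B * `|w n p| ^+ 3) <= B * `|w n p| ^+ 3.
  by rewrite ge_min lexx orbT.
apply: (le_trans (er_bound H)).
have -> : B * `|w n p| ^+ 3 / b n = B / a * `|Y p| ^+ 3 * (lam n)^-1.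
  rewrite bE /w normrM (ger0_norm (lamV0 n)) exprMn; field.
  by rewrite !lt0r_neq0.
by rewrite -mulrDl mulrA.
Qed.

Let cPsi k' n : continuous k' -> (forall y, `|k' y| <= B) ->
  (forall x y, `|k' x - k' y| <= B * `|x - y|) -> continuous (Psi k' n).
Proof. by move=> ck' k'B k'L; exact: (continuous_lap_ridge nu_c ck' k'B k'L). Qed.

Let cw n : continuous (w n).
Proof. by apply: ctsM => //; exact: cts_cst. Qed.

Let cexp n : continuous (fun p => expR (b n * th p)).
Proof.
apply: cts_comp; first exact: continuous_expR.
by apply: ctsM => //; exact: cts_cst.
Qed.

Let cPw n : continuous (fun p => Psi k n (w n p)).
Proof. by apply: cts_comp => //; exact: cPsi. Qed.

Let cer n : continuous (er n).
Proof.
have c c' : continuous (fun _ : X => c' : R) by exact: cts_cst.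
apply: ctsM => //; apply: ctsB; last first.
  apply: ctsM => //; apply: ctsM => //.
  by apply: (cts_comp (h := fun y => y ^+ 2)) => // y; exact: exprn_continuous.
apply: ctsB; last exact: ctsM.
apply: ctsB; last by apply: ctsM => //; exact: ctsM.
by apply: ctsB => //; apply: ctsM.
Qed.

Let er_int n : Q.-integrable setT (EFin \o er n).
Proof. by apply: iY_le (er_bound1 n); exact: cer. Qed.

Let er_cvg : \int[Q]_p er n p @[n --> \oo] --> 0.
Proof.
rewrite -(prob_cst Q 0).
pose g p := A * (a * B + B + 2 * B / a) * (1 + Y p ^+ 2).
apply: (@Rdominated_cvg _ _ _ Q setT er (cst 0) g) => //.
- by move=> n; exact: borel_measurable2.
- move=> p _; apply/norm_cvg0P.
  set C := A * (a * B + B * `|Y p| + B / a * `|Y p| ^+ 3).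
  apply: (squeeze_cvgr (f := cst 0) (h := fun n => C * (lam n)^-1)).
  + by apply: nearW => n; rewrite normr_ge0 er_bound2.
  + exact: cvg_cst.
  + by rewrite -(mulr0 C); apply: cvgM => //; exact: cvg_cst.
- apply: (iY_le (C := `|A * (a * B + B + 2 * B / a)|)).
    apply: ctsM; first exact: cts_cst.
    apply: ctsD; first exact: cts_cst.
    by apply: (cts_comp (h := fun y => y ^+ 2)) => // y; exact: exprn_continuous.
  by move=> p; rewrite /g normrM ler_wpM2l// ger0_norm// addr_ge0// sqr_ge0.
Qed.

Let I n p := \int[@lebesgue_measure R]_(r in `[th p, 0])
  (expR (- b n * r) * ridge nu k (xi n) r (- kap n * r + w n p)).

Let Sn n p := lap (b n) (shifted_ridge nu th k (xi n) (kap n) ^~ p).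

Let SnE n p : Sn n p = expR (b n * th p) * (Psi k n (w n p) + I n p).
Proof. by rewrite /Sn LRshift wE. Qed.

Let mth p : fine (@lebesgue_measure R `[th p, 0]) = - th p.
Proof.
have /andP[_ h] := th_b p.
rewrite lebesgue_measure_itv /= lte_fin; case: ltgtP h => // [h _|-> _].
  by rewrite add0r.
by rewrite oppr0.
Qed.

Let mI n p : measurable_fun `[th p, 0]
  (fun r => expR (- b n * r) * ridge nu k (xi n) r (- kap n * r + w n p)).
Proof.
by apply: measurable_funM; [exact: measurable_expRM|exact: measurable_ridge_line].
Qed.

Let Ib n p r : th p <= r <= 0 ->
  `|expR (- b n * r) * ridge nu k (xi n) r (- kap n * r + w n p)| <= expR a * B.
Proof.
move=> /andP[h1 h2]; have /andP[h3 _] := th_b p.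
rewrite normrM ger0_norm ?expR_ge0// ler_pM ?expR_ge0//; last exact: ridge_bound.
by rewrite ler_expR; have := ba n; have := b0 n; nra.
Qed.

Let icst p (c : R) : (@lebesgue_measure R).-integrable `[th p, 0] (EFin \o (fun _ : R => c)).
Proof.
apply: continuous_compact_integrable; first exact: segment_compact.
by apply: continuous_subspaceT; exact: cts_cst.
Qed.

Let I_bound n p : `|I n p| <= expR a * B.
Proof.
apply: (@le_trans _ _ (\int[@lebesgue_measure R]_(r in `[th p, 0]) (fun _ : R => expR a * B) r)).
  apply: le_normr_Rintegral_bound => //; first exact: mI.
  by move=> r /=; rewrite in_itv /=; exact: Ib.
rewrite Rintegral_cst// mth ler_piMr// ?mulr_ge0 ?expR_ge0//.
by have /andP[] := th_b p; rewrite lerNl.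
Qed.

Let I_cvg p : I n p @[n --> \oo] --> k 0 * - th p.
Proof.
rewrite -mth -(Rintegral_cst lebesgue_measure (measurable_itv `[th p, 0])).
apply: (@Rdominated_cvg _ _ _ lebesgue_measure `[th p, 0]
  (fun n r => expR (- b n * r) * ridge nu k (xi n) r (- kap n * r + w n p))
  (fun=> k 0) (fun=> expR a * B)) => //.
- by move=> n; exact: mI.
- move=> r _.
  have -> : k 0 = expR (- 0 * r) * k 0 by rewrite oppr0 mul0r expR0 mul1r.
  apply: cvgM.
    apply: continuous_cvg; first exact: continuous_expR.
    apply: cvgM; last exact: cvg_cst.
    exact: cvgN.
  apply: ridge_dirac0 => //.
  have -> : (0 : R) = 0 * (- dot zeta K * r + Y p) by rewrite mul0r.
  have -> : (fun n => - kap n * r + w n p) = (fun n => (lam n)^-1 * (- dot zeta K * r + Y p)).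
    by apply/funext => n; rewrite /kap /w /xi dotZl; ring.
  by apply: cvgM => //; exact: cvg_cst.
- by move=> n r /=; rewrite in_itv /=; exact: Ib.
Qed.

(** The contribution of the integral over [[th p, 0]]. It is written as a difference because its
    measurability in [p] is read off the two terms. *)
Let bd n p := ai p * (Sn n p - expR (b n * th p) * Psi k n (w n p)).

Let bdE n p : bd n p = ai p * (expR (b n * th p) * I n p).
Proof. by rewrite /bd SnE; ring. Qed.

Let bd_bound n p : `|bd n p| <= A * (1 * (expR a * B)).
Proof.
rewrite bdE normrM ler_pM// normrM ler_pM//.
by rewrite ger0_norm ?expR_ge0// expR_le1.
Qed.

Let mbd n : measurable_fun setT (bd n : Borel X -> R).
Proof.
apply: measurable_funM; first exact: borel_measurable2.
apply: measurable_funB; first exact: LRmeas.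
by apply: borel_measurable2; exact: ctsM.
Qed.

Let bd_int n : Q.-integrable setT (EFin \o bd n).
Proof. exact: prob_integrable (mbd n) (bd_bound n). Qed.

(** The integral over [[th p, 0]] tends to [k 0] times the length [- th p] of the interval;
    averaging against [ai] produces [G]. *)
Let bd_cvg : \int[Q]_p bd n p @[n --> \oo] --> G * k 0.
Proof.
have -> : G * k 0 = \int[Q]_p (- k 0 * (ai p * th p)).
  by rewrite RintegralZl// hG; ring.
apply: (@Rdominated_cvg _ _ _ Q setT bd (fun p => - k 0 * (ai p * th p))
  (fun=> A * (1 * (expR a * B)))).
- exact: measurableT.
- exact: mbd.
- move=> p _; rewrite (_ : (fun n => bd n p) = (fun n => ai p * (expR (b n * th p) * I n p))); last first.
    by apply/funext => n; exact: bdE.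
  have -> : - k 0 * (ai p * th p) = ai p * (1 * (k 0 * - th p)) by ring.
  apply: cvgM; first exact: cvg_cst.
  apply: cvgM; last exact: I_cvg.
  have -> : (1 : R) = expR (0 * th p) by rewrite mul0r expR0.
  apply: continuous_cvg; first exact: continuous_expR.
  by apply: cvgM; last exact: cvg_cst.
- exact: finite_measure_integrable_cst.
- by move=> n p _; exact: bd_bound.
Qed.

Let Tn n t := transient Q nu al ai th k (xi n) (kap n) t.

Let dir n t p : `|(al t p - ai p) * (shifted_ridge nu th k (xi n) (kap n) t p
    - ridge nu k (xi n) t (- kap n * t))| <= `|al t p - ai p| * (2 * B).
Proof.
rewrite normrM ler_wpM2l// (le_trans (ler_normB _ _))// mulr_natl mulr2n.
by rewrite lerD//; exact: ridge_bound.
Qed.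

Let Tn_bound n (t : R) : 0 <= t -> `|Tn n t| <= M0 * expR (- beta * t) * (2 * B).
Proof.
move=> t0; apply: prob_norm_le => [|p]; first exact: LRmeasT.
by apply: le_trans (dir _ _ _) _; rewrite ler_wpM2r// ?mulr_ge0// al_ai.
Qed.

Let Tn_cvg (t : R) : 0 <= t -> Tn n t @[n --> \oo] --> (0 : R).
Proof.
move=> t0; rewrite -(prob_cst Q 0).
apply: (@Rdominated_cvg _ _ _ Q setT (fun n p => (al t p - ai p) *
    (shifted_ridge nu th k (xi n) (kap n) t p - ridge nu k (xi n) t (- kap n * t)))
  (cst 0) (fun=> M0 * expR (- beta * t) * (2 * B))) => //.
- move=> p _; rewrite -[X in _ --> X](mulr0 (al t p - ai p)) -(subrr (k 0)).
  apply: cvgM; first exact: cvg_cst.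
  apply: cvgB; apply: ridge_dirac0 => //.
    have -> : (0 : R) = 0 * (- dot zeta K * t + dot zeta p.2) by rewrite mul0r.
    have -> : (fun n => - kap n * t + dot (xi n) p.2) =
        (fun n => (lam n)^-1 * (- dot zeta K * t + dot zeta p.2)).
      by apply/funext => n; rewrite /kap /xi !dotZl; ring.
    by apply: cvgM => //; exact: cvg_cst.
  have -> : (0 : R) = 0 * (- dot zeta K * t) by rewrite mul0r.
  have -> : (fun n => - kap n * t) = (fun n => (lam n)^-1 * (- dot zeta K * t)).
    by apply/funext => n; rewrite /kap /xi !dotZl; ring.
  by apply: cvgM => //; exact: cvg_cst.
- exact: finite_measure_integrable_cst.
- move=> n p _; apply: le_trans (dir _ _ _) _.
  by rewrite ler_wpM2r// ?mulr_ge0// al_ai.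
Qed.

(** The weight [expR (- b n * s)] tends to 1 and gives no decay; domination comes from the decay of
    the rates at speed [beta]. The limit at each time is 0 because both ridges tend to [k 0]. *)
Let lapT_cvg : lap (b n) (Tn n) @[n --> \oo] --> 0.
Proof.
have Z : \int[@lebesgue_measure R]_(s in `[0, +oo[) (0 : R) = 0.
  by rewrite Rintegral_cst// mul0r.
rewrite -Z.
apply: (@Rdominated_cvg _ _ _ lebesgue_measure `[(0 : R), +oo[
  (fun n s => expR (- b n * s) * Tn n s) (fun=> 0)
  (fun s => expR (- beta * s) * (M0 * (2 * B)))) => //.
- move=> n; apply: measurable_funM; first exact: measurable_expRM.
  by apply: measurable_funTS; apply: continuous_measurable_fun; exact: LRcontT.
- move=> s /=; rewrite in_itv /= andbT => s0; apply/norm_cvg0P.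
  apply: (squeeze_cvgr (f := cst 0) (h := fun n => `|Tn n s|)).
  + apply: nearW => n; rewrite normr_ge0 normrM ger0_norm ?expR_ge0//= ler_piMl//.
    by rewrite -expR0 ler_expR mulNr oppr_le0 mulr_ge0// ltW.
  + exact: cvg_cst.
  + by apply/norm_cvg0P; exact: Tn_cvg.
- exact: integrable_expRN_cst.
- move=> n s /=; rewrite in_itv /= andbT => s0.
  rewrite normrM ger0_norm ?expR_ge0//.
  apply: (@le_trans _ _ `|Tn n s|).
    by rewrite ler_piMl// -expR0 ler_expR mulNr oppr_le0 mulr_ge0// ltW.
  by rewrite mulrA [_ * M0]mulrC; exact: Tn_bound.
Qed.

Let P0_cvg : ridge nu k (xi n) 0 0 @[n --> \oo] --> k 0.
Proof. by apply: ridge_dirac0 => //; exact: cvg_cst. Qed.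

Let decomposition n : \int[Q]_p (ai p * (Sn n p - Psi k n 0)) =
  \int[Q]_p bd n p + \int[Q]_p er n p + - G * (b n * Psi k n 0)
  + dot zeta K * ((lam n)^-1 * Psi k1 n 0)
  + c0 * ((lam n)^-1 ^+ 2 / 2 * Psi k2 n 0).
Proof.
set u3 := b n * Psi k n 0; set u4 := _ * Psi k1 n 0; set u5 := _ * Psi k2 n 0.
have iZ (h : X -> R) (c : R) : Q.-integrable setT (EFin \o h) ->
    Q.-integrable setT (EFin \o (fun p => h p * c)).
  by move=> /(integrableZr measurableT c); apply: eq_integrable => // p _.
have iD (h h' : X -> R) : Q.-integrable setT (EFin \o h) -> Q.-integrable setT (EFin \o h') ->
    Q.-integrable setT (EFin \o (fun p => h p + h' p)).
  by move=> ih /(integrableD measurableT ih); apply: eq_integrable => // p _.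
have i3 := iZ _ u3 aith_int; have i4 := iZ _ u4 aiY_int; have i5 := iZ _ u5 aiY2_int.
have i12 := iD _ _ (bd_int n) (er_int n).
have i123 := iD _ _ i12 i3; have i1234 := iD _ _ i123 i4.
have E5 := RintegralD measurableT i1234 i5; have E4 := RintegralD measurableT i123 i4.
have E3 := RintegralD measurableT i12 i3; have E2 := RintegralD measurableT (bd_int n) (er_int n).
have Z3 := RintegralZr u3 measurableT aith_int.
have Z4 := RintegralZr u4 measurableT aiY_int.
have Z5 := RintegralZr u5 measurableT aiY2_int.
rewrite hG in Z3; rewrite hK in Z4; rewrite -/c0 in Z5.
rewrite -Z3 -Z4 -Z5; apply: etrans (etrans E5 _).
  by apply: eq_Rintegral => p _; exact: defect_split.
by congr (_ + _); apply: (etrans E4); congr (_ + _); apply: (etrans E3); congr (_ + _).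
Qed.

(* The first-order Taylor terms in the jump [z + theta K] cancel by the choice of
   [K]; the mass that the shift by the delay leaves on [theta, 0] produces the
   factor [1 + G]. *)
Theorem lap_ridge_limit :
  (b n * (1 + G) * Psi k n 0 - (lam n)^-1 ^+ 2 * (c0 / 2) * Psi k2 n 0) @[n --> \oo]
  --> (1 + G) * k 0.
Proof.
have -> : (fun n => b n * (1 + G) * Psi k n 0 - (lam n)^-1 ^+ 2 * (c0 / 2) * Psi k2 n 0) =
  (fun n => ridge nu k (xi n) 0 0 + lap (b n) (Tn n) + \int[Q]_p bd n p + \int[Q]_p er n p).
  apply/funext => n.
  apply: balance (decomposition n).
  by have := LRident n; rewrite {1}/kap dotZl.
rewrite (_ : (1 + G) * k 0 = k 0 + 0 + G * k 0 + 0); last by ring.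
by apply: cvgD => //; apply: cvgD => //; apply: cvgD.
Qed.

End asymptotics.

End delay_asymptotics.

(** * Approximation by trigonometric polynomials *)

Section bernstein.
Context {R : realType}.
Implicit Types (u c : R) (f g : nat -> R).

(* The expectation of [f] at the number of successes in [n] Bernoulli([u]) tosses,
   by recursion on the tosses. *)
Fixpoint bern (n : nat) u f : R :=
  if n is m.+1 then u * bern m u (f \o S) + (1 - u) * bern m u f else f 0%N.

Lemma bern_le n u f g : 0 <= u <= 1 ->
  (forall j, (j <= n)%N -> f j <= g j) -> bern n u f <= bern n u g.
Proof.
move=> /andP[u0 u1]; elim: n f g => [|n IH] f g fg /=; first exact: fg.
apply: lerD; rewrite ler_wpM2l ?subr_ge0//; apply: IH => j jn; apply: fg => //.
exact: leqW.
Qed.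

Lemma bern_lin n u c d f g :
  bern n u (fun j => c * f j + d * g j) = c * bern n u f + d * bern n u g.
Proof.
elim: n f g => [//|n IH] f g /=; rewrite IH.
rewrite (_ : (_ \o S) = (fun j => c * (f \o S) j + d * (g \o S) j))// IH; ring.
Qed.

Lemma bern_cst n u c : bern n u (fun=> c) = c.
Proof.
elim: n => [//|n IH] /=; rewrite (_ : (fun=> c) \o S = fun=> c)// IH; ring.
Qed.

Lemma eq_bern n u f g : f =1 g -> bern n u f = bern n u g.
Proof. by move=> /funext ->. Qed.

Lemma bern_mean n u : bern n u (fun j => j%:R - n%:R * u) = 0.
Proof.
elim: n => [|n IH] /=; first by rewrite mul0r subr0.
rewrite (@eq_bern n u _ (fun j => 1 * (j%:R - n%:R * u) + (1 - u) * 1)); last first.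
  by move=> j /=; rewrite -[in j.+1%:R]natr1 -natr1; ring.
rewrite (@eq_bern n u (fun j => j%:R - n.+1%:R * u) (fun j => 1 * (j%:R - n%:R * u) + (- u) * 1)); last first.
  by move=> j /=; rewrite -natr1; ring.
rewrite !bern_lin IH !bern_cst; ring.
Qed.

(** With one more toss the centred variable moves by [1 - u] or by [- u]; the cross terms vanish by
    [bern_mean], and the squares add [u * (1 - u)]. *)
Lemma bern_var n u :
  bern n u (fun j => (j%:R - n%:R * u) ^+ 2) = n%:R * (u * (1 - u)).
Proof.
elim: n => [|n IH] /=; first by rewrite mul0r subr0 expr0n /= mul0r.
rewrite (@eq_bern n u _ (fun j => 1 * (j%:R - n%:R * u) ^+ 2 + 1 *
    (2 * (1 - u) * (j%:R - n%:R * u) + (1 - u) ^+ 2 * 1))); last first.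
  by move=> j /=; rewrite -[in j.+1%:R]natr1 -natr1; ring.
rewrite (@eq_bern n u (fun j => (j%:R - n.+1%:R * u) ^+ 2)
  (fun j => 1 * (j%:R - n%:R * u) ^+ 2 + 1 *
    (- 2 * u * (j%:R - n%:R * u) + u ^+ 2 * 1))); last first.
  by move=> j /=; rewrite -natr1; ring.
rewrite !bern_lin IH bern_mean !bern_cst -natr1; ring.
Qed.

Lemma bern_var_le n u : 0 <= u <= 1 ->
  bern n u (fun j => (j%:R - n%:R * u) ^+ 2) <= n%:R.
Proof. by move=> /andP[u0 u1]; rewrite bern_var ler_piMr//; nra. Qed.

Section multivariate.
Context {N : nat}.
Implicit Types (y t : 'rV[R]_N) (h : 'rV[R]_N -> R).

Definition setc y (i : 'I_N) (v : R) : 'rV[R]_N :=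
  \row_j (if j == i then v else y 0 j).

Definition grid (L : R) (n j : nat) : R := - L + 2 * L * (j%:R / n%:R).

(** The coordinates in [s] are overwritten by independent random grid points of mean
    [- L + 2 * L * u i]; the others are kept from [y]. When [s] lists all coordinates the value no
    longer depends on [y] and is a polynomial in the [u i]. *)
Fixpoint mbern (L : R) n (u : 'I_N -> R) (s : seq 'I_N) h y : R :=
  if s is i :: s' then
    bern n (u i) (fun j => mbern L n u s' h (setc y i (grid L n j)))
  else h y.

Definition cube (L : R) : set 'rV[R]_N := [set y | forall i, - L <= y 0 i <= L].

Lemma cube_setc L y i v : - L <= v <= L -> cube L y -> cube L (setc y i v).
Proof. by move=> vL yL j; rewrite mxE; case: eqP => // _; exact: yL. Qed.

Lemma grid_itv L n j : 0 <= L -> (0 < n)%N -> (j <= n)%N -> - L <= grid L n j <= L.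
Proof.
move=> L0 n0 jn; rewrite /grid.
have h0 : 0 <= j%:R / n%:R :> R by rewrite divr_ge0.
have h1 : j%:R / n%:R <= 1 :> R by rewrite ler_pdivrMr ?ltr0n// mul1r ler_nat.
by apply/andP; split; nra.
Qed.

(** Chebyshev's argument. Continuity at [t] is encoded as [e] plus a multiple of the squared
    distance to [t]; averaging a coordinate whose mean is [t 0 i] replaces its square by a variance,
    at most [4 * L ^+ 2 / n%:R]. *)
Lemma mbern_error L n (u : 'I_N -> R) s h y t (c e C : R) :
  0 <= L -> (0 < n)%N -> 0 <= C -> (forall i, 0 <= u i <= 1) -> uniq s ->
  (forall i, t 0 i = - L + 2 * L * u i) ->
  (forall y, cube L y -> `|h y - c| <= e + C * \sum_i (y 0 i - t 0 i) ^+ 2) ->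
  cube L y ->
  `|mbern L n u s h y - c| <=
    e + C * (\sum_(i | i \notin s) (y 0 i - t 0 i) ^+ 2 + (size s)%:R * (4 * L ^+ 2 / n%:R)).
Proof.
move=> L0 n0 C0 u01 us tE hc.
elim: s us y => [|i s IH] /= us y yL.
  by rewrite mul0r addr0; exact: hc.
move: us => /andP[is_ us].
have n0' : 0 < n%:R :> R by rewrite ltr0n.
set D := \sum_(j | j \notin i :: s) (y 0 j - t 0 j) ^+ 2.
have key j : (j <= n)%N -> `|mbern L n u s h (setc y i (grid L n j)) - c| <=
   e + C * (D + (size s)%:R * (4 * L ^+ 2 / n%:R)) +
   C * (4 * L ^+ 2 / n%:R ^+ 2) * (j%:R - n%:R * u i) ^+ 2.
  move=> jn; have cj := cube_setc i (grid_itv L0 n0 jn) yL.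
  apply: (le_trans (IH us _ cj)).
  rewrite (bigD1 i)//= mxE eqxx.
  have -> : \sum_(j0 | (j0 \notin s) && (j0 != i)) (setc y i (grid L n j) 0 j0 - t 0 j0) ^+ 2 = D.
    rewrite /D; apply: eq_big => [j0|j0 /andP[_ /negPf ji]].
      by rewrite inE negb_or andbC.
    by rewrite mxE ji.
  rewrite tE le_eqVlt; apply/orP; left; apply/eqP; rewrite /grid; field.
  exact: lt0r_neq0.
set K0 := e + C * (D + _) in key; set K1 := C * (4 * L ^+ 2 / n%:R ^+ 2) in key.
have K10 : 0 <= K1 by rewrite mulr_ge0// divr_ge0 ?mulr_ge0 ?sqr_ge0// exprn_ge0.
have up : bern n (u i) (fun j => K0 * 1 + K1 * (j%:R - n%:R * u i) ^+ 2) <= K0 + K1 * n%:R.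
  by rewrite bern_lin bern_cst mulr1 lerD2l ler_wpM2l// bern_var_le.
have E : K0 + K1 * n%:R = e + C * (D + (size s).+1%:R * (4 * L ^+ 2 / n%:R)).
  by rewrite /K0 /K1 -natr1; field; exact: lt0r_neq0.
rewrite -E ler_norml; apply/andP; split.
- rewrite -(opprK (K0 + _)) in up *.
  have : c * 1 + - 1 * (K0 + K1 * n%:R) <= bern n (u i) (fun j => mbern L n u s h (setc y i (grid L n j))).
    apply: (@le_trans _ _ (bern n (u i) (fun j => c * 1 + - 1 * (K0 * 1 + K1 * (j%:R - n%:R * u i) ^+ 2)))).
      rewrite bern_lin bern_cst lerD2l -subr_ge0; move: up; rewrite opprK; lra.
    apply: bern_le => // j /key; rewrite ler_norml => /andP[+ _]; lra.
  by rewrite opprK; lra.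
- have : bern n (u i) (fun j => mbern L n u s h (setc y i (grid L n j))) <= c * 1 + 1 * (K0 + K1 * n%:R).
    apply: (@le_trans _ _ (bern n (u i) (fun j => c * 1 + 1 * (K0 * 1 + K1 * (j%:R - n%:R * u i) ^+ 2)))).
      apply: bern_le => // j /key; rewrite ler_norml => /andP[_ +]; lra.
    by rewrite bern_lin bern_cst; lra.
  lra.
Qed.

Lemma mbern_bound L n (u : 'I_N -> R) s h y (M : R) : (forall i, 0 <= u i <= 1) ->
  (forall y, `|h y| <= M) -> `|mbern L n u s h y| <= M.
Proof.
move=> u01 hM; elim: s y => [//|i s IH] y /=; rewrite ler_norml; apply/andP; split.
  rewrite -(bern_cst n (u i) (- M)); apply: bern_le => // j _.
  by have := IH (setc y i (grid L n j)); rewrite ler_norml => /andP[].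
rewrite -[leRHS](bern_cst n (u i) M); apply: bern_le => // j _.
by have := IH (setc y i (grid L n j)); rewrite ler_norml => /andP[].
Qed.

Lemma cube_compact L : compact (cube L).
Proof.
have := @rV_compact R N (fun=> `[- L, L]%classic) (fun=> @segment_compact _ _ _).
congr (compact _); apply/seteqP; split => y /= yL i; have := yL i; by rewrite /= in_itv.
Qed.

(** Heine-Cantor by contradiction, at a cluster point of the first components of offending pairs. *)
Lemma cube_uniform_continuity h L e : continuous h -> 0 < e ->
  exists2 d : R, 0 < d & forall x y, cube L x -> cube L y -> `|x - y| < d -> `|h x - h y| <= e.
Proof.
move=> ch e0; apply: contrapT => H.
have P n : exists xy : 'rV[R]_N * 'rV[R]_N, [/\ cube L xy.1, cube L xy.2,
    `|xy.1 - xy.2| < n.+1%:R^-1 & e < `|h xy.1 - h xy.2| ].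
  apply: contrapT => Hn; apply: H; exists n.+1%:R^-1; first by rewrite invr_gt0.
  move=> x y xL yL xy; rewrite leNgt; apply/negP => exy; apply: Hn.
  by exists (x, y).
have [u uP] := choice P.
have [p [pL clp]] := @cube_compact L (fmap (fun n => (u n).1) \oo) _
  (filterS (fun n _ => let: And4 a _ _ _ := uP n in a) (@filterT _ \oo _)).
have /cvgrPdist_lt /(_ (e / 2)) := ch p; rewrite divr_gt0// => /(_ isT) nb.
have [d /= d0 bd] : exists2 d : R, 0 < d & forall z, `|p - z| < d -> `|h p - h z| < e / 2.
  have /nbhs_ballP[d /= d0 hd] := nb; exists d => // z zd; apply: hd.
  by rewrite -ball_normE.
have [n0 n0d] : exists n0, n0.+1%:R^-1 < d / 2.
  have := near_infty_natSinv_lt (PosNum (divr_gt0 d0 (ltr0n R 2))).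
  by move=> [n0 _ /(_ n0 (leqnn _))] /=; exists n0.
have b2 : nbhs p (ball p (d / 2)) by apply: nbhsx_ballx; rewrite divr_gt0.
have fA : ((fun n => (u n).1) @ \oo) [set (u n).1 | n in [set n | (n0 <= n)%N]].
  by exists n0 => // n /= n0n; exists n.
have [z [[n /= n0n <-] zb]] := clp _ _ fA b2.
move: zb; rewrite -ball_normE /= => zb.
have [_ _ uxy ue] := uP n.
have h1 : `|h p - h (u n).1| < e / 2 by apply: bd; apply: lt_trans zb _; lra.
have h2 : `|h p - h (u n).2| < e / 2.
  apply: bd; apply: le_lt_trans (ler_distD (u n).1 _ _) _.
  have : n.+1%:R^-1 <= n0.+1%:R^-1 :> R by rewrite lef_pV2 ?posrE ?ltr0n// ler_nat.
  by move=> h3; rewrite (splitr d) ltrD// (lt_trans (lt_le_trans uxy h3)).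
have : `|h (u n).1 - h (u n).2| < e.
  by apply: le_lt_trans (ler_distD (h p) _ _) _; rewrite distrC; lra.
by move=> /(lt_trans ue); rewrite ltxx.
Qed.

End multivariate.
End bernstein.

Section trigonometric.
Context {R : realType} {N : nat}.
Implicit Types (f g : 'rV[R]_N -> R) (x z : 'rV[R]_N).

(** Products are not among the constructors, since limits of Laplace transforms pass through linear
    combinations only; [trig_mul] recovers products by the product-to-sum formulas. *)
Inductive trig : ('rV[R]_N -> R) -> Prop :=
| trig_cos z : trig (fun x => cos (dot z x))
| trig_sin z : trig (fun x => sin (dot z x))
| trig_add f g : trig f -> trig g -> trig (fun x => f x + g x)
| trig_scale c f : trig f -> trig (fun x => c * f x).

Lemma dotDl (u v x : 'rV[R]_N) : dot (u + v) x = dot u x + dot v x.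
Proof. by rewrite -big_split; apply: eq_bigr => i _; rewrite mxE mulrDl. Qed.

Lemma dotNl (u x : 'rV[R]_N) : dot (- u) x = - dot u x.
Proof. by rewrite -scaleN1r dotZl mulN1r. Qed.

Lemma eq_trig f g : f =1 g -> trig f -> trig g.
Proof. by move=> /funext ->. Qed.

Lemma trig_cst c : trig (fun=> c).
Proof.
apply: (@eq_trig (fun x => c * cos (dot 0 x))); last by apply: trig_scale; exact: trig_cos.
by move=> x; rewrite /dot big1 ?cos0 ?mulr1// => i _; rewrite mxE mul0r.
Qed.

Lemma trig_mul f g : trig f -> trig g -> trig (fun x => f x * g x).
Proof.
have base z f' : trig f' -> trig (fun x => cos (dot z x) * f' x) /\
    trig (fun x => sin (dot z x) * f' x).
  elim=> [z'|z'|f1 g1 _ [c1 s1] _ [c2 s2]|c f1 _ [c1 s1]].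
  - split.
    + apply: (@eq_trig (fun x => 2^-1 * (cos (dot (z + z') x) + cos (dot (z + - z') x)))).
        by move=> x; rewrite !dotDl dotNl !cosD cosN sinN; field.
      by apply: trig_scale; apply: trig_add; exact: trig_cos.
    + apply: (@eq_trig (fun x => 2^-1 * (sin (dot (z + z') x) + sin (dot (z + - z') x)))).
        by move=> x; rewrite !dotDl dotNl !sinD cosN sinN; field.
      by apply: trig_scale; apply: trig_add; exact: trig_sin.
  - split.
    + apply: (@eq_trig (fun x => 2^-1 * (sin (dot (z + z') x) + (-1) * sin (dot (z + - z') x)))).
        by move=> x; rewrite !dotDl dotNl !sinD cosN sinN; field.
      by apply: trig_scale; apply: trig_add; [exact: trig_sin|apply: trig_scale; exact: trig_sin].
    + apply: (@eq_trig (fun x => 2^-1 * (cos (dot (z + - z') x) + (-1) * cos (dot (z + z') x)))).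
        by move=> x; rewrite !dotDl dotNl !cosD cosN sinN; field.
      by apply: trig_scale; apply: trig_add; [exact: trig_cos|apply: trig_scale; exact: trig_cos].
  - split.
    + by apply: eq_trig (trig_add c1 c2) => x; rewrite mulrDr.
    + by apply: eq_trig (trig_add s1 s2) => x; rewrite mulrDr.
  - split.
    + by apply: eq_trig (trig_scale c c1) => x; rewrite mulrCA.
    + by apply: eq_trig (trig_scale c s1) => x; rewrite mulrCA.
move=> tf tg; elim: tf => [z|z|f1 f2 _ h1 _ h2|c f1 _ h1].
- by case: (base z g tg).
- by case: (base z g tg).
- by apply: eq_trig (trig_add h1 h2) => x; rewrite mulrDl.
- by apply: eq_trig (trig_scale c h1) => x; rewrite mulrA.
Qed.

Lemma trig_bern n (u : 'rV[R]_N -> R) (F : nat -> 'rV[R]_N -> R) : trig u ->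
  (forall j, trig (F j)) -> trig (fun x => bern n (u x) (F ^~ x)).
Proof.
move=> tu; elim: n F => [|n IH] F tF /=; first exact: tF.
apply: trig_add; first by apply: trig_mul => //; apply: (IH (fun j => F j.+1)) => j; exact: tF.
apply: trig_mul; last exact: IH.
by apply: eq_trig (trig_add (trig_cst 1) (trig_scale (-1) tu)) => x; rewrite mulN1r.
Qed.

Lemma trig_mbern L n (u : 'I_N -> 'rV[R]_N -> R) s (h : 'rV[R]_N -> R) y :
  (forall i, trig (u i)) -> trig (fun x => mbern L n (u ^~ x) s h y).
Proof.
move=> tu; elim: s y => [|i s IH] y /=; first exact: trig_cst.
by apply: (trig_bern n (tu i)) => j; exact: IH.
Qed.

Lemma trig_Cb f : trig f -> is_Cb f.
Proof.
elim=> [z|z|f1 g1 _ [c1 [M1 b1]] _ [c2 [M2 b2]]|c f1 _ [c1 [M1 b1]]].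
- split; first by apply: cts_comp; [exact: continuous_cos|exact: continuous_dot].
  by exists 1 => x; rewrite ler_norml cos_geN1 cos_le1.
- split; first by apply: cts_comp; [exact: continuous_sin|exact: continuous_dot].
  by exists 1 => x; rewrite ler_norml sin_geN1 sin_le1.
- split; first exact: ctsD.
  by exists (M1 + M2) => x; rewrite (le_trans (ler_normD _ _))// lerD.
- split; first by apply: ctsM => //; exact: cts_cst.
  by exists (`|c| * M1) => x; rewrite normrM ler_wpM2l.
Qed.

Lemma rV_norm_lt x (d : R) : 0 < d -> (forall i, `|x 0 i| < d) -> `|x| < d.
Proof.
move=> d0 xd; rewrite [ltLHS]/Num.Def.normr /= mx_normrE; apply/bigmax_ltP; split => //.
by move=> [i j] _ /=; rewrite ord1.
Qed.

(* [h \o sin_box L] is a function of the sines [sin (x_i / L)], so its Bernstein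
   polynomials in [(1 + sin (x_i / L)) / 2] are trigonometric; and [sin_box L]
   tends to the identity as [L] grows. *)
Definition sin_box (L : R) x : 'rV[R]_N := \row_i (L * sin (x 0 i / L)).

Lemma sin_box_close L r x : 1 <= L -> (forall i, `|x 0 i| <= r) ->
  forall i, `|sin_box L x 0 i| <= r /\ `|sin_box L x 0 i - x 0 i| <= r ^+ 2 / L.
Proof.
move=> L1 xr i; have L0 : 0 < L by exact: lt_le_trans L1.
have := smooth3_lip (@smooth3_sin R) (x 0 i / L) 0.
have := smooth3_taylor1 (@smooth3_sin R) 0 (x 0 i / L).
rewrite add0r sin0 cos0 !subr0 mulr1 !mul1r mxE => h2 h1; split.
  rewrite normrM (gtr0_norm L0) (le_trans _ (xr i))//.
  by rewrite mulrC -ler_pdivlMr// (le_trans h1)// normrM normfV (gtr0_norm L0).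
have -> : L * sin (x 0 i / L) - x 0 i = L * (sin (x 0 i / L) - x 0 i / L).
  by rewrite mulrBr mulrCA divff ?mulr1// lt0r_neq0.
rewrite normrM (gtr0_norm L0).
have -> : r ^+ 2 / L = L * (r ^+ 2 / L ^+ 2) by field; exact: lt0r_neq0.
rewrite ler_pM2l// (le_trans h2)// exprMn exprVn ler_pM2r ?invr_gt0 ?exprn_gt0//.
by rewrite -real_normK ?num_real// ler_sqr ?nnegrE// (le_trans _ (xr i)).
Qed.

Lemma trig_approx_box (h : 'rV[R]_N -> R) (M L e : R) : continuous h ->
  (forall x, `|h x| <= M) -> 0 < L -> 0 < e ->
  exists q, [/\ trig q, forall x, `|q x| <= M & forall x, `|q x - h (sin_box L x)| <= e].
Proof.
move=> ch hM L0 e0.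
have M0 : 0 <= M by apply: le_trans (hM 0).
have e20 : 0 < e / 2 by rewrite divr_gt0.
have [d d0 dP] := cube_uniform_continuity L ch e20.
(* When [y] is at distance at least [d] from [t], some coordinate differs by at least [d], and the
   trivial bound [2 * M] is at most [C] times its square. *)
pose C := 2 * M / d ^+ 2.
have C0 : 0 <= C by rewrite divr_ge0 ?sqr_ge0// mulr_ge0.
pose W := C * (N%:R * (4 * L ^+ 2)).
have W0 : 0 <= W by rewrite mulr_ge0// mulr_ge0// mulr_ge0// sqr_ge0.
(* The variances of all coordinates contribute [W / n%:R], made at most [e / 2]. *)
pose n := (Num.truncn (W / (e / 2))).+1.
have Wn : W / n%:R <= e / 2.
  rewrite ler_pdivrMr ?ltr0n// mulrC -ler_pdivrMr//.
  by apply/ltW; have /Num.Theory.truncn_itv/andP[] : 0 <= W / (e / 2) by rewrite divr_ge0// ltW.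
pose u i x := 2^-1 * (1 + sin (dot (L^-1 *: delta_mx 0 i) x)).
have dE i x : dot (L^-1 *: delta_mx 0 i) x = x 0 i / L.
  rewrite dotZl /dot (bigD1 i)//= mxE !eqxx mul1r big1 ?addr0 1?mulrC// => j ji.
  by rewrite mxE eqxx (negPf ji) mul0r.
have u01 x i : 0 <= u i x <= 1.
  rewrite /u; have := sin_geN1 (dot (L^-1 *: delta_mx 0 i) x).
  have := sin_le1 (dot (L^-1 *: delta_mx 0 i) x).
  by move=> h1 h2; apply/andP; split; lra.
have tu i : trig (u i).
  apply: trig_scale; apply: trig_add; first exact: trig_cst.
  exact: trig_sin.
exists (fun x => mbern L n (u ^~ x) (enum 'I_N) h 0); split.
- exact: trig_mbern.
- by move=> x; apply: mbern_bound.
- move=> x; set t := sin_box L x.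
  have tE i : t 0 i = - L + 2 * L * u i x by rewrite mxE /u dE; field.
  have tL : cube L t.
    by move=> i; rewrite tE; have /andP[h1 h2] := u01 x i; apply/andP; split; nra.
  have hb y : cube L y -> `|h y - h t| <= e / 2 + C * \sum_i (y 0 i - t 0 i) ^+ 2.
    move=> yL; have S0 : 0 <= \sum_i (y 0 i - t 0 i) ^+ 2 by apply: sumr_ge0 => i _; exact: sqr_ge0.
    have [yt|yt] := ltP `|y - t| d.
      by rewrite (le_trans (dP _ _ yL tL yt))// lerDl mulr_ge0.
    have [i di] : exists i, d <= `|y 0 i - t 0 i|.
      apply: contrapT => H; move: yt; rewrite leNgt => /negP; apply.
      apply: rV_norm_lt => // i; rewrite !mxE ltNge; apply/negP => di.
      by apply: H; exists i; move: di; rewrite mxE.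
    apply: (@le_trans _ _ (2 * M)).
      by rewrite (le_trans (ler_normB _ _))// mulr_natl mulr2n lerD.
    rewrite -[leLHS]add0r; apply: lerD; first exact: ltW.
    have -> : 2 * M = C * d ^+ 2 by rewrite /C; field; exact: lt0r_neq0.
    rewrite ler_wpM2l// (bigD1 i)//= -[leLHS]addr0 lerD//.
      by rewrite -[leRHS]real_normK ?num_real// ler_sqr ?nnegrE// ltW.
    by apply: sumr_ge0 => j _; exact: sqr_ge0.
  have c0 : cube L (0 : 'rV[R]_N) by move=> i; rewrite mxE oppr_le0 ltW.
  have := mbern_error (ltW L0) (ltn0Sn _) C0 (u01 x) (enum_uniq 'I_N) tE hb c0.
  move=> /(_ (Num.truncn (W / (e / 2)))) /le_trans; apply.
  rewrite big1 ?add0r => [|i]; last by rewrite mem_enum.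
  rewrite size_enum_ord [leRHS]splitr lerD2l.
  rewrite -/n; move: Wn; rewrite /W !mulrA; exact.
Qed.

(** Closeness is uniform on bounded boxes only, but the bound [M] of [h] is kept everywhere: outside
    a box the error is left to tightness. *)
Lemma trig_approx (h : 'rV[R]_N -> R) (M : R) : continuous h ->
  (forall x, `|h x| <= M) ->
  exists q : nat -> 'rV[R]_N -> R, [/\ forall n, trig (q n),
    forall n x, `|q n x| <= M &
    forall e r : R, 0 < e -> exists n0, forall n x, (n0 <= n)%N ->
      (forall i, `|x 0 i| <= r) -> `|q n x - h x| <= e].
Proof.
move=> ch hM.
have H n := @trig_approx_box h M n.+1%:R n.+1%:R^-1 ch hM (ltr0Sn R n).
have {}H n : exists q, [/\ trig q, forall x, `|q x| <= M &
    forall x, `|q x - h (sin_box n.+1%:R x)| <= n.+1%:R^-1].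
  by apply: H; rewrite invr_gt0.
have [q qP] := choice H; exists q; split.
- by move=> n; case: (qP n).
- by move=> n; case: (qP n).
move=> e r e0; have e20 : 0 < e / 2 by rewrite divr_gt0.
have [d d0 dP] := cube_uniform_continuity r ch e20.
(* From [n0] on, the sine distorts the box of size [r] by at most [r ^+ 2 / n.+1%:R < d], and the
   error [n.+1%:R^-1] of the Bernstein polynomials is at most [e / 2]. *)
pose n0 := Num.truncn (r ^+ 2 / d + (e / 2)^-1).
exists n0 => n x n0n xr; have [_ _ /(_ x) qx] := qP n.
have a0 : 0 <= r ^+ 2 / d by rewrite divr_ge0 ?sqr_ge0// ltW.
have b0 : 0 < (e / 2)^-1 by rewrite invr_gt0.
have nn : r ^+ 2 / d + (e / 2)^-1 < n.+1%:R.
  have /Num.Theory.truncn_itv/andP[_ h1] : 0 <= r ^+ 2 / d + (e / 2)^-1 by rewrite addr_ge0// ltW.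
  by apply: lt_le_trans h1 _; rewrite ler_nat.
have n1 : r ^+ 2 / n.+1%:R < d.
  rewrite ltr_pdivrMr ?ltr0n// mulrC -ltr_pdivrMr//; lra.
have n2 : n.+1%:R^-1 <= e / 2.
  by rewrite -[leRHS]invrK lef_pV2 ?posrE ?ltr0n//; apply: ltW; lra.
apply: le_trans (ler_distD (h (sin_box n.+1%:R x)) _ _) _.
rewrite [leRHS]splitr lerD//; first exact: le_trans qx n2.
have L1 : 1 <= n.+1%:R :> R by rewrite ler1n.
have sb := sin_box_close L1 xr.
apply: dP.
- by move=> i; rewrite -ler_norml; case: (sb i).
- by move=> i; rewrite -ler_norml.
- apply: rV_norm_lt => // i; case: (sb i) => _ h1.
  by rewrite !mxE; apply: le_lt_trans n1; move: h1; rewrite mxE.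
Qed.

End trigonometric.

(** * Gaussian test functions and the diffusion equation *)

Section directional.
Context {R : realType} {V : normedModType R}.
Implicit Types (F : V -> R) (x v : V).

(** A directional derivative is an ordinary derivative along a line, which makes the one-variable
    rules available. *)
Lemma line_quotient F x v (d : R) :
  is_derive x v F d <-> is_derive (0 : R) (1 : R) (fun h : R => F (h *: v + x)) d.
Proof.
have E : (fun h : R => h^-1 *: (((fun h : R => F (h *: v + x)) \o shift (0 : R)) (h *: (1 : R)) - F (0 *: v + x))) =
   (fun h : R => h^-1 *: ((F \o shift x) (h *: v) - F x)).
  by apply/funext => h /=; rewrite addr0 scale0r add0r [h *: 1]mulr1.
split=> -[D dD]; apply: DeriveDef.
- by rewrite /derivable E.
- by rewrite /derive E.
- by rewrite /derivable -E.
- by rewrite /derive -E.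
Qed.

Lemma is_derive_comp_dir (g : R -> R) F x v (dg dF : R) :
  is_derive (F x) (1 : R) g dg -> is_derive x v F dF ->
  is_derive x v (fun y => g (F y)) (dg * dF).
Proof.
move=> hg /line_quotient hF; apply/line_quotient.
apply: (@is_derive1_comp R g (fun h : R => F (h *: v + x))) => //.
by rewrite scale0r add0r.
Qed.

Lemma is_derive_linear F x v : (forall (h : R) y w, F (h *: w + y) = h * F w + F y) ->
  is_derive x v F (F v).
Proof.
move=> FL; apply/line_quotient.
rewrite (_ : (fun h => _) = (fun h => h * F v + F x)); last by apply/funext => h; exact: FL.
by apply: is_derive_eq; rewrite /GRing.scale /=; ring.
Qed.

Lemma is_derive_mulr F G x v (dF dG : R) : is_derive x v F dF -> is_derive x v G dG ->
  is_derive x v (fun y => F y * G y) (dF * G x + F x * dG).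
Proof.
move=> hF hG; apply: (@is_derive_eq _ _ _ _ _ _ _ _ (is_deriveM hF hG)).
by rewrite /GRing.scale /= addrC [G x * _]mulrC.
Qed.

End directional.

Section schwartz_class.
Context {R : realType} {N : nat}.
Notation X := (R * 'rV[R]_N)%type.

(** Given by constructors, so that stability under derivatives and polynomial growth are
    inductions. *)
Inductive polynomial_fun : (X -> R) -> Prop :=
| pf_cst c : polynomial_fun (fun=> c)
| pf_time : polynomial_fun (fun p => p.1)
| pf_coord i : polynomial_fun (fun p => p.2 0 i)
| pf_add f g : polynomial_fun f -> polynomial_fun g -> polynomial_fun (fun p => f p + g p)
| pf_mul f g : polynomial_fun f -> polynomial_fun g -> polynomial_fun (fun p => f p * g p).

Lemma pf_sum (I : Type) (r : seq I) (F : I -> X -> R) :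
  (forall i, polynomial_fun (F i)) -> polynomial_fun (fun p => \sum_(i <- r) F i p).
Proof.
move=> hF; elim: r => [|i r IH].
  rewrite (_ : (fun p => _) = fun=> 0); first exact: pf_cst.
  by apply/funext => p; rewrite big_nil.
rewrite (_ : (fun p => _) = fun p => F i p + \sum_(j <- r) F j p); first exact: pf_add.
by apply/funext => p; rewrite big_cons.
Qed.

Lemma continuous_time : continuous (fun p : X => p.1).
Proof. by move=> p; exact: cvg_fst. Qed.

Lemma continuous_space_coord (i : 'I_N) : continuous (fun p : X => p.2 0 i).
Proof.
move=> p; apply: (@continuous_comp _ _ _ (fun p : X => p.2) (fun x : 'rV[R]_N => x 0 i)).
  exact: cvg_snd.
exact: coord_continuous.
Qed.

Lemma pf_continuous f : polynomial_fun f -> continuous f.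
Proof.
elim=> [c||i|g h _ cg _ ch|g h _ cg _ ch].
- exact: cts_cst.
- exact: continuous_time.
- exact: continuous_space_coord.
- exact: ctsD.
- exact: ctsM.
Qed.

Lemma pf_derive (v : X) f : polynomial_fun f ->
  exists2 df, polynomial_fun df & forall p, is_derive p v f (df p).
Proof.
elim=> [c||i|g h pg [dg pdg Dg] ph [dh pdh Dh]|g h pg [dg pdg Dg] ph [dh pdh Dh]].
- by exists (fun=> 0) => [|p]; [exact: pf_cst|exact: is_derive_cst].
- exists (fun=> v.1) => [|p]; first exact: pf_cst.
  exact: (@is_derive_linear _ _ (fun p : X => p.1)).
- exists (fun=> v.2 0 i) => [|p]; first exact: pf_cst.
  by apply: (@is_derive_linear _ _ (fun p : X => p.2 0 i)) => h y w; rewrite /= !mxE.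
- exists (fun p => dg p + dh p) => [|p]; first exact: pf_add.
  by have ? := Dg p; have ? := Dh p; exact: is_deriveD.
- exists (fun p => dg p * h p + g p * dh p) => [|p]; first by apply: pf_add; exact: pf_mul.
  exact: is_derive_mulr.
Qed.

Lemma coord_le_norm (x : 'rV[R]_N) i : `|x 0 i| <= `|x|.
Proof.
rewrite [leRHS]/Num.Def.normr /= mx_normrE; apply/bigmax_geP; right => /=.
by exists (0, i).
Qed.

Lemma pair_norm_ge (p : X) : `|p.1| <= `|p| /\ `|p.2| <= `|p|.
Proof. by split; rewrite [leRHS]prod_normE le_max lexx ?orbT. Qed.

Lemma pf_growth f : polynomial_fun f ->
  exists C m, forall p : X, `|f p| <= C * (1 + `|p|) ^+ m.
Proof.
have n1 (p : X) : 1 <= 1 + `|p| by rewrite lerDl.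
elim=> [c||i|g h _ [C [m hg]] _ [D [l hh]]|g h _ [C [m hg]] _ [D [l hh]]].
- by exists `|c|, 0%N => p; rewrite expr0 mulr1.
- exists 1, 1%N => p; rewrite mul1r expr1; have [h _] := pair_norm_ge p; lra.
- exists 1, 1%N => p; rewrite mul1r expr1; have [_ h] := pair_norm_ge p.
  have := coord_le_norm p.2 i; lra.
- exists (`|C| + `|D|), (m + l)%N => p.
  have E0 j : 0 <= (1 + `|p|) ^+ j by rewrite exprn_ge0// addr_ge0.
  have E1 j : 1 <= (1 + `|p|) ^+ j by rewrite exprn_ege1.
  rewrite (le_trans (ler_normD _ _))// mulrDl lerD//.
    apply: le_trans (hg p) _; apply: (@le_trans _ _ (`|C| * (1 + `|p|) ^+ m)).
      by rewrite ler_wpM2r// ler_norm.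
    by rewrite ler_wpM2l// exprD ler_peMr.
  apply: le_trans (hh p) _; apply: (@le_trans _ _ (`|D| * (1 + `|p|) ^+ l)).
    by rewrite ler_wpM2r// ler_norm.
  by rewrite ler_wpM2l// exprD ler_peMl.
- exists (C * D), (m + l)%N => p.
  by rewrite normrM exprD mulrACA ler_pM.
Qed.

Variables (a eta : R) (zeta : 'rV[R]_N).
Hypothesis eta0 : 0 < eta.

Definition gauss_exponent (p : X) : R :=
  - a * p.1 + - (eta ^+ 2) * (p.1 * p.1 + \sum_i p.2 0 i * p.2 0 i).

(* A family stable under all partial derivatives. *)
Definition gauss_trig (P Q : X -> R) (p : X) : R :=
  expR (gauss_exponent p) * (P p * cos (dot zeta p.2) + Q p * sin (dot zeta p.2)).

Lemma pf_exponent : polynomial_fun gauss_exponent.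
Proof.
apply: pf_add; first by apply: pf_mul; [exact: pf_cst|exact: pf_time].
apply: pf_mul; first exact: pf_cst.
apply: pf_add; first by apply: pf_mul; exact: pf_time.
by apply: pf_sum => i; apply: pf_mul; exact: pf_coord.
Qed.

Lemma is_derive_dot (v p : X) :
  is_derive p v (fun p : X => dot zeta p.2) (dot zeta v.2).
Proof.
by apply: (@is_derive_linear _ _ (fun p : X => dot zeta p.2)) => h y w; rewrite /= dotDr dotZr.
Qed.

Lemma gauss_trig_derive (v : X) P Q : polynomial_fun P -> polynomial_fun Q ->
  exists P' Q', [/\ polynomial_fun P', polynomial_fun Q' &
    forall p, is_derive p v (gauss_trig P Q) (gauss_trig P' Q' p)].
Proof.
move=> pP pQ; have [P1 pP1 dP] := pf_derive v pP; have [Q1 pQ1 dQ] := pf_derive v pQ.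
have [g pg dg] := pf_derive v pf_exponent.
pose z := dot zeta v.2.
exists (fun p => (P1 p + P p * g p) + Q p * z), (fun p => (Q1 p + Q p * g p) + P p * - z).
split.
- apply: pf_add; last by apply: pf_mul => //; exact: pf_cst.
  by apply: pf_add => //; exact: pf_mul.
- apply: pf_add; last by apply: pf_mul => //; exact: pf_cst.
  by apply: pf_add => //; exact: pf_mul.
move=> p.
have dE := is_derive_comp_dir (is_derive_expR (gauss_exponent p)) (dg p).
have dC := @is_derive_comp_dir _ _ cos (fun p : X => dot zeta p.2) p v _ _
  (is_derive_cos (dot zeta p.2)) (is_derive_dot v p).
have dS := @is_derive_comp_dir _ _ sin (fun p : X => dot zeta p.2) p v _ _
  (is_derive_sin (dot zeta p.2)) (is_derive_dot v p).
have d1 := is_derive_mulr (dP p) dC; have d2 := is_derive_mulr (dQ p) dS.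
have d12 := is_deriveD d1 d2.
apply: (@is_derive_eq _ _ _ _ _ _ _ _ (is_derive_mulr dE d12)).
rewrite /gauss_trig !fctE /= -/z; ring.
Qed.

Lemma continuous_gauss_trig P Q : polynomial_fun P -> polynomial_fun Q ->
  continuous (gauss_trig P Q).
Proof.
move=> pP pQ; have cd : continuous (fun p : X => dot zeta p.2).
  move=> p; apply: (@continuous_comp _ _ _ (fun p : X => p.2) (dot zeta)).
    exact: cvg_snd.
  exact: continuous_dot.
apply: ctsM; first by apply: cts_comp; [exact: continuous_expR|exact: pf_continuous pf_exponent].
apply: ctsD; apply: ctsM; try exact: pf_continuous.
- by apply: cts_comp => //; exact: continuous_cos.
- by apply: cts_comp => //; exact: continuous_sin.
Qed.

(** The norm of [p] is the larger of the absolute value of the time and the sup norm of [p.2], the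
    latter attained at a coordinate; so its square is bounded by one of the squares in the
    exponent. *)
Lemma exponent_le (p : X) : gauss_exponent p <= `|a| * `|p| - eta ^+ 2 * `|p| ^+ 2.
Proof.
have [h1 h2] := pair_norm_ge p; have e20 : 0 <= eta ^+ 2 by rewrite sqr_ge0.
have ha : - a * p.1 <= `|a| * `|p|.
  by rewrite (le_trans (ler_norm _))// normrM normrN ler_wpM2l.
have S0 i : 0 <= p.2 0 i * p.2 0 i by rewrite -expr2 sqr_ge0.
have hs : `|p| ^+ 2 <= p.1 * p.1 + \sum_i p.2 0 i * p.2 0 i.
  have := prod_normE p; have [_|_] := leP `|p.2| `|p.1|.
    move=> ->; rewrite real_normK ?num_real// expr2 lerDl.
    by apply: sumr_ge0.
  move=> ->; have [->|x0] := eqVneq `|p.2| 0.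
    by rewrite expr0n /= addr_ge0 ?sumr_ge0// -expr2 sqr_ge0.
  have [[i j] /= E] := mx_norm_neq0 x0.
  have -> : `|p.2| = `|p.2 0 j| by rewrite [LHS]E ord1.
  rewrite real_normK ?num_real// (bigD1 j)//= expr2 addrCA lerDl addr_ge0 -?expr2 ?sqr_ge0//.
  exact: sumr_ge0.
rewrite /gauss_exponent lerD// mulNr lerN2 ler_wpM2l//.
Qed.

Lemma expR_ge_pow (y : R) m : 0 <= y -> y ^+ m <= m`!%:R * expR y.
Proof.
move=> y0; case: m => [|m]; first by rewrite expr0 mul1r -expR0 ler_expR.
have := expR_ge1Dxn m y0.
move=> h; rewrite mulrC -ler_pdivrMr ?ltr0n ?fact_gt0//; lra.
Qed.

Lemma gauss_trig_decay (m : nat) P Q : polynomial_fun P -> polynomial_fun Q ->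
  exists C, forall p : X, (1 + `|p|) ^+ m * `|gauss_trig P Q p| <= C.
Proof.
move=> /pf_growth[C1 [m1 h1]] /pf_growth[C2 [m2 h2]].
have key l : exists C, forall p : X, (1 + `|p|) ^+ l * expR (gauss_exponent p) <= C.
  (* The power is at most l! exp (1 + y) with y the norm of [p]; completing the square bounds 1 + y
     + |a| y - eta^2 y^2 by the exponent chosen here. *)
  exists (l`!%:R * expR (1 + (`|a| + 1) ^+ 2 / (4 * eta ^+ 2))) => p.
  apply: (@le_trans _ _ (l`!%:R * expR (1 + `|p|) * expR (gauss_exponent p))).
    by rewrite ler_wpM2r ?expR_ge0// expR_ge_pow// addr_ge0.
  rewrite -mulrA -expRD ler_wpM2l// ler_expR.
  apply: (le_trans (lerD (lexx _) (exponent_le p))).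
  have e2 : eta ^+ 2 != 0 by rewrite expf_neq0// lt0r_neq0.
  have : 0 <= (eta * `|p| - (`|a| + 1) / (2 * eta)) ^+ 2 by rewrite sqr_ge0.
  have -> : (eta * `|p| - (`|a| + 1) / (2 * eta)) ^+ 2 =
     eta ^+ 2 * `|p| ^+ 2 - `|a| * `|p| - `|p| + (`|a| + 1) ^+ 2 / (4 * eta ^+ 2).
    by field; exact: lt0r_neq0.
  lra.
have [D1 k1] := key (m + m1)%N; have [D2 k2] := key (m + m2)%N.
exists (`|C1| * D1 + `|C2| * D2) => p.
have n0 : 0 <= 1 + `|p| by rewrite addr_ge0.
have p0 l : 0 <= (1 + `|p|) ^+ l by rewrite exprn_ge0.
have E0 := expR_ge0 (gauss_exponent p).
have hP : `|P p * cos (dot zeta p.2)| <= `|C1| * (1 + `|p|) ^+ m1.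
  rewrite normrM -[leRHS]mulr1 ler_pM//; last by rewrite ler_norml cos_geN1 cos_le1.
  by rewrite (le_trans (h1 p))// ler_wpM2r// ler_norm.
have hQ : `|Q p * sin (dot zeta p.2)| <= `|C2| * (1 + `|p|) ^+ m2.
  rewrite normrM -[leRHS]mulr1 ler_pM//; last by rewrite ler_norml sin_geN1 sin_le1.
  by rewrite (le_trans (h2 p))// ler_wpM2r// ler_norm.
rewrite /gauss_trig normrM (ger0_norm E0).
apply: (@le_trans _ _ ((1 + `|p|) ^+ m * (expR (gauss_exponent p) *
   (`|C1| * (1 + `|p|) ^+ m1 + `|C2| * (1 + `|p|) ^+ m2)))).
  by rewrite ler_wpM2l// ler_wpM2l// (le_trans (ler_normD _ _))// lerD.
rewrite (_ : _ * _ = `|C1| * ((1 + `|p|) ^+ (m + m1) * expR (gauss_exponent p)) +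
   `|C2| * ((1 + `|p|) ^+ (m + m2) * expR (gauss_exponent p))).
  by rewrite lerD// ler_wpM2l.
by rewrite !exprD; ring.
Qed.

Lemma schwartz_gauss_trig P Q : polynomial_fun P -> polynomial_fun Q ->
  schwartz (gauss_trig P Q).
Proof.
move=> pP pQ.
have H s : exists P' Q', [/\ polynomial_fun P', polynomial_fun Q' &
    partials s (gauss_trig P Q) = gauss_trig P' Q'].
  elim: s => [|i s [P' [Q' [pP' pQ' E]]]] /=; first by exists P, Q.
  have [P2 [Q2 [pP2 pQ2 D]]] := gauss_trig_derive (basis_dir R i) pP' pQ'.
  exists P2, Q2; split=> //; apply/funext => p; rewrite E.
  by have ? := D p; rewrite derive_val.
split=> [s|s i p|m s]; have [P' [Q' [pP' pQ' ->]]] := H s.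
- exact: continuous_gauss_trig.
- by have [P2 [Q2 [_ _ D]]] := gauss_trig_derive (basis_dir R i) pP' pQ'; case: (D p).
- exact: gauss_trig_decay.
Qed.

End schwartz_class.

Section narrow_topology.
Context {R : realType} {T : ptopologicalType}.

Lemma continuous_narrow_integral (f : T -> R) : is_Cb f ->
  continuous (fun P : narrow R T => \int[P]_x f x).
Proof.
move=> hf; pose F : Cb R T := exist _ f hf.
have h1 : continuous (fun P : narrow R T => @narrow_ev R T P : {ptws Cb R T -> R}).
  exact: initial_continuous.
have h2 : continuous (fun g : {ptws Cb R T -> R} => g F) by exact: (@proj_continuous _ (fun=> R) F).
by move=> P; apply: (continuous_comp (h1 P) (h2 _)).
Qed.

Lemma within_narrow_integral (A : set R) (mu : R -> narrow R T) (f : T -> R) :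
  {within A, continuous mu} -> is_Cb f ->
  {within A, continuous (fun t => \int[mu t]_x f x)}.
Proof.
move=> cmu hf t; have h := @continuous_narrow_integral f hf (mu t).
exact: (@continuous_comp (subspace A) (narrow R T) R mu _ t (cmu t) h).
Qed.

End narrow_topology.

(** * Gaussian-damped ridge functions and bounds uniform in the damping *)

Section gaussian_test.
Context {R : realType} {N : nat}.
Variables (B : R) (k k1 k2 : R -> R).
Hypothesis hk : smooth3 B k k1 k2.
Let kB y : `|k y| <= B. Proof. by case: hk => _ _ /(_ y)[]. Qed.
Let k1B y : `|k1 y| <= B. Proof. by case: hk => _ _ /(_ y)[]. Qed.
Let k2B y : `|k2 y| <= B. Proof. by case: hk => _ _ /(_ y)[]. Qed.
Let ck := smooth3_continuous hk.
Let ck1 := smooth3_continuous1 hk.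
Let ck2 := smooth3_continuous2 hk.
Let dk y : is_derive y (1 : R) k (k1 y). Proof. by case: hk. Qed.
Let dk1 y : is_derive y (1 : R) k1 (k2 y). Proof. by case: hk. Qed.
Variables (zeta : 'rV[R]_N) (eta : R).
Hypothesis eta0 : 0 < eta.
Hypothesis eta1 : eta <= 1.
Implicit Types (x : 'rV[R]_N) (i j : 'I_N).

Definition sqnorm x : R := \sum_i x 0 i * x 0 i.
Definition damp x : R := expR (- eta ^+ 2 * sqnorm x).
Definition test x : R := damp x * k (dot zeta x).
(** Closed forms of the partial derivatives of [test], in which every coordinate of [x] comes with a
    factor [eta]; the bounds uniform in [eta] rest on this. *)
Definition dtest j x : R :=
  damp x * (- 2 * eta ^+ 2 * x 0 j * k (dot zeta x) + zeta 0 j * k1 (dot zeta x)).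
Definition d2test i j x : R := damp x * (
  - 2 * eta ^+ 2 * x 0 i *
    (- 2 * eta ^+ 2 * x 0 j * k (dot zeta x) + zeta 0 j * k1 (dot zeta x))
  + (- 2 * eta ^+ 2 * (i == j)%:R * k (dot zeta x)
     - 2 * eta ^+ 2 * x 0 j * zeta 0 i * k1 (dot zeta x)
     + zeta 0 j * zeta 0 i * k2 (dot zeta x))).

Let e_ i : 'rV[R]_N := delta_mx 0 i.

Let dcoord i j x : is_derive x (e_ i) (fun x => x 0 j) (i == j)%:R.
Proof.
have -> : (i == j)%:R = (e_ i) 0 j :> R by rewrite mxE eqxx eq_sym.
by apply: (@is_derive_linear _ _ (fun x : 'rV[R]_N => x 0 j)) => h y w; rewrite !mxE.
Qed.

Lemma dot_delta i : dot zeta (e_ i) = zeta 0 i.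
Proof.
rewrite /dot (bigD1 i)//= mxE !eqxx mulr1 big1 ?addr0// => j ji.
by rewrite mxE eqxx (negPf ji) mulr0.
Qed.

Let ddot i x : is_derive x (e_ i) (dot zeta) (zeta 0 i).
Proof.
rewrite -dot_delta; apply: is_derive_linear => h y w.
by rewrite dotDr dotZr.
Qed.

Let dsq i x : is_derive x (e_ i) sqnorm (2 * x 0 i).
Proof.
apply/line_quotient.
have -> : (fun h : R => sqnorm (h *: e_ i + x)) = (fun h => sqnorm x + (2 * x 0 i * h + h * h)).
  apply/funext => h; rewrite /sqnorm (bigD1 i)//= [in RHS](bigD1 i)//= !mxE !eqxx mulr1.
  rewrite (eq_bigr (fun j => x 0 j * x 0 j)) => [|j ji]; last first.
    by rewrite !mxE eqxx (negPf ji) mulr0 add0r.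
  ring.
by apply: is_derive_eq; rewrite /GRing.scale /=; ring.
Qed.

Let ddamp i x : is_derive x (e_ i) damp (damp x * (- 2 * eta ^+ 2 * x 0 i)).
Proof.
have h1 : is_derive x (e_ i) (fun x => - eta ^+ 2 * sqnorm x) (- 2 * eta ^+ 2 * x 0 i).
  have h := is_derive_mulr (is_derive_cst (- eta ^+ 2) x (e_ i)) (dsq i x).
  by apply: is_derive_eq h _; rewrite !fctE /=; ring.
exact: (is_derive_comp_dir (is_derive_expR _) h1).
Qed.

Let dkdot i x : is_derive x (e_ i) (fun x => k (dot zeta x)) (k1 (dot zeta x) * zeta 0 i).
Proof. exact: (is_derive_comp_dir (dk _) (ddot i x)). Qed.
Let dk1dot i x : is_derive x (e_ i) (fun x => k1 (dot zeta x)) (k2 (dot zeta x) * zeta 0 i).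
Proof. exact: (is_derive_comp_dir (dk1 _) (ddot i x)). Qed.

Lemma is_derive_test j x : is_derive x (e_ j) test (dtest j x).
Proof.
apply: is_derive_eq (is_derive_mulr (ddamp j x) (dkdot j x)) _.
rewrite /dtest; ring.
Qed.

Lemma is_derive_dtest i j x : is_derive x (e_ i) (dtest j) (d2test i j x).
Proof.
have h1 := is_derive_mulr (is_derive_cst (- 2 * eta ^+ 2) x (e_ i)) (dcoord i j x).
have h2 := is_derive_mulr h1 (dkdot i x).
have h3 := is_derive_mulr (is_derive_cst (zeta 0 j) x (e_ i)) (dk1dot i x).
apply: is_derive_eq (is_derive_mulr (ddamp i x) (is_deriveD h2 h3)) _.
rewrite /d2test !fctE /=; ring.
Qed.

Lemma continuous_damp : continuous damp.
Proof.
apply: cts_comp; first exact: continuous_expR.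
apply: ctsM; first exact: cts_cst.
by apply: cts_sum => i _; apply: ctsM; exact: coord_continuous.
Qed.

Let ckd (h : R -> R) : continuous h -> continuous (fun x => h (dot zeta x)).
Proof. by move=> ch; apply: cts_comp => //; exact: continuous_dot. Qed.

Lemma continuous_test : continuous test.
Proof. by apply: ctsM; [exact: continuous_damp|exact: ckd]. Qed.

Lemma continuous_d2test i j : continuous (d2test i j).
Proof.
have c c' : continuous (fun _ : 'rV[R]_N => c' : R) by exact: cts_cst.
have cx i' : continuous (fun x : 'rV[R]_N => x 0 i') by exact: coord_continuous.
apply: ctsM; first exact: continuous_damp.
apply: ctsD.
  apply: ctsM; first exact: ctsM.
  by apply: ctsD; apply: ctsM => //; [exact: ctsM|exact: ckd|exact: ckd].
apply: ctsD; last by apply: ctsM => //; exact: ckd.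
apply: ctsB; apply: ctsM => //; try exact: ckd.
by apply: ctsM => //; exact: ctsM.
Qed.

Lemma damp_ge0 x : 0 <= damp x. Proof. exact: expR_ge0. Qed.

Lemma sqnorm_ge0 x : 0 <= sqnorm x.
Proof. by apply: sumr_ge0 => i _; rewrite -expr2 sqr_ge0. Qed.

Lemma damp_le1 x : damp x <= 1.
Proof.
by rewrite /damp -expR0 ler_expR mulNr oppr_le0 mulr_ge0 ?sqr_ge0 ?sqnorm_ge0.
Qed.

(** With [q = eta ^+ 2 * sqnorm x] the Gaussian absorbs the monomials of degree 1 and 2 in the
    [eta * x 0 i], and with [q = (eta * t) ^+ 2] the factor [eta * t]. *)
Lemma expRN_absorb (q : R) : 0 <= q -> expR (- q) * (1 + q) <= 1.
Proof.
move=> q0; rewrite -[leRHS](expR0 R) -(addNr q) expRD ler_wpM2l ?expR_ge0//.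
exact: expR_ge1Dx.
Qed.

Lemma coord_sq_le x i : (eta * x 0 i) ^+ 2 <= eta ^+ 2 * sqnorm x.
Proof.
rewrite exprMn ler_wpM2l ?sqr_ge0// /sqnorm (bigD1 i)//= -expr2 lerDl.
by apply: sumr_ge0 => j _; rewrite -expr2 sqr_ge0.
Qed.

Lemma damp_coord x i : damp x * `|eta * x 0 i| <= 1.
Proof.
set q := eta ^+ 2 * sqnorm x.
have q0 : 0 <= q by rewrite mulr_ge0 ?sqr_ge0 ?sqnorm_ge0.
have -> : damp x = expR (- q) by rewrite /damp mulNr.
apply: le_trans (expRN_absorb q0); rewrite ler_wpM2l ?expR_ge0//.
have := coord_sq_le x i; rewrite -/q -[in X in X -> _](real_normK (num_real (eta * x 0 i))).
set z := `|_| => zq; have := sqr_ge0 (z - 1).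
rewrite (_ : (z - 1) ^+ 2 = z ^+ 2 - 2 * z + 1); last by ring.
lra.
Qed.

Lemma damp_coord2 x i j : damp x * `|(eta * x 0 i) * (eta * x 0 j)| <= 1.
Proof.
set q := eta ^+ 2 * sqnorm x.
have q0 : 0 <= q by rewrite mulr_ge0 ?sqr_ge0 ?sqnorm_ge0.
have -> : damp x = expR (- q) by rewrite /damp mulNr.
apply: le_trans (expRN_absorb q0); rewrite ler_wpM2l ?expR_ge0//.
have := coord_sq_le x i; have := coord_sq_le x j; rewrite -/q normrM.
rewrite -[X in X ^+ 2 <= _ -> _](mulr1) -(real_normK (num_real (eta * x 0 j * 1))) mulr1.
rewrite -(real_normK (num_real (eta * x 0 i))).
set z := `|eta * x 0 i|; set w := `|eta * x 0 j| => wq zq.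
have := sqr_ge0 (z - w).
rewrite (_ : (z - w) ^+ 2 = z ^+ 2 - 2 * (z * w) + w ^+ 2); last by ring.
lra.
Qed.

Let B0 : 0 <= B. Proof. exact: smooth3_ge0 hk. Qed.

(** Once each coordinate is grouped with a factor [eta] and absorbed by [damp], every term other
    than the main one retains a further factor [eta]. *)
Lemma d2test_close i j x :
  `|d2test i j x - zeta 0 i * zeta 0 j * (damp x * k2 (dot zeta x))| <=
  eta * (B * (6 + 2 * `|zeta 0 i| + 2 * `|zeta 0 j|)).
Proof.
set K := k (dot zeta x); set K1 := k1 (dot zeta x).
have -> : d2test i j x - zeta 0 i * zeta 0 j * (damp x * k2 (dot zeta x)) =
  eta * (4 * eta * (damp x * ((eta * x 0 i) * (eta * x 0 j)) * K)
   + (- 2 * zeta 0 j) * (damp x * (eta * x 0 i) * K1)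
   + (- 2 * zeta 0 i) * (damp x * (eta * x 0 j) * K1)
   + (- 2 * eta * (i == j)%:R) * (damp x * K)).
  by rewrite /d2test -/K -/K1; ring.
rewrite normrM (gtr0_norm eta0) ler_wpM2l ?(ltW eta0)//.
have aux (y z C : R) : damp x * `|y| <= 1 -> `|z| <= B -> `|damp x * y * z| <= B.
  move=> h1 h2; rewrite normrM -[leRHS]mul1r ler_pM//.
  by rewrite normrM (ger0_norm (damp_ge0 x)).
have h1 := aux _ _ 0 (damp_coord2 x i j) (kB (dot zeta x)).
have h2 := aux _ _ 0 (damp_coord x i) (k1B (dot zeta x)).
have h3 := aux _ _ 0 (damp_coord x j) (k1B (dot zeta x)).
have h4 : `|damp x * K| <= B.
  by rewrite normrM -[leRHS]mul1r ler_pM ?kB// ger0_norm ?damp_ge0// damp_le1.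
have -> : B * (6 + 2 * `|zeta 0 i| + 2 * `|zeta 0 j|) =
  4 * B + 2 * `|zeta 0 j| * B + 2 * `|zeta 0 i| * B + 2 * B by ring.
have e4 : `|4 * eta| <= 4 by rewrite normrM (gtr0_norm eta0) normr_nat -[leRHS]mulr1 ler_wpM2l.
have e2 : `|- 2 * eta * (i == j)%:R| <= 2.
  rewrite normrM -[leRHS]mulr1 ler_pM//; last by case: (i == j); rewrite ?normr0 ?normr1.
  by rewrite normrM (gtr0_norm eta0) normrN normr_nat -[leRHS]mulr1 ler_wpM2l.
have n2 (z : R) : `|- 2 * z| = 2 * `|z| by rewrite normrM normrN (@ger0_norm _ 2).
rewrite (le_trans (ler_normD _ _))// lerD//; last by rewrite normrM ler_pM.
rewrite (le_trans (ler_normD _ _))// lerD//; last by rewrite normrM n2 ler_wpM2l// mulr_ge0.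
rewrite (le_trans (ler_normD _ _))// lerD//; last by rewrite normrM n2 ler_wpM2l// mulr_ge0.
by rewrite normrM ler_pM.
Qed.

Lemma test_bound x : `|test x| <= B.
Proof.
by rewrite /test normrM -[leRHS]mul1r ler_pM// ger0_norm ?damp_ge0// damp_le1.
Qed.

End gaussian_test.

(** * Laplace transforms of the solution of the diffusion equation *)

Section diffusion_laplace.
Context {R : realType} {N : nat}.
Variables (A : 'M[R]_N) (Pi : R -> narrow R 'rV[R]_N).
Hypothesis hPi : diffusion_solution A Pi.

Lemma within_measurable (F : R -> R) : {within `[0, +oo[, continuous F} ->
  measurable_fun `[(0 : R), +oo[ F.
Proof. by move=> h; apply: subspace_continuous_measurable_fun. Qed.

Lemma diffusion_measurable (f : 'rV[R]_N -> R) : is_Cb f ->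
  measurable_fun `[(0 : R), +oo[ (fun t => \int[Pi t]_x f x).
Proof.
move=> hf; apply: within_measurable; apply: within_narrow_integral => //.
by case: hPi.
Qed.

Section smooth_profile.
Variables (B : R) (k k1 k2 : R -> R).
Hypothesis hk : smooth3 B k k1 k2.
Let kB y : `|k y| <= B. Proof. by case: hk => _ _ /(_ y)[]. Qed.
Let k1B y : `|k1 y| <= B. Proof. by case: hk => _ _ /(_ y)[]. Qed.
Let k2B y : `|k2 y| <= B. Proof. by case: hk => _ _ /(_ y)[]. Qed.
Let ck := smooth3_continuous hk.
Let ck2 := smooth3_continuous2 hk.
Variables (zeta : 'rV[R]_N) (a : R).
Hypothesis a0 : 0 < a.

Definition time_cutoff (eta t : R) : R := expR (- a * t + - (eta ^+ 2) * (t * t)).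

Hypothesis schwartz_k : forall eta, 0 < eta ->
  schwartz (fun p : R * 'rV[R]_N => time_cutoff eta p.1 * test k zeta eta p.2).

Definition half_div (eta : R) (x : 'rV[R]_N) : R :=
  2^-1 * \sum_i \sum_j A i j * d2test k k1 k2 zeta eta i j x.

Lemma generator_test (eta t : R) x :
  derive1 (fun s => time_cutoff eta s * test k zeta eta x) t +
  2^-1 * divergence (fun y =>
    grad (fun z => time_cutoff eta t * test k zeta eta z) y *m A^T) x =
  time_cutoff eta t *
    ((- a - 2 * eta ^+ 2 * t) * test k zeta eta x + half_div eta x).
Proof.
have hT : is_derive t (1 : R) (fun s => time_cutoff eta s * test k zeta eta x)
    (time_cutoff eta t * (- a - 2 * eta ^+ 2 * t) * test k zeta eta x).
  have h1 : is_derive t (1 : R) (fun s : R => - a * s + - (eta ^+ 2) * (s * s))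
      (- a - 2 * eta ^+ 2 * t).
    by apply: is_derive_eq; rewrite /GRing.scale /=; ring.
  have h2 := is_derive_comp_dir (is_derive_expR _) h1.
  apply: is_derive_eq (is_derive_mulr h2 (is_derive_cst (test k zeta eta x) t 1)) _.
  by rewrite !fctE /= /time_cutoff; ring.
have -> : derive1 (fun s => time_cutoff eta s * test k zeta eta x) t =
    time_cutoff eta t * (- a - 2 * eta ^+ 2 * t) * test k zeta eta x.
  by rewrite derive1E; case: hT.
have hg y j : grad (fun z => time_cutoff eta t * test k zeta eta z) y 0 j =
    time_cutoff eta t * dtest k k1 zeta eta j y.
  rewrite mxE; have h := is_derive_mulr
    (is_derive_cst (time_cutoff eta t) y (delta_mx 0 j : 'rV[R]_N))
    (is_derive_test hk zeta eta j y).
  by case: h => _ ->; rewrite !fctE /=; ring.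
have -> : divergence (fun y =>
    grad (fun z => time_cutoff eta t * test k zeta eta z) y *m A^T) x =
    time_cutoff eta t * \sum_i \sum_j A i j * d2test k k1 k2 zeta eta i j x.
  rewrite /divergence mulr_sumr; apply: eq_bigr => i _.
  have -> : (fun y => (grad (fun z => time_cutoff eta t * test k zeta eta z) y *m A^T) 0 i) =
      (fun y => \sum_j (time_cutoff eta t * A i j) * dtest k k1 zeta eta j y).
    apply/funext => y; rewrite mxE; apply: eq_bigr => j _.
    by rewrite hg !mxE; ring.
  have h : is_derive x (delta_mx 0 i : 'rV[R]_N)
      (\sum_j (fun y => (time_cutoff eta t * A i j) * dtest k k1 zeta eta j y))
      (\sum_j (time_cutoff eta t * A i j) * d2test k k1 k2 zeta eta i j x).
    apply: is_derive_sum => j.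
    have h := is_derive_mulr
      (is_derive_cst (time_cutoff eta t * A i j) x (delta_mx 0 i : 'rV[R]_N))
      (is_derive_dtest hk zeta eta i j x).
    by apply: is_derive_eq h _; rewrite !fctE /=; ring.
  have -> : (fun y => \sum_j (time_cutoff eta t * A i j) * dtest k k1 zeta eta j y) =
      \sum_j (fun y => (time_cutoff eta t * A i j) * dtest k k1 zeta eta j y).
    by apply/funext => y; rewrite fct_sumE.
  case: h => _ ->; rewrite mulr_sumr; apply: eq_bigr => j _; ring.
rewrite /half_div; ring.
Qed.

Definition half_quad : R := 2^-1 * \sum_i \sum_j A i j * (zeta 0 i * zeta 0 j).

Let C2 : R := 2^-1 * \sum_i \sum_j `|A i j| *
  (B * (6 + 2 * `|zeta 0 i| + 2 * `|zeta 0 j|) + `|zeta 0 i * zeta 0 j| * B).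

Let half_div_bound (eta : R) x : 0 < eta -> eta <= 1 -> `|half_div eta x| <= C2.
Proof.
move=> e0 e1; rewrite /half_div /C2 normrM ger0_norm ?invr_ge0// ler_wpM2l ?invr_ge0//.
rewrite (le_trans (ler_norm_sum _ _ _))// ler_sum// => i _.
rewrite (le_trans (ler_norm_sum _ _ _))// ler_sum// => j _.
rewrite normrM ler_wpM2l//.
have h := d2test_close hk zeta e0 e1 i j x.
set u := d2test _ _ _ _ _ _ _ _ in h *; set w := zeta 0 i * zeta 0 j * _ in h.
rewrite (_ : u = (u - w) + w); last by rewrite subrK.
rewrite (le_trans (ler_normD _ _))// lerD//.
  rewrite (le_trans h)// -[leRHS]mul1r ler_wpM2r//.
  by rewrite mulr_ge0 ?(smooth3_ge0 hk)// !addr_ge0// mulr_ge0.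
rewrite /w normrM ler_wpM2l// normrM -[leRHS]mul1r ler_pM//.
by rewrite ger0_norm ?damp_ge0// damp_le1.
Qed.

Let test_Cb (eta : R) : 0 < eta -> eta <= 1 -> is_Cb (test k zeta eta).
Proof.
move=> e0 e1; split; first exact: continuous_test hk _ _.
by exists B => x; exact: test_bound hk _ _ _.
Qed.

Let half_div_Cb (eta : R) : 0 < eta -> eta <= 1 -> is_Cb (half_div eta).
Proof.
move=> e0 e1; split; last by exists C2 => x; exact: half_div_bound.
apply: ctsM; first exact: cts_cst.
apply: cts_sum => i _; apply: cts_sum => j _.
by apply: ctsM; [exact: cts_cst|exact: continuous_d2test hk _ _ _ _].
Qed.

Let en n : R := n.+1%:R^-1.
Let en0 n : 0 < en n. Proof. by rewrite invr_gt0. Qed.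
Let en1 n : en n <= 1. Proof. by rewrite invf_le1// ler1n. Qed.
Let en_cvg : en n @[n --> \oo] --> (0 : R).
Proof. exact: cvg_harmonic. Qed.

(** The integrand of the weak formulation with [expR (- a * t)] taken out, so that its time integral
    is a Laplace transform. *)
Let J (eta t : R) : R := expR (- (eta ^+ 2) * (t * t)) *
  ((- a - 2 * eta ^+ 2 * t) * \int[Pi t]_x test k zeta eta x
   + \int[Pi t]_x half_div eta x).

Let intg (f : 'rV[R]_N -> R) (P : probability (Borel 'rV[R]_N) R) : is_Cb f ->
  P.-integrable setT (EFin \o f).
Proof.
move=> [cf [M fM]]; apply: (@prob_integrable _ _ _ _ _ M) => //.
exact: borel_measurable.
Qed.

Let lap_J (eta : R) : 0 < eta -> eta <= 1 -> lap a (J eta) = - k 0.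
Proof.
move=> e0 e1; have [_ /(_ _ (schwartz_k e0))] := hPi => /=.
have -> : - (time_cutoff eta 0 * test k zeta eta 0) = - k 0.
  rewrite /time_cutoff /test /damp /sqnorm /dot !mulr0 !add0r expR0 mul1r.
  rewrite big1 => [|i _]; last by rewrite mxE mulr0.
  by rewrite big1 => [|i _]; rewrite ?mulr0 ?expR0 ?mul1r ?mxE ?mulr0.
move=> <-; apply: eq_Rintegral => t _.
under [RHS]eq_Rintegral do rewrite generator_test.
have h1 := intg (Pi t) (test_Cb e0 e1).
have h2 := intg (Pi t) (half_div_Cb e0 e1).
have h3 : (Pi t).-integrable setT
    (EFin \o (fun x => (- a - 2 * eta ^+ 2 * t) * test k zeta eta x)).
  exact: (integrableZl measurableT _ h1).
rewrite [RHS]RintegralZl//; last exact: (integrableD measurableT h3 h2).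
rewrite RintegralD// RintegralZl//.
by rewrite /J mulrA -expRD.
Qed.

Let mJ (eta : R) : 0 < eta -> eta <= 1 -> measurable_fun `[(0 : R), +oo[ (J eta).
Proof.
move=> e0 e1; apply: measurable_funM.
  apply: measurable_funTS; apply: continuous_measurable_fun.
  apply: cts_comp; first exact: continuous_expR.
  by apply: ctsM; [exact: cts_cst|apply: ctsM => t; exact: cvg_id].
apply: measurable_funD; last by apply: diffusion_measurable; exact: half_div_Cb.
apply: measurable_funM; last by apply: diffusion_measurable; exact: test_Cb.
apply: measurable_funTS; apply: continuous_measurable_fun.
by apply: ctsB; [exact: cts_cst|apply: ctsM; [exact: cts_cst|move=> t; exact: cvg_id]].
Qed.

(** The factor [2 * eta ^+ 2 * t] from differentiating the cutoff is unbounded in time; it equals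
    [2 * eta * (eta * t)], and [expR (- (eta * t) ^+ 2)] absorbs [eta * t]. Hence the 2 in
    [a + 2]. *)
Let J_bound (eta t : R) : 0 < eta -> eta <= 1 -> 0 <= t -> `|J eta t| <= (a + 2) * B + C2.
Proof.
move=> e0 e1 t0; set q := (eta * t) ^+ 2.
have -> : J eta t = expR (- q) * (- a - 2 * eta ^+ 2 * t) *
    \int[Pi t]_x test k zeta eta x + expR (- q) * \int[Pi t]_x half_div eta x.
  rewrite /J /q (_ : - (eta ^+ 2) * (t * t) = - (eta * t) ^+ 2); last by ring.
  by rewrite mulrDr mulrA.
have q0 : 0 <= q by rewrite sqr_ge0.
have eq1 : expR (- q) <= 1 by rewrite -expR0 ler_expR oppr_le0.
have h1 : `|\int[Pi t]_x test k zeta eta x| <= B.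
  by apply: prob_norm_le => [|x]; [apply: borel_measurable; case: (test_Cb e0 e1)|exact: test_bound hk _ _ _].
have h2 : `|\int[Pi t]_x half_div eta x| <= C2.
  by apply: prob_norm_le => [|x]; [apply: borel_measurable; case: (half_div_Cb e0 e1)|exact: half_div_bound].
rewrite (le_trans (ler_normD _ _))// lerD//; last first.
  by rewrite normrM -[leRHS]mul1r ler_pM// ger0_norm ?expR_ge0.
rewrite normrM ler_pM// normrM (ger0_norm (expR_ge0 _)).
have -> : `|- a - 2 * eta ^+ 2 * t| = a + 2 * eta * (eta * t).
  rewrite ler0_norm; first by ring.
  by rewrite -opprD oppr_le0 addr_ge0 ?(ltW a0)// !mulr_ge0 ?(ltW e0).
rewrite mulrDr lerD//; first by rewrite -[leRHS]mul1r ler_wpM2r ?(ltW a0).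
have et0 : 0 <= eta * t by rewrite mulr_ge0 ?(ltW e0).
have := expRN_absorb q0; rewrite /q.
set z := eta * t in et0 *; set E := expR _ => hE.
have E0 : 0 <= E by exact: expR_ge0.
have hz : z <= 1 + z ^+ 2.
  have := sqr_ge0 (z - 1); rewrite (_ : (z - 1) ^+ 2 = z ^+ 2 - 2 * z + 1); last by ring.
  by move=> ?; lra.
have h3 : E * z <= 1 by apply: le_trans hE; rewrite ler_wpM2l.
rewrite (_ : E * (2 * eta * z) = 2 * (eta * (E * z))); last by ring.
rewrite -[leRHS]mulr1 ler_wpM2l// -[leRHS]mulr1 ler_pM//; last by rewrite mulr_ge0.
exact: ltW.
Qed.

Let at_eta (G : R -> R) l : continuous G -> G 0 = l -> G (en n) @[n --> \oo] --> l.
Proof.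
move=> cG <-; apply: (continuous_cvg _ (cG 0)); exact: en_cvg.
Qed.

Let sq_cts : continuous (fun e : R => e ^+ 2).
Proof. by move=> x; exact: exprn_continuous. Qed.

Let damp_cts (x : 'rV[R]_N) : continuous (fun eta : R => damp eta x).
Proof.
apply: cts_comp; first exact: continuous_expR.
by apply: ctsM; [apply: ctsN|exact: cts_cst].
Qed.

Let damp0 (x : 'rV[R]_N) : damp 0 x = 1.
Proof. by rewrite /damp expr0n oppr0 mul0r expR0. Qed.

Let d2test_cts i j (x : 'rV[R]_N) : continuous (fun eta : R => d2test k k1 k2 zeta eta i j x).
Proof.
have c c' : continuous (fun _ : R => c' : R) by exact: cts_cst.
have s2 : continuous (fun e : R => - 2 * e ^+ 2) by exact: ctsM.
apply: ctsM; first exact: damp_cts.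
apply: ctsD.
  apply: ctsM; first exact: ctsM.
  by apply: ctsD; apply: ctsM => //; exact: ctsM.
apply: ctsD; last by exact: ctsM.
apply: ctsB; apply: ctsM => //; try exact: ctsM.
by apply: ctsM => //; apply: ctsM => //; exact: ctsM.
Qed.

Let int_test_cvg t :
  \int[Pi t]_x test k zeta (en n) x @[n --> \oo] --> \int[Pi t]_x k (dot zeta x).
Proof.
apply: (@Rdominated_cvg _ _ _ (Pi t) setT (fun n x => test k zeta (en n) x) _ (cst B)) => //.
- by move=> n; apply: borel_measurable; case: (test_Cb (en0 n) (en1 n)).
- move=> x _; apply: (at_eta (G := fun eta => test k zeta eta x)).
    by apply: ctsM; [exact: damp_cts|exact: cts_cst].
  by rewrite /test damp0 mul1r.
- by apply: (@prob_integrable _ _ _ _ _ `|B|) => //; exact: measurable_cst.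
- by move=> n x _; exact: test_bound hk _ _ _.
Qed.

Let int_half_div_cvg t : \int[Pi t]_x half_div (en n) x @[n --> \oo] -->
  half_quad * \int[Pi t]_x k2 (dot zeta x).
Proof.
have hk2 : is_Cb (fun x : 'rV[R]_N => k2 (dot zeta x)).
  by split; [apply: cts_comp => //; exact: continuous_dot|exists B => x].
rewrite -RintegralZl//; last exact: intg.
apply: (@Rdominated_cvg _ _ _ (Pi t) setT (fun n x => half_div (en n) x) _ (cst C2)) => //.
- by move=> n; apply: borel_measurable; case: (half_div_Cb (en0 n) (en1 n)).
- move=> x _; apply: (at_eta (G := fun eta => half_div eta x)).
    apply: ctsM; first exact: cts_cst.
    by apply: cts_sum => i _; apply: cts_sum => j _; apply: ctsM => //; exact: cts_cst.
  rewrite /half_div /half_quad -mulrA; congr (_ * _).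
  rewrite mulr_suml; apply: eq_bigr => i _; rewrite mulr_suml; apply: eq_bigr => j _.
  by rewrite /d2test damp0 expr0n /=; ring.
- by apply: (@prob_integrable _ _ _ _ _ `|C2|) => //; exact: measurable_cst.
- by move=> n x _; exact: half_div_bound.
Qed.

Let J_cvg t : J (en n) t @[n --> \oo] -->
  - a * \int[Pi t]_x k (dot zeta x) + half_quad * \int[Pi t]_x k2 (dot zeta x).
Proof.
rewrite -[X in _ --> X]mul1r; apply: cvgM.
  apply: (at_eta (G := fun eta => expR (- (eta ^+ 2) * (t * t)))).
    apply: cts_comp; first exact: continuous_expR.
    by apply: ctsM; [exact: ctsN|exact: cts_cst].
  by rewrite expr0n oppr0 mul0r expR0.
apply: cvgD; last exact: int_half_div_cvg.
apply: cvgM; last exact: int_test_cvg.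
apply: (at_eta (G := fun eta => - a - 2 * eta ^+ 2 * t)).
  apply: ctsB; first exact: cts_cst.
  by apply: ctsM; [apply: ctsM => //; exact: cts_cst|exact: cts_cst].
by rewrite expr0n mulr0 mul0r subr0.
Qed.

(** The damping is removed along [eta = n.+1%:R^-1], by dominated convergence in space and then in
    time; the transform of [J] equals [- k 0] at every stage. *)
Lemma diffusion_lap_profile :
  - a * lap a (fun t => \int[Pi t]_x k (dot zeta x)) +
  half_quad * lap a (fun t => \int[Pi t]_x k2 (dot zeta x)) = - k 0.
Proof.
have Cbf (f : R -> R) : continuous f -> (forall y, `|f y| <= B) ->
    is_Cb (fun x : 'rV[R]_N => f (dot zeta x)).
  by move=> cf fB; split; [apply: cts_comp => //; exact: continuous_dot|exists B => x].
have mB (f : R -> R) : continuous f -> (forall y, `|f y| <= B) -> forall s : R, 0 <= s ->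
    `|\int[Pi s]_x f (dot zeta x)| <= B.
  move=> cf fB s _; apply: prob_norm_le => // .
  by apply: borel_measurable; case: (Cbf f cf fB).
have m1 := diffusion_measurable (Cbf k ck kB).
have m2 := diffusion_measurable (Cbf k2 ck2 k2B).
have b1 := mB k ck kB; have b2 := mB k2 ck2 k2B.
have E1 := lapZ (- a) a0 m1 b1; have E2 := lapZ half_quad a0 m2 b2.
rewrite -E1 -E2.
have ZB c (f : R -> R) : (forall s : R, 0 <= s -> `|f s| <= B) ->
    forall s, 0 <= s -> `|c * f s| <= `|c| * B.
  by move=> fB s s0; rewrite normrM ler_wpM2l// fB.
have mZ c (f : R -> R) : measurable_fun `[(0 : R), +oo[ f ->
    measurable_fun `[(0 : R), +oo[ (fun s => c * f s).
  by move=> mf; apply: measurable_funM => //; exact: measurable_cst.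
have E3 := lapD a0 (mZ (- a) _ m1) (ZB (- a) _ b1) (mZ half_quad _ m2) (ZB half_quad _ b2).
rewrite -E3.
have h := lap_cvg a0 (fun n => mJ (en0 n) (en1 n)) (fun n s => J_bound (en0 n) (en1 n))
  (fun s _ => J_cvg (t := s)).
have h2 : lap a (J (en n)) @[n --> \oo] --> - k 0.
  rewrite (_ : (fun n => lap a (J (en n))) = fun=> - k 0); first exact: cvg_cst.
  by apply/funext => n; exact: lap_J.
exact: (cvg_unique _ h h2).
Qed.

End smooth_profile.

(** Both terms of [diffusion_lap_profile] involve the same transform up to sign, so it becomes a
    scalar equation. The damped test functions are of Schwartz class as instances of [gauss_trig]
    with constant coefficients. *)
Lemma diffusion_lap_trig (zeta : 'rV[R]_N) (a : R) : 0 < a ->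
  (a + half_quad zeta) * lap a (fun t => \int[Pi t]_x cos (dot zeta x)) = 1 /\
  (a + half_quad zeta) * lap a (fun t => \int[Pi t]_x sin (dot zeta x)) = 0.
Proof.
move=> a0.
have pf c : polynomial_fun (fun _ : R * 'rV[R]_N => c : R) by exact: pf_cst.
have expE eta (p : R * 'rV[R]_N) : expR (gauss_exponent a eta p) =
    time_cutoff a eta p.1 * damp eta p.2.
  by rewrite /time_cutoff /damp /sqnorm -expRD /gauss_exponent mulrDr addrA.
have hc := diffusion_lap_profile smooth3_cos a0 (zeta := zeta).
have hs := diffusion_lap_profile smooth3_sin a0 (zeta := zeta).
have {}hc := hc _.
have {}hs := hs _.
have neg (f : R -> R) : continuous f -> (forall y, `|f y| <= 1) ->
    lap a (fun t => \int[Pi t]_x - f (dot zeta x)) =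
    - lap a (fun t => \int[Pi t]_x f (dot zeta x)).
  move=> cf f1.
  have Cbf : is_Cb (fun x : 'rV[R]_N => f (dot zeta x)).
    by split; [apply: cts_comp => //; exact: continuous_dot|exists 1 => x].
  have mf := borel_measurable (proj1 Cbf).
  have b1 (s : R) : 0 <= s -> `|\int[Pi s]_x f (dot zeta x)| <= 1.
    by move=> _; exact: prob_norm_le.
  have E := lapZ (- 1) a0 (diffusion_measurable Cbf) b1.
  rewrite -[RHS]mulN1r -E; apply: eq_lap => s _.
  rewrite -RintegralZl//; last exact: (@prob_integrable _ _ _ _ _ 1).
  by apply: eq_Rintegral => x _; rewrite mulN1r.
split.
  have h : forall eta : R, 0 < eta ->
      schwartz (fun p : R * 'rV[R]_N => time_cutoff a eta p.1 * test cos zeta eta p.2).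
    move=> eta e0; have := schwartz_gauss_trig a zeta e0 (pf 1) (pf 0).
    rewrite (_ : gauss_trig _ _ _ _ _ = fun p : R * 'rV[R]_N =>
      time_cutoff a eta p.1 * test cos zeta eta p.2)//.
    by apply/funext => p; rewrite /gauss_trig expE /test; ring.
  have := hc h; rewrite (neg cos) ?cos0; [|exact: continuous_cos|by move=> y; rewrite ler_norml cos_geN1 cos_le1].
  by move: (half_quad zeta) (lap a _) => c L E; rewrite mulrDl; lra.
have h : forall eta : R, 0 < eta ->
    schwartz (fun p : R * 'rV[R]_N => time_cutoff a eta p.1 * test sin zeta eta p.2).
  move=> eta e0; have := schwartz_gauss_trig a zeta e0 (pf 0) (pf 1).
  rewrite (_ : gauss_trig _ _ _ _ _ = fun p : R * 'rV[R]_N =>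
    time_cutoff a eta p.1 * test sin zeta eta p.2)//.
  by apply/funext => p; rewrite /gauss_trig expE /test; ring.
have := hs h; rewrite (neg sin) ?sin0; [|exact: continuous_sin|by move=> y; rewrite ler_norml sin_geN1 sin_le1].
by move: (half_quad zeta) (lap a _) => c L E; rewrite mulrDl; lra.
Qed.

End diffusion_laplace.

(** * The rescaled laws *)

Lemma within_comp (S T U : topologicalType) (A : set T) (f : T -> U) (g : S -> T) :
  {within A, continuous f} -> continuous g -> (forall s, A (g s)) ->
  continuous (fun s => f (g s)).
Proof.
move=> cf cg gA s; have h := (@subspace_continuousP T A U f).1 cf (g s) (gA s).
apply: (cvg_comp _ _ _ h) => B wB; have := cg s _ wB.
by rewrite /nbhs /= => h2; apply: filterS h2 => r /(_ (gA r)).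
Qed.

Section maxmin.
Context {R : realType} {T : topologicalType}.
Lemma cts_max (f g : T -> R) : continuous f -> continuous g ->
  continuous (fun x => Num.max (f x) (g x)).
Proof. by move=> cf cg x; exact: (continuous_max (cf x) (cg x)). Qed.
Lemma cts_min (f g : T -> R) : continuous f -> continuous g ->
  continuous (fun x => Num.min (f x) (g x)).
Proof. by move=> cf cg x; exact: (continuous_min (cf x) (cg x)). Qed.
End maxmin.

Section strip_integrals.
Context {R : realType} {N : nat}.
Notation X := (R * 'rV[R]_N)%type.
Context (Q : probability (Borel X) R).
Hypothesis hQS : Q (@strip R N) = 1%E.
Hypothesis hQ : standing_Q Q.

Lemma measurable_strip : measurable (@strip R N : set (Borel X)).
Proof.
have m1 : measurable_fun [set: Borel X] (fun p : X => p.1).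
  by apply: borel_measurable2; exact: continuous_time.
rewrite (_ : @strip R N = setT `&` (fun p : X => p.1) @^-1` `[-1, 0]); first exact: m1.
by apply/seteqP; split => [p hp|p [_]] /=; rewrite ?in_itv.
Qed.

Let Q_out : Q (~` @strip R N) = 0%E.
Proof. by rewrite (probability_setC Q measurable_strip) hQS subee. Qed.

(** The complement of the strip is null, so [g] may be replaced by any integrable [h] that agrees
    with it there; this exchanges the given data for continuous extensions. *)
Lemma strip_Rintegral (g h : X -> R) :
  (forall p, -1 <= p.1 <= 0 -> g p = h p) -> Q.-integrable setT (EFin \o h) ->
  \int[Q]_(p in @strip R N) g p = \int[Q]_p h p.
Proof.
move=> gh ih; rewrite (@eq_Rintegral _ _ _ Q _ h); last first.
  by move=> p; rewrite inE => /gh.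
rewrite /Rintegral (negligible_integral _ _ ih Q_out)//.
  by rewrite setTD setCK.
by apply: measurableC; exact: measurable_strip.
Qed.

Lemma continuous_sqr_enorm : continuous (fun p : X => sqr_enorm p.2).
Proof.
apply: cts_sum => i _ p; have := @continuous_space_coord R N i p => h.
by rewrite (_ : (fun p : X => p.2 0 i ^+ 2) = (fun p : X => p.2 0 i * p.2 0 i));
  [exact: (ctsM (@continuous_space_coord R N i) (@continuous_space_coord R N i))|apply/funext => q; rewrite expr2].
Qed.

Lemma sqr_enorm_ge0 (x : 'rV[R]_N) : 0 <= sqr_enorm x.
Proof. by apply: sumr_ge0 => i _; exact: sqr_ge0. Qed.

Lemma integrable_sqr_enorm : Q.-integrable setT (EFin \o (fun p : X => sqr_enorm p.2)).
Proof.
have mE : measurable_fun [set: Borel X] (fun p : X => (sqr_enorm p.2)%:E).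
  by apply/measurable_EFinP; apply: borel_measurable2; exact: continuous_sqr_enorm.
apply/integrableP; split => //.
under eq_integral do rewrite gee0_abs ?lee_fin ?sqr_enorm_ge0//.
rewrite (ge0_negligible_integral _ _ mE _ Q_out)//.
- by rewrite setTD setCK.
- by apply: measurableC; exact: measurable_strip.
- by move=> p _; rewrite lee_fin sqr_enorm_ge0.
Qed.

Lemma quadratic_integrable (h : X -> R) (C : R) : continuous h ->
  (forall p, `|h p| <= C * (1 + sqr_enorm p.2)) -> Q.-integrable setT (EFin \o h).
Proof.
move=> ch hC.
have i1 : Q.-integrable setT (EFin \o (fun p : X => C * (1 + sqr_enorm p.2))).
  have i1 : Q.-integrable setT (EFin \o (fun _ : X => 1 : R)).
    by apply: (@prob_integrable _ _ _ Q (fun=> 1) 1) => [|x]; [exact: measurable_cst|rewrite normr1].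
  exact: (integrableZl measurableT C (integrableD measurableT i1 integrable_sqr_enorm)).
apply: (le_integrable measurableT _ _ i1).
  by apply/measurable_EFinP; exact: borel_measurable2.
by move=> p _ /=; rewrite lee_fin (le_trans (hC p))// ler_norm.
Qed.

Lemma coord_le_enorm (x : 'rV[R]_N) i : x 0 i ^+ 2 <= sqr_enorm x.
Proof.
by rewrite /sqr_enorm (bigD1 i)//= lerDl sumr_ge0// => j _; rewrite sqr_ge0.
Qed.

End strip_integrals.

(** * The delay equation for data extended to the whole space *)

Section clamped_data.
Context {R : realType} {N : nat}.
Notation X := (R * 'rV[R]_N)%type.
Context (Q : probability (Borel X) R).
Variables (alpha : R -> R -> R) (alpha_oo : R -> R).
Variables (u0 mu : R -> narrow R 'rV[R]_N).
Hypothesis halpha : standing_alpha alpha alpha_oo.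
Hypothesis hQS : Q (@strip R N) = 1%E.
Hypothesis hQ : standing_Q Q.
Hypothesis hmu : delay_solution Q alpha u0 mu.

(* Clamping the delay to [-1, 0] and the times to [0, oo) and [-1, oo) extends the
   data continuously to the whole space without changing any integral over the
   strip. *)
Definition clamp (x : R) : R := Num.max (-1) (Num.min x 0).
Definition delay_of (p : X) : R := clamp p.1.
Definition rate (t : R) (p : X) : R := alpha (Num.max t 0) (delay_of p).
Definition rate_oo (p : X) : R := alpha_oo (delay_of p).
Definition law (t : R) : probability (Borel 'rV[R]_N) R := mu (Num.max t (-1)).

Lemma delay_of_itv p : -1 <= delay_of p <= 0.
Proof.
rewrite /delay_of /clamp le_max lexx ge_max ge_min lexx orbT andbT/=.
by rewrite oppr_le0.
Qed.

Lemma delay_ofE (p : X) : -1 <= p.1 <= 0 -> delay_of p = p.1.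
Proof. by move=> /andP[h1 h2]; rewrite /delay_of /clamp min_l// max_r. Qed.

Let cid : continuous (fun t : R => t). Proof. by move=> t; exact: cvg_id. Qed.

Lemma continuous_delay_of : continuous delay_of.
Proof.
apply: cts_max; first exact: cts_cst.
by apply: cts_min; [exact: continuous_time|exact: cts_cst].
Qed.

Let pair_cts (T : topologicalType) (f g : T -> R) : continuous f -> continuous g ->
  continuous (fun x => (f x, g x)).
Proof. by move=> cf cg x; exact: (cvg_pair (cf x) (cg x)). Qed.

Let rate_dom (t : R) p : [set p : R * R | 0 <= p.1 /\ -1 <= p.2 <= 0] (Num.max t 0, delay_of p).
Proof. by split => /=; [rewrite le_max lexx orbT|exact: delay_of_itv]. Qed.

Lemma rate_t p : continuous (rate ^~ p).
Proof.
case: halpha => _ _ ca _ _; apply: (within_comp ca (g := fun t : R => (Num.max t 0, delay_of p))) => [|t]; last exact: rate_dom.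
by apply: pair_cts; [apply: cts_max => //; exact: cts_cst|exact: cts_cst].
Qed.

Lemma rate_p t : continuous (rate t).
Proof.
case: halpha => _ _ ca _ _; apply: (within_comp ca (g := fun p => (Num.max t 0, delay_of p))) => [|p]; last exact: rate_dom.
by apply: pair_cts; [exact: cts_cst|exact: continuous_delay_of].
Qed.

Lemma rate_oo_c : continuous rate_oo.
Proof.
case: halpha => _ _ _ [_ ca] _; apply: (within_comp ca continuous_delay_of) => p.
by rewrite /= in_itv /= delay_of_itv.
Qed.

Lemma rate_oo_gt0 p : 0 < rate_oo p.
Proof. by case: halpha => _ _ _ [h _] _; apply: h; exact: delay_of_itv. Qed.

Lemma rate_bounds : exists A : R,
  (forall t p, `|rate t p| <= A) /\ (forall p, `|rate_oo p| <= A).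
Proof.
case: halpha => _ [B hB] _ _ [M [beta [M0 b0 hM]]].
have h0 (t : R) : 0 <= Num.max t 0 by rewrite le_max lexx orbT.
exists (B + M); split => [t p|p].
  by rewrite (le_trans (hB _ _ (h0 t) (delay_of_itv p)))// lerDl ltW.
have h1 := hM 0 _ (lexx 0) (delay_of_itv p); have h2 := hB 0 _ (lexx 0) (delay_of_itv p).
rewrite mulr0 expR0 mulr1 in h1.
rewrite /rate_oo -(subrK (alpha 0 (delay_of p)) (alpha_oo _)) addrC (le_trans (ler_normD _ _))//.
by rewrite lerD// distrC.
Qed.

Lemma rate_decay : exists M beta : R, [/\ 0 < M, 0 < beta &
  forall (t : R) p, 0 <= t -> `|rate t p - rate_oo p| <= M * expR (- beta * t)].
Proof.
case: halpha => _ _ _ _ [M [beta [M0 b0 hM]]]; exists M, beta; split => // t p t0.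
by rewrite /rate max_l// hM// delay_of_itv.
Qed.

Lemma law_c (f : 'rV[R]_N -> R) : is_Cb f -> continuous (fun t => \int[law t]_x f x).
Proof.
move=> hf; case: hmu => cmu _ _.
apply: (within_comp (within_narrow_integral cmu hf) (g := fun t : R => Num.max t (-1))).
  by apply: cts_max => //; exact: cts_cst.
by move=> t; rewrite /= in_itv /= andbT le_max lexx orbT.
Qed.

Lemma lawE (t : R) : -1 <= t -> law t = mu t.
Proof. by move=> h; rewrite /law max_l. Qed.

Lemma law_delay_eq (h : R -> R) (C : R) : continuous h ->
  (forall y, `|h y| <= C) -> (forall x y, `|h x - h y| <= C * `|x - y|) ->
  forall xi y (t : R), 0 < t -> is_derive t 1 (fun s => ridge law h xi s y)
    (\int[Q]_p (rate t p *
      (ridge law h xi (t + delay_of p) (dot xi p.2 + y) - ridge law h xi t y))).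
Proof.
move=> ch hC hL xi y t t0.
have hf := ridge_Cb ch hC xi y.
case: hmu => _ _ /(_ _ hf) [/(_ t t0) df _ /(_ t t0)].
set F := fun s => _ => E.
(* Since [t > 0], the clamp at -1 is inactive near [t]. *)
have near_t : \near t, F t = ridge law h xi t y.
  near=> s; rewrite /F /ridge lawE//.
  have : 0 < s by near: s; exact: lt_nbhsr.
  by move=> s0; rewrite (le_trans _ (ltW s0))// oppr_le0.
apply: (near_eq_is_derive near_t).
have [A [rA _]] := rate_bounds.
have A0 : 0 <= A by apply: le_trans (rA 0 (0, 0)).
have cd : continuous (fun p : X => dot xi p.2 + y).
  apply: ctsD; last exact: cts_cst.
  move=> q; apply: (@continuous_comp _ _ _ (fun p : X => p.2) (dot xi)).
    exact: cvg_snd.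
  exact: continuous_dot.
have cdel : continuous (fun p : X => t + delay_of p).
  by apply: ctsD; [exact: cts_cst|exact: continuous_delay_of].
have c1 : continuous (fun p : X => ridge law h xi (t + delay_of p) (dot xi p.2 + y)).
  by move=> p; apply: (ridge_cvg law_c ch hC hL); [exact: cdel|exact: cd].
have rb s z : `|ridge law h xi s z| <= C by exact: (ridge_bound _ ch hC).
have i1 : Q.-integrable setT (EFin \o (fun p : X => rate t p * ridge law h xi (t + delay_of p) (dot xi p.2 + y))).
  apply: (@prob_integrable _ _ _ _ _ (A * C)) => [|p].
    by apply: borel_measurable2; apply: ctsM => //; exact: rate_p.
  by rewrite normrM ler_pM.
have i2 : Q.-integrable setT (EFin \o rate t).
  by apply: (@prob_integrable _ _ _ _ _ A) => //; apply: borel_measurable2; exact: rate_p.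
have i3 := integrableZl measurableT (ridge law h xi t y) i2.
split=> //; rewrite -derive1E E /delay_rhs.
have t1 : -1 <= t by rewrite (le_trans _ (ltW t0))// oppr_le0.
have -> : \int[Q]_(p in @strip R N) alpha t p.1 = \int[Q]_p rate t p.
  by apply: strip_Rintegral => // p hp; rewrite /rate max_l ?(ltW t0)// delay_ofE.
have -> : \int[Q]_(p in @strip R N) (alpha t p.1 * \int[mu (t + p.1)]_x h (dot xi (x + p.2) + y))
    = \int[Q]_p (rate t p * ridge law h xi (t + delay_of p) (dot xi p.2 + y)).
  apply: strip_Rintegral => // p hp; rewrite /rate max_l ?(ltW t0)// delay_ofE//.
  rewrite /ridge lawE; last by move: hp => /andP[? ?]; lra.
  by congr (_ * _); apply: eq_Rintegral => x _; congr h; rewrite dotDr addrA.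
have Z := RintegralZl (ridge law h xi t y) measurableT i2.
have S := RintegralB measurableT i1 i3.
have -> : \int[mu t]_x h (dot xi x + y) = ridge law h xi t y by rewrite /ridge lawE.
rewrite -Z -S; apply: eq_Rintegral => p _; ring.
Unshelve. all: by end_near.
Qed.

End clamped_data.

Lemma integrable_Rsum {R : realType} d (T : measurableType d) (m : {measure set T -> \bar R})
    (D : set T) (I : Type) (r : seq I) (F : I -> T -> R) : measurable D ->
  (forall i, m.-integrable D (EFin \o F i)) ->
  m.-integrable D (EFin \o (fun x => \sum_(i <- r) F i x)).
Proof.
move=> mD iF; elim: r => [|i r IH].
  rewrite (_ : EFin \o _ = cst 0%E); first exact: integrable0.
  by apply/funext => x /=; rewrite big_nil.
rewrite (_ : EFin \o _ = (EFin \o F i) \+ (EFin \o (fun x => (\sum_(i <- r) F i x)%R)))%E.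
  exact: integrableD.
by apply/funext => x /=; rewrite big_cons EFinD.
Qed.

Lemma Rintegral_sum {R : realType} d (T : measurableType d) (m : {measure set T -> \bar R})
    (D : set T) (I : Type) (r : seq I) (F : I -> T -> R) : measurable D ->
  (forall i, m.-integrable D (EFin \o F i)) ->
  \int[m]_(x in D) (\sum_(i <- r) F i x) = \sum_(i <- r) \int[m]_(x in D) F i x.
Proof.
move=> mD iF; elim: r => [|i r IH].
  rewrite big_nil; under eq_Rintegral do rewrite big_nil.
  by rewrite Rintegral_cst// mul0r.
rewrite big_cons -IH; under eq_Rintegral do rewrite big_cons.
apply: RintegralD => //.
exact: integrable_Rsum.
Qed.

Lemma integrable_bound {R : realType} d (T : measurableType d)
    (m : {measure set T -> \bar R}) (D : set T) (f g : T -> R) :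
  measurable D -> measurable_fun D f -> m.-integrable D (EFin \o g) ->
  (forall x, D x -> `|f x| <= g x) -> m.-integrable D (EFin \o f).
Proof.
move=> mD mf ig fg; apply: (le_integrable mD _ _ ig); first exact/measurable_EFinP.
by move=> x Dx /=; rewrite lee_fin (le_trans (fg _ Dx))// ler_norm.
Qed.

(** * Moments of the recentred jumps and comparison of the shift with the drift *)

Section drift_identities.
Context {R : realType} {N : nat}.
Notation X := (R * 'rV[R]_N)%type.
Context (Q : probability (Borel X) R).
Variables (alpha : R -> R -> R) (alpha_oo : R -> R).
Hypothesis halpha : standing_alpha alpha alpha_oo.
Hypothesis hQS : Q (@strip R N) = 1%E.
Hypothesis hQ : standing_Q Q.
Local Notation G := (Gam Q alpha_oo).
Local Notation K := (drift Q alpha_oo).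
Local Notation ai := (rate_oo alpha_oo : X -> R).
Local Notation th := (@delay_of R N).

Let sq1 (x : 'rV[R]_N) i : `|x 0 i| <= 1 + sqr_enorm x.
Proof.
rewrite (@le_trans _ _ (1 + x 0 i ^+ 2))//; last by rewrite lerD2l coord_le_enorm.
rewrite -(real_normK (num_real (x 0 i))).
have : 0 <= `|x 0 i| by [].
set z := `|_|.
have := sqr_ge0 (z - 1); rewrite (_ : (z - 1) ^+ 2 = z ^+ 2 - 2 * z + 1); last by ring.
by move=> ? ?; lra.
Qed.

Let aic := rate_oo_c halpha (N := N).

Let crate_p t : continuous (rate alpha t : X -> R).
Proof. exact: (@rate_p R N _ _ halpha t). Qed.

Let crate_t (p : X) : continuous (rate alpha ^~ p).
Proof. exact: (@rate_t R N _ _ halpha p). Qed.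

Let zc i : continuous (fun p : X => p.2 0 i). Proof. exact: continuous_space_coord. Qed.

Lemma rate_delay_integrable : Q.-integrable setT (EFin \o (fun p : X => ai p * th p)).
Proof.
have [A [_ aA]] := rate_bounds (N := N) halpha.
apply: (@prob_integrable _ _ _ _ _ (A * 1)) => [|p].
  by apply: borel_measurable2; apply: ctsM => //; exact: continuous_delay_of.
rewrite normrM ler_pM// ler_norml; have /andP[-> h] := delay_of_itv p.
by rewrite (le_trans h).
Qed.

Lemma coord_integrable i (g : X -> R) (A : R) : continuous g -> (forall p, `|g p| <= A) ->
  Q.-integrable setT (EFin \o (fun p : X => g p * p.2 0 i)).
Proof.
move=> cg gA; apply: (quadratic_integrable hQS hQ (C := A)); first exact: ctsM.
by move=> p; rewrite normrM ler_pM//; exact: sq1.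
Qed.

Lemma rate_coord_integrable i : Q.-integrable setT (EFin \o (fun p : X => ai p * p.2 0 i)).
Proof.
have [A [_ aA]] := rate_bounds (N := N) halpha.
exact: (coord_integrable _ aic aA).
Qed.

Lemma rate_delay_mean : \int[Q]_p (ai p * th p) = - G.
Proof.
have i1 := rate_delay_integrable.
have Z := RintegralZl (- 1) measurableT i1.
rewrite /Gam (@strip_Rintegral _ _ _ hQS _ (fun p => - 1 * (ai p * th p))).
- by rewrite Z mulN1r opprK.
- by move=> p hp; rewrite /rate_oo delay_ofE//; ring.
- exact: (integrableZl measurableT (- 1) i1).
Qed.

Lemma Gam_ge0 : 0 <= G.
Proof.
apply: Rintegral_ge0 => p hp; rewrite mulr_ge0//.
  by rewrite oppr_ge0; case/andP: hp.
by case: halpha => _ _ _ [h _] _; apply/ltW/h.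
Qed.

Let G1 : 0 < 1 + G. Proof. by rewrite ltr_pwDl// Gam_ge0. Qed.

Lemma drift_mean i : \int[Q]_p (ai p * p.2 0 i) = (1 + G) * K 0 i.
Proof.
rewrite !mxE mulrA divff ?gt_eqF// mul1r; apply/esym/strip_Rintegral => //.
  by move=> p hp; rewrite /rate_oo delay_ofE.
exact: rate_coord_integrable.
Qed.

Let w (p : X) : 'rV[R]_N := p.2 + th p *: K.

(** The jumps contribute [(1 + G) * dot zeta K] by the definition of [K], the delays
    [- G * dot zeta K]; what remains is the speed of the moving centre. *)
Lemma rate_dot_mean zeta : \int[Q]_p (ai p * dot zeta (p.2 + th p *: K)) = dot zeta K.
Proof.
have iz i : Q.-integrable setT (EFin \o (fun p : X => zeta 0 i * (ai p * p.2 0 i))).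
  exact: (integrableZl measurableT _ (rate_coord_integrable i)).
have i2 := integrableZl measurableT (dot zeta K) rate_delay_integrable.
have isum : Q.-integrable setT (EFin \o (fun p : X => \sum_i zeta 0 i * (ai p * p.2 0 i))).
  exact: integrable_Rsum measurableT iz.
have D := RintegralD measurableT isum i2.
have S := Rintegral_sum (index_enum _) measurableT iz.
have Z := RintegralZl (dot zeta K) measurableT rate_delay_integrable.
transitivity (\int[Q]_p (\sum_i zeta 0 i * (ai p * p.2 0 i) + dot zeta K * (ai p * th p))).
  apply: eq_Rintegral => p _; rewrite dotDr dotZr mulrDr; congr (_ + _); last by ring.
  by rewrite /dot mulr_sumr; apply: eq_bigr => i _; ring.
apply: (etrans D); rewrite [X in _ + X]Z rate_delay_mean [X in X + _]S.
under eq_bigr => i _.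
  have Zi := RintegralZl (zeta 0 i) measurableT (rate_coord_integrable i).
  rewrite Zi drift_mean mulrCA; over.
by rewrite -mulr_sumr /=; rewrite -/(dot zeta K); ring.
Qed.

Let wc i : continuous (fun p : X => w p 0 i).
Proof.
rewrite (_ : (fun p => _) = fun p : X => p.2 0 i + th p * K 0 i).
  apply: ctsD; first exact: zc.
  by apply: ctsM; [exact: continuous_delay_of|exact: cts_cst].
by apply/funext => p; rewrite !mxE.
Qed.

Let wE i p : w p 0 i = p.2 0 i + th p * K 0 i.
Proof. by rewrite /w mxE; congr (_ + _); rewrite mxE. Qed.

Let w_sq i p : w p 0 i ^+ 2 <= 2 * (1 + K 0 i ^+ 2) * (1 + sqr_enorm p.2).
Proof.
have /andP[h1 h2] := delay_of_itv p; rewrite wE.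
have := coord_le_enorm p.2 i; have := sqr_enorm_ge0 p.2.
set s := sqr_enorm _; set z := p.2 0 i; set t := th p in h1 h2 *; set c := K 0 i.
move=> s0 zs; have t1 : t ^+ 2 <= 1.
  have : t ^+ 2 = t * t by exact: expr2.
  by move=> ->; nra.
have : (z + t * c) ^+ 2 <= 2 * z ^+ 2 + 2 * (t ^+ 2 * c ^+ 2).
  have := sqr_ge0 (z - t * c).
  rewrite (_ : (z - t * c) ^+ 2 = 2 * z ^+ 2 + 2 * (t ^+ 2 * c ^+ 2) - (z + t * c) ^+ 2); last by ring.
  by move=> h; lra.
move=> h; apply: (le_trans h); have c2 := sqr_ge0 c.
have : t ^+ 2 * c ^+ 2 <= 1 * c ^+ 2 by rewrite ler_wpM2r.
set u := c ^+ 2 in c2 *; rewrite mul1r => h3.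
have : 0 <= u * s by rewrite mulr_ge0.
by move=> us; rewrite (_ : 2 * (1 + u) * (1 + s) = 2 + 2 * s + 2 * u + 2 * (u * s)); [lra|ring].
Qed.

Let wij_int i j (g : X -> R) (A : R) : continuous g -> (forall p, `|g p| <= A) ->
  Q.-integrable setT (EFin \o (fun p : X => g p * (w p 0 i * w p 0 j))).
Proof.
move=> cg gA; apply: (quadratic_integrable hQS hQ
   (C := A * (2 * (1 + K 0 i ^+ 2) + 2 * (1 + K 0 j ^+ 2)))).
  by apply: ctsM => //; apply: ctsM; exact: wc.
move=> p; rewrite normrM -[leRHS]mulrA ler_pM//.
have h : `|w p 0 i * w p 0 j| <= w p 0 i ^+ 2 + w p 0 j ^+ 2.
  set x := w p 0 i; set y := w p 0 j.
  have h1 := sqr_ge0 (x - y); have h2 := sqr_ge0 (x + y).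
  have e1 : (x - y) ^+ 2 = x ^+ 2 + y ^+ 2 - 2 * (x * y) by ring.
  have e2 : (x + y) ^+ 2 = x ^+ 2 + y ^+ 2 + 2 * (x * y) by ring.
  have h3 := sqr_ge0 x; have h4 := sqr_ge0 y.
  by rewrite ler_norml; rewrite e1 in h1; rewrite e2 in h2; apply/andP; split; lra.
by rewrite (le_trans h)// mulrDl lerD// w_sq.
Qed.

Let sum_prod (zeta x : 'rV[R]_N) :
  dot zeta x ^+ 2 = \sum_i \sum_j zeta 0 i * zeta 0 j * (x 0 i * x 0 j).
Proof.
rewrite expr2 /dot mulr_suml; apply: eq_bigr => i _; rewrite mulr_sumr.
by apply: eq_bigr => j _; ring.
Qed.

Lemma dot_sq_integrable zeta :
  Q.-integrable setT (EFin \o (fun p : X => dot zeta (p.2 + th p *: K) ^+ 2)).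
Proof.
have i1 i j : Q.-integrable setT (EFin \o (fun p : X => zeta 0 i * zeta 0 j * (w p 0 i * w p 0 j))).
  apply: (@wij_int i j (fun=> zeta 0 i * zeta 0 j) `|zeta 0 i * zeta 0 j|) => //.
  exact: cts_cst.
have := integrable_Rsum (index_enum _) measurableT (fun i =>
  integrable_Rsum (index_enum _) measurableT (i1 i)).
by apply: eq_integrable => // p _ /=; rewrite -/(w p) sum_prod.
Qed.

Lemma D0_quadratic zeta : \int[Q]_p (ai p * dot zeta (p.2 + th p *: K) ^+ 2) =
  \sum_i \sum_j D0 Q alpha_oo i j * (zeta 0 i * zeta 0 j).
Proof.
have [A [_ aA]] := rate_bounds (N := N) halpha.
have i0 i j := wij_int i j aic aA.
have i1 i j : Q.-integrable setT (EFin \o (fun p : X => zeta 0 i * zeta 0 j * (ai p * (w p 0 i * w p 0 j)))).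
  exact: (integrableZl measurableT _ (i0 i j)).
have i2 i : Q.-integrable setT (EFin \o (fun p : X => \sum_j zeta 0 i * zeta 0 j * (ai p * (w p 0 i * w p 0 j)))).
  exact: integrable_Rsum measurableT (i1 i).
have S2 := Rintegral_sum (index_enum _) measurableT i2.
transitivity (\int[Q]_p \sum_i \sum_j zeta 0 i * zeta 0 j * (ai p * (w p 0 i * w p 0 j))).
  apply: eq_Rintegral => p _; rewrite -/(w p) sum_prod mulr_sumr.
  apply: eq_bigr => i _; rewrite mulr_sumr; apply: eq_bigr => j _; ring.
apply: (etrans S2); apply: eq_bigr => i _.
have S1 := Rintegral_sum (index_enum _) measurableT (i1 i).
apply: (etrans S1); apply: eq_bigr => j _.
have Z := RintegralZl (zeta 0 i * zeta 0 j) measurableT (i0 i j).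
rewrite Z mulrC; congr (_ * _); rewrite mxE; apply/esym/strip_Rintegral => // p hp.
have -> : p.2 + p.1 *: K = w p by rewrite /w delay_ofE.
by rewrite /rate_oo delay_ofE// mxE big_ord1 !mxE.
Qed.

Lemma rate_dot_sq_ge0 zeta : 0 <= \int[Q]_p (ai p * dot zeta (p.2 + th p *: K) ^+ 2).
Proof.
apply: Rintegral_ge0 => p _.
by rewrite mulr_ge0 ?sqr_ge0// ltW// (rate_oo_gt0 halpha).
Qed.

Local Notation mu := (@lebesgue_measure R).
Local Notation H := (Hshift Q alpha alpha_oo).

Definition mean_jump i (t : R) : R := \int[Q]_p (rate alpha t p * p.2 0 i).

(** The coordinate [p.2 0 i] is unbounded, so continuity of parameter integrals is applied to its
    truncations at [n]; [mean_jump] is their pointwise limit, by domination with [A] times the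
    absolute value of the coordinate. *)
Lemma measurable_mean_jump i (D : set R) : measurable_fun D (mean_jump i).
Proof.
apply: measurable_funTS.
have [A [rA _]] := rate_bounds (N := N) halpha.
have A0 : 0 <= A by apply: le_trans (rA 0 (0, 0)).
pose cl n (z : R) := Num.max (- n%:R) (Num.min z n%:R).
have clc n : continuous (cl n).
  apply: cts_max; first exact: cts_cst.
  by apply: cts_min; [move=> x; exact: cvg_id|exact: cts_cst].
have cln n z : `|cl n z| <= n%:R.
  rewrite ler_norml /cl le_max lexx ge_max ge_min lexx orbT andbT /=.
  by rewrite (@le_trans _ _ 0)// oppr_le0.
have clz n z : `|cl n z| <= `|z|.
  rewrite /cl; have n0 : 0 <= n%:R :> R by [].
  case: (leP z n%:R) => h1; case: (leP (- n%:R) _) => h2 //.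
  - by rewrite normrN (ger0_norm n0) -normrN (le_trans _ (ler_norm _))// lerNr ltW.
  - by rewrite ger0_norm// (le_trans (ltW h1))// ler_norm.
  - by move: h2; rewrite ltNge (@le_trans _ _ 0)// oppr_le0.
have clE n z : `|z| <= n%:R -> cl n z = z.
  by rewrite ler_norml => /andP[h1 h2]; rewrite /cl min_l// max_r.
apply: (measurable_fun_cvg (h := fun n t => \int[Q]_p (rate alpha t p * cl n (p.2 0 i)))) => [n|t _].
  apply: continuous_measurable_fun.
  apply: (@continuous_prob_integral _ _ _ Q (fun t p => rate alpha t p * cl n (p.2 0 i)) (A * n%:R)).
  - move=> t; apply: borel_measurable2; apply: ctsM; first exact: crate_p.
    exact: cts_comp.
  - by move=> p; apply: ctsM; [exact: crate_t|exact: cts_cst].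
  - by move=> t p; rewrite normrM ler_pM.
apply: (@Rdominated_cvg _ _ _ Q setT (fun n p => rate alpha t p * cl n (p.2 0 i)) _
  (fun p => A * `|p.2 0 i|)) => //.
- move=> n; apply: borel_measurable2; apply: ctsM; first exact: crate_p.
  exact: cts_comp.
- move=> p _; apply: cvgM; first exact: cvg_cst.
  have e : \forall n \near \oo, p.2 0 i = cl n (p.2 0 i).
    near=> n; rewrite clE//; near: n.
    exact: nbhs_infty_ger.
  by apply: (cvg_trans (near_eq_cvg e)); exact: cvg_cst.
- apply: (quadratic_integrable hQS hQ (C := A)).
    apply: ctsM; first exact: cts_cst.
    by apply: (cts_comp (h := Num.Def.normr)) => // x; exact: norm_continuous.
  by move=> p; rewrite normrM normr_id (ger0_norm A0) ler_wpM2l.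
- by move=> n p _; rewrite normrM ler_pM.
Unshelve. all: by end_near.
Qed.

Let E i := \int[Q]_p `|p.2 0 i|.
Let absz_int i : Q.-integrable setT (EFin \o (fun p : X => `|p.2 0 i|)).
Proof.
apply: (quadratic_integrable hQS hQ (C := 1)).
  by apply: (cts_comp (h := Num.Def.normr)) => // x; exact: norm_continuous.
by move=> p; rewrite normr_id mul1r.
Qed.

Lemma mean_jump_bounded i : exists C, forall t : R, `|mean_jump i t| <= C.
Proof.
have [A [rA _]] := rate_bounds (N := N) halpha.
have A0 : 0 <= A by apply: le_trans (rA 0 (0, 0)).
exists (\int[Q]_p (A * `|p.2 0 i|)) => t.
apply: le_normr_Rintegral_bound => //.
- by apply: borel_measurable2; apply: ctsM; [exact: crate_p|exact: zc].
- exact: (integrableZl measurableT A (absz_int i)).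
- by move=> p _; rewrite normrM ler_wpM2r.
Qed.

Lemma mean_jump_decay i : exists C beta : R, 0 < beta /\
  forall t : R, 0 <= t -> `|(1 + G) * K 0 i - mean_jump i t| <= expR (- beta * t) * C.
Proof.
have [M [beta [M0 b0 hM]]] := rate_decay (N := N) halpha.
have [A [rA aA]] := rate_bounds (N := N) halpha.
exists (M * E i), beta; split => // t t0.
have i1 := rate_coord_integrable i.
have i2 := coord_integrable i (crate_p (t := t)) (rA t).
have B := RintegralB measurableT i1 i2.
rewrite -drift_mean /mean_jump -B.
have Z := RintegralZl (M * expR (- beta * t)) measurableT (absz_int i).
rewrite mulrA (mulrC (expR _)) -Z; apply: le_normr_Rintegral_bound => //.
- apply: borel_measurable2; apply: ctsB; apply: ctsM => //; first [exact: crate_p|exact: zc].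
- exact: (integrableZl measurableT _ (absz_int i)).
- by move=> p _; rewrite -mulrBl normrM ler_wpM2r// distrC hM.
Qed.

Let ijump i (s t : R) : mu.-integrable `[s, t] (EFin \o mean_jump i).
Proof.
have [C hC] := mean_jump_bounded i.
have h : mu.-integrable `[s, t] (EFin \o (fun _ : R => C)).
  apply: continuous_compact_integrable; first exact: segment_compact.
  by apply: continuous_subspaceT; exact: cts_cst.
apply: (@integrable_bound _ _ _ mu `[s, t] _ (fun=> C)) => //.
exact: measurable_mean_jump.
Qed.

Lemma HshiftE i (t : R) :
  H t 0 i = - (1 + G)^-1 * \int[mu]_(s in `[0, t]) mean_jump i s.
Proof.
rewrite !mxE; congr (_ * _); apply: eq_Rintegral => s; rewrite inE /= in_itv /= => /andP[s0 _].
apply: strip_Rintegral => //.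
  by move=> p hp; rewrite /rate max_l// delay_ofE.
have [A [rA aA]] := rate_bounds (N := N) halpha.
exact: (coord_integrable i (crate_p (t := s)) (rA s)).
Qed.

Let mitv (s t : R) : s <= t -> fine (mu `[s, t]) = t - s.
Proof.
rewrite le_eqVlt => /orP[/eqP ->|st]; first by rewrite set_itv1 lebesgue_measure_set1 subrr.
by rewrite lebesgue_measure_itv /= lte_fin st.
Qed.

(** Up to the factor [(1 + G)^-1] this is the integral over [[0, t]] of [(1 + G) * K 0 i] minus the
    mean jump, a difference that decays exponentially because the rates do so towards their
    limit. *)
Lemma Hshift_drift_bounded i : exists C, forall t : R, 0 <= t ->
  `|H t 0 i + t * K 0 i| <= C.
Proof.
have [C [beta [b0 hC]]] := mean_jump_decay i.
exists ((1 + G)^-1 * (C / beta)) => t t0.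
set c := (1 + G) * K 0 i in hC.
have icst : mu.-integrable `[0, t] (EFin \o (fun _ : R => c)).
  apply: continuous_compact_integrable; first exact: segment_compact.
  by apply: continuous_subspaceT; exact: cts_cst.
have B := @RintegralB _ _ _ mu `[0, t] (fun=> c) (mean_jump i) (measurable_itv _) icst (ijump i 0 t).
rewrite Rintegral_cst// mitv// subr0 in B.
rewrite HshiftE (_ : _ + _ = (1 + G)^-1 * (c * t - \int[mu]_(s in `[0, t]) mean_jump i s)); last first.
  by rewrite /c; field; rewrite gt_eqF.
rewrite -B normrM ger0_norm ?invr_ge0 ?(ltW G1)// ler_wpM2l ?invr_ge0 ?(ltW G1)//.
have C0 : 0 <= C.
  by have := hC 0 (lexx 0); rewrite mulr0 expR0 mul1r; apply: le_trans.
have iE := integrable_expRN_cst C b0.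
have sub : `[0, t] `<=` `[(0 : R), +oo[.
  by move=> x /=; rewrite !in_itv /= andbT => /andP[].
have iE' := @integrableS _ _ _ mu _ _ _ (measurable_itv _) (measurable_itv _) sub iE.
apply: (@le_trans _ _ (\int[mu]_(s in `[0, t]) (expR (- beta * s) * C))).
  apply: le_normr_Rintegral_bound => //.
    by apply: measurable_funB; [exact: measurable_cst|exact: measurable_mean_jump].
  by move=> s /=; rewrite in_itv /= => /andP[s0 _]; exact: hC.
rewrite -(lap_cst C b0) /lap /Rintegral.
have pos x : (0 <= (expR (- beta * x) * C)%:E)%E.
  by rewrite lee_fin mulr_ge0 ?expR_ge0.
apply: fine_le; [exact: (integrable_fin_num _ iE')|exact: (integrable_fin_num _ iE)|].
apply: ge0_subset_integral => //; first exact: measurable_int iE.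
Qed.

Lemma Hshift_lipschitz i : exists C, forall s t : R,
  `|H (Num.max s 0) 0 i - H (Num.max t 0) 0 i| <= C * `|s - t|.
Proof.
have [C hC] := mean_jump_bounded i.
have C0 : 0 <= C by apply: le_trans (hC 0).
exists ((1 + G)^-1 * C).
suff h (s t : R) : s <= t ->
    `|H (Num.max s 0) 0 i - H (Num.max t 0) 0 i| <= (1 + G)^-1 * C * `|s - t|.
  move=> s t; have [st|/ltW ts] := leP s t; first exact: h.
  by rewrite distrC (distrC s); exact: h.
move=> st; set s' := Num.max s 0; set t' := Num.max t 0.
have s0 : 0 <= s' by rewrite le_max lexx orbT.
have st' : s' <= t'.
  by rewrite ge_max; apply/andP; split; rewrite le_max ?st ?lexx ?orbT.
have le' : t' - s' <= `|s - t|.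
  rewrite distrC ger0_norm ?subr_ge0// /t' /s'.
  by case: (leP t 0) => h1; case: (leP s 0) => h2; lra.
rewrite !HshiftE -mulrBr normrM -[leRHS]mulrA.
have -> : `|- (1 + G)^-1| = (1 + G)^-1 by rewrite normrN gtr0_norm ?invr_gt0.
rewrite ler_wpM2l ?invr_ge0 ?(ltW G1)// distrC.
have I := ijump i 0 t'.
have Bq := Rintegral_itvB I (x := s').
rewrite Bq ?bnd_simp//.
apply: (@le_trans _ _ (\int[mu]_(x in `]s', t']) (fun _ : R => C) x)).
  apply: le_normr_Rintegral_bound => //; first exact: measurable_mean_jump.
  have h : mu.-integrable `[s', t'] (EFin \o (fun _ : R => C)).
    apply: continuous_compact_integrable; first exact: segment_compact.
    by apply: continuous_subspaceT; exact: cts_cst.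
  apply: (@integrableS _ _ _ mu _ _ _ (measurable_itv _) (measurable_itv _) _ h).
  exact: subset_itv_oc_cc.
rewrite Rintegral_cst// ler_wpM2l//.
have mo : fine (mu `]s', t']) = t' - s'.
  rewrite lebesgue_measure_itv /= lte_fin; case: ltP => //= h.
  by apply/esym/eqP; rewrite subr_eq0 eq_le h st'.
by rewrite -mo in le'.
Qed.

Lemma continuous_dot_Hshift xi : continuous (fun t : R => dot xi (H (Num.max t 0))).
Proof.
apply: cts_sum => i _; apply: ctsM; first exact: cts_cst.
have [C hC] := Hshift_lipschitz i.
exact: lipschitz_continuous hC.
Qed.

End drift_identities.

Lemma lap_dist_le {R : realType} (a e M M' : R) (F F' : R -> R) : 0 < a ->
  measurable_fun `[(0 : R), +oo[ F -> (forall s, 0 <= s -> `|F s| <= M) ->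
  measurable_fun `[(0 : R), +oo[ F' -> (forall s, 0 <= s -> `|F' s| <= M') ->
  (forall s, 0 <= s -> `|F s - F' s| <= e) -> `|lap a F - lap a F'| <= e / a.
Proof.
move=> a0 mF FM mF' FM' h; have E := lapB a0 mF FM mF' FM'.
rewrite -E; apply: lap_norm_le => //; exact: measurable_funB.
Qed.

Lemma trig_approx_pointwise {R : realType} {N : nat} (h : 'rV[R]_N -> R) (M : R)
  (q : nat -> 'rV[R]_N -> R) :
  (forall e r : R, 0 < e -> exists n0, forall n (x : 'rV[R]_N), (n0 <= n)%N ->
      (forall i, `|x 0 i| <= r) -> `|q n x - h x| <= e) ->
  forall x, q n x @[n --> \oo] --> h x.
Proof.
move=> hq x; apply/cvgrPdist_le => e e0.
have [n0 hn0] := hq e `|x| e0.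
near=> n; rewrite distrC; apply: hn0; last by move=> i; exact: coord_le_norm.
by near: n; exact: nbhs_infty_ge.
Unshelve. all: by end_near.
Qed.

Lemma Cb_prob_integrable {R : realType} {N : nat} (f : 'rV[R]_N -> R)
  (P : probability (Borel 'rV[R]_N) R) : is_Cb f -> P.-integrable setT (EFin \o f).
Proof.
move=> [cf [M fM]]; apply: (@prob_integrable _ _ _ _ _ M) => //.
exact: borel_measurable.
Qed.

Lemma Cb_prob_bound {R : realType} {N : nat} (f : 'rV[R]_N -> R) (M : R)
  (P : probability (Borel 'rV[R]_N) R) : is_Cb f -> (forall x, `|f x| <= M) ->
  `|\int[P]_x f x| <= M.
Proof. by move=> [cf _] fM; apply: prob_norm_le => //; exact: borel_measurable. Qed.

Lemma Cb_prob_cvg {R : realType} {N : nat} (q : nat -> 'rV[R]_N -> R) (h : 'rV[R]_N -> R)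
    (M : R) (P : probability (Borel 'rV[R]_N) R) :
  (forall n, is_Cb (q n)) -> (forall n x, `|q n x| <= M) ->
  (forall x, q n x @[n --> \oo] --> h x) ->
  \int[P]_x q n x @[n --> \oo] --> \int[P]_x h x.
Proof.
move=> cq qM qh; apply: (@Rdominated_cvg _ _ _ P setT q h (fun=> M)) => //.
- by move=> n; apply: borel_measurable; case: (cq n).
- by apply: (@prob_integrable _ _ _ _ _ `|M|) => //; exact: measurable_cst.
Qed.

(** * The limit relation for the rescaled laws *)

Section rescaled_limits.
Context {R : realType} {N : nat}.
Notation X := (R * 'rV[R]_N)%type.
Context (Q : probability (Borel X) R).
Variables (alpha : R -> R -> R) (alpha_oo : R -> R).
Variables (u0 mu Pi : R -> narrow R 'rV[R]_N) (p : R -> R -> narrow R 'rV[R]_N).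
Hypothesis halpha : standing_alpha alpha alpha_oo.
Hypothesis hQS : Q (@strip R N) = 1%E.
Hypothesis hQ : standing_Q Q.
Hypothesis hmu : delay_solution Q alpha u0 mu.
Hypothesis hp : rescaled (Hshift Q alpha alpha_oo) mu p.
Local Notation G := (Gam Q alpha_oo).
Local Notation K := (drift Q alpha_oo).
Local Notation H := (Hshift Q alpha alpha_oo).
Local Notation ai := (rate_oo alpha_oo : X -> R).
Local Notation th := (@delay_of R N).
Local Notation nu := (law mu).

Let nu_c := law_c hmu.

Let G1 : 0 < 1 + G. Proof. by rewrite ltr_pwDl// (Gam_ge0 _ halpha). Qed.

(** The integral of [f (dot zeta x)] against [p lam s], written with the original law. The clamp
    makes it continuous on the whole line, whereas [p] is described at nonnegative times only. *)
Definition rescaled_ridge (f : R -> R) (zeta : 'rV[R]_N) (lam s : R) : R :=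
  ridge nu f (lam^-1 *: zeta) (lam ^+ 2 * s)
    (dot (lam^-1 *: zeta) (H (Num.max (lam ^+ 2 * s) 0))).

Lemma rescaled_ridgeE (f : R -> R) (B : R) zeta (lam s : R) : continuous f ->
  (forall y, `|f y| <= B) -> 0 < lam -> 0 <= s ->
  \int[p lam s]_x f (dot zeta x) = rescaled_ridge f zeta lam s.
Proof.
move=> cf fB l0 s0.
have ls0 : 0 <= lam ^+ 2 * s by rewrite mulr_ge0// sqr_ge0.
rewrite hp//; last first.
  by split; [apply: cts_comp => //; exact: continuous_dot|exists B => x].
rewrite /rescaled_ridge /ridge lawE; last by rewrite (le_trans _ ls0)// oppr_le0.
apply: eq_Rintegral => x _; congr f; rewrite max_l//.
by rewrite dotZr dotDr !dotZl mulrDr.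
Qed.

Section lipschitz_profile.
Variables (f : R -> R) (B : R).
Hypothesis cf : continuous f.
Hypothesis fB : forall y, `|f y| <= B.
Hypothesis fL : forall x y, `|f x - f y| <= B * `|x - y|.

Let scale_cts (c : R) : continuous (fun s : R => c * s).
Proof. by apply: ctsM; [exact: cts_cst|move=> s; exact: cvg_id]. Qed.

Lemma continuous_rescaled_ridge zeta lam : continuous (rescaled_ridge f zeta lam).
Proof.
apply: (continuous_ridge_t nu_c cf fB fL); first exact: scale_cts.
apply: (cts_comp (h := fun t => dot (lam^-1 *: zeta) (H (Num.max t 0)))); last exact: scale_cts.
exact: (continuous_dot_Hshift halpha hQS hQ).
Qed.

Lemma rescaled_ridge_bound zeta (lam s : R) : `|rescaled_ridge f zeta lam s| <= B.
Proof. exact: (ridge_bound _ cf fB). Qed.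

Let line_ridge zeta lam (t : R) : R :=
  ridge nu f (lam^-1 *: zeta) t (- dot (lam^-1 *: zeta) K * t + 0).

Let line_cts zeta lam : continuous (line_ridge zeta lam).
Proof.
apply: (continuous_ridge_t nu_c cf fB fL); first by move=> s; exact: cvg_id.
by apply: ctsD; [exact: scale_cts|exact: cts_cst].
Qed.

Lemma lap_ridge_rescaled zeta (a lam : R) : 0 < a -> 0 < lam ->
  lap_ridge nu f (lam^-1 *: zeta) (a / lam ^+ 2) (dot (lam^-1 *: zeta) K) 0 =
  lam ^+ 2 * lap a (fun s => ridge nu f (lam^-1 *: zeta) (lam ^+ 2 * s)
    (- dot (lam^-1 *: zeta) K * (lam ^+ 2 * s) + 0)).
Proof.
move=> a0 l0; apply: (@lap_scale _ a (lam ^+ 2) (line_ridge zeta lam) B a0) => //.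
  by rewrite exprn_gt0.
by move=> s _; exact: (ridge_bound _ cf fB).
Qed.

Let drift_bound zeta : exists2 C, 0 <= C & forall t : R, 0 <= t ->
  `|dot zeta (H t) + dot zeta K * t| <= C.
Proof.
have /choice[C hC] := Hshift_drift_bounded halpha hQS hQ.
have C0 i : 0 <= C i by apply: le_trans (hC i 0 (lexx 0)).
exists (\sum_i `|zeta 0 i| * C i).
  by apply: sumr_ge0 => i _; rewrite mulr_ge0.
move=> t t0; rewrite /dot mulr_suml -big_split /=.
rewrite (le_trans (ler_norm_sum _ _ _))// ler_sum// => i _.
rewrite (_ : _ + _ = zeta 0 i * (H t 0 i + t * K 0 i)); last by ring.
by rewrite normrM ler_wpM2l// hC.
Qed.

Lemma lap_rescaled_close zeta (a : R) : 0 < a -> exists C, forall lam, 0 < lam ->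
  `|lap a (rescaled_ridge f zeta lam)
    - lap a (fun s => ridge nu f (lam^-1 *: zeta) (lam ^+ 2 * s)
      (- dot (lam^-1 *: zeta) K * (lam ^+ 2 * s) + 0))| <= C / lam.
Proof.
move=> a0; have [C C0 hC] := drift_bound zeta.
exists (B * C / a) => lam l0.
have B0 : 0 <= B by apply: le_trans (fB 0).
rewrite (_ : B * C / a / lam = B * (lam^-1 * C) / a); last by ring.
have m (g : R -> R) : continuous g -> measurable_fun `[(0 : R), +oo[ g.
  by move=> cg; apply: measurable_funTS; exact: continuous_measurable_fun.
apply: (@lap_dist_le _ _ _ B B) => //.
- by apply: m; exact: continuous_rescaled_ridge.
- by move=> s _; exact: rescaled_ridge_bound.
- by apply: m; apply: (cts_comp (h := line_ridge zeta lam)); [exact: line_cts|exact: scale_cts].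
- by move=> s _; exact: (ridge_bound _ cf fB).
move=> s s0; rewrite /rescaled_ridge.
apply: (le_trans (ridge_lip _ cf fB fL _ _ _ _)); rewrite ler_wpM2l//.
have ls0 : 0 <= lam ^+ 2 * s by rewrite mulr_ge0// sqr_ge0.
rewrite max_l// !dotZl.
rewrite (_ : _ - _ = lam^-1 * (dot zeta (H (lam ^+ 2 * s)) + dot zeta K * (lam ^+ 2 * s))); last by ring.
by rewrite normrM gtr0_norm ?invr_gt0// ler_wpM2l ?invr_ge0 ?(ltW l0)// hC.
Qed.

End lipschitz_profile.

Variables (a : R) (lam : R^nat).
Hypothesis a0 : 0 < a.
Hypothesis lam1 : forall n, 1 <= lam n.
Hypothesis lam_oo : lam n @[n --> \oo] --> +oo.
Let lam0 n : 0 < lam n. Proof. exact: lt_le_trans (lam1 n). Qed.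

Let lamV0 : (lam n)^-1 @[n --> \oo] --> (0 : R).
Proof. by apply/gtr0_cvgV0 => //; near=> n. Unshelve. all: by end_near. Qed.

Section profile_limit.
Variables (B : R) (k k1 k2 : R -> R).
Hypothesis hk : smooth3 B k k1 k2.
Let kB y : `|k y| <= B. Proof. by case: hk => _ _ /(_ y)[]. Qed.
Let k2B y : `|k2 y| <= B. Proof. by case: hk => _ _ /(_ y)[]. Qed.
Let ck := smooth3_continuous hk.
Let ck2 := smooth3_continuous2 hk.
Let kL := smooth3_lip hk.
Let k2L x y : `|k2 x - k2 y| <= B * `|x - y|. Proof. by case: hk. Qed.

Definition quad (zeta : 'rV[R]_N) : R :=
  \int[Q]_q (ai q * dot zeta (q.2 + th q *: K) ^+ 2).

(** The change of time scale gives each transform a factor [lam n ^+ 2], which cancels the factor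
    [(lam n)^-1 ^+ 2] in both terms of [lap_ridge_limit]; replacing the drift line by the shift
    costs a multiple of [(lam n)^-1]. *)
Lemma rescaled_lap_limit zeta :
  a * (1 + G) * lap a (rescaled_ridge k zeta (lam n))
  - quad zeta / 2 * lap a (rescaled_ridge k2 zeta (lam n)) @[n --> \oo] --> (1 + G) * k 0.
Proof.
have [A [rA aA]] := rate_bounds (N := N) halpha.
have [M [beta [M0 b0 hM]]] := rate_decay (N := N) halpha.
have L := lap_ridge_limit (law_c hmu) (rate_t halpha) (rate_p halpha) rA
  (rate_oo_c halpha) aA hM (@continuous_delay_of R N) (@delay_of_itv R N) b0
  (law_delay_eq halpha hQS hmu) hk a0 lam1 lam_oo
  (dot_sq_integrable alpha_oo hQS hQ zeta) (rate_delay_mean halpha hQS)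
  (rate_dot_mean halpha hQS hQ zeta).
pose Lf f n := lap a (fun s => ridge nu f ((lam n)^-1 *: zeta) (lam n ^+ 2 * s)
    (- dot ((lam n)^-1 *: zeta) K * (lam n ^+ 2 * s) + 0)).
have {}L : a * (1 + G) * Lf k n - quad zeta / 2 * Lf k2 n @[n --> \oo] --> (1 + G) * k 0.
  move: L; apply: cvg_trans; apply: near_eq_cvg; near=> n.
  rewrite (lap_ridge_rescaled ck kB kL zeta a0 (lam0 n)).
  rewrite (lap_ridge_rescaled ck2 k2B k2L zeta a0 (lam0 n)).
  rewrite -/(Lf k n) -/(Lf k2 n) -/(quad zeta).
  have l0 : lam n != 0 by rewrite gt_eqF.
  by move: (Lf k n) (Lf k2 n) (quad zeta) => x y z; field.
have D (f : R -> R) : continuous f -> (forall y, `|f y| <= B) ->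
    (forall x y, `|f x - f y| <= B * `|x - y|) ->
    lap a (rescaled_ridge f zeta (lam n)) - Lf f n @[n --> \oo] --> (0 : R).
  move=> cf fB fL; have [C hC] := lap_rescaled_close cf fB fL zeta a0.
  apply/norm_cvg0P; apply: (squeeze_cvgr (f := fun=> 0) (h := fun n => C / lam n)).
  - by near=> n; rewrite normr_ge0 /=; exact: hC.
  - exact: cvg_cst.
  - by rewrite -(mulr0 C); apply: cvgM => //; exact: cvg_cst.
have D1 := D k ck kB kL; have D2 := D k2 ck2 k2B k2L.
have E : a * (1 + G) * Lf k n - quad zeta / 2 * Lf k2 n +
   (a * (1 + G) * (lap a (rescaled_ridge k zeta (lam n)) - Lf k n) -
    quad zeta / 2 * (lap a (rescaled_ridge k2 zeta (lam n)) - Lf k2 n)) @[n --> \oo] -->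
   (1 + G) * k 0 + (a * (1 + G) * 0 - quad zeta / 2 * 0).
  apply: cvgD; first exact: L.
  by apply: cvgB; (apply: cvgM; first exact: cvg_cst); [exact: D1|exact: D2].
rewrite (_ : (1 + G) * k 0 + (a * (1 + G) * 0 - quad zeta / 2 * 0) = (1 + G) * k 0) in E; last by ring.
move: E; apply: cvg_trans; apply: near_eq_cvg; near=> n.
move: (Lf k n) (Lf k2 n) (lap a (rescaled_ridge k zeta _)) (lap a (rescaled_ridge k2 zeta _)) (quad zeta).
by move=> x y z w v; ring.
Unshelve. all: by end_near.
Qed.

End profile_limit.

Lemma quad_ge0 zeta : 0 <= quad zeta.
Proof. exact: (rate_dot_sq_ge0 Q halpha zeta). Qed.

Lemma half_quad_diffusion zeta :
  half_quad ((1 + G)^-1 *: D0 Q alpha_oo) zeta = quad zeta / 2 / (1 + G).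
Proof.
rewrite /quad (D0_quadratic halpha hQS hQ) /half_quad.
transitivity (2^-1 * ((1 + G)^-1 * \sum_i \sum_j D0 Q alpha_oo i j * (zeta 0 i * zeta 0 j))).
  congr (_ * _); rewrite mulr_sumr; apply: eq_bigr => i _; rewrite mulr_sumr.
  by apply: eq_bigr => j _; rewrite mxE -mulrA.
move: (\sum_i _) => s; ring.
Qed.

End rescaled_limits.

(** * Tightness and convergence of Laplace transforms *)

Section rational_profile.
Context {R : realType}.

Let u (y : R) : R := (1 + y ^+ 2)^-1.
Let den (y : R) : 0 < 1 + y ^+ 2. Proof. by rewrite ltr_pwDl// sqr_ge0. Qed.
Let u0 y : 0 < u y. Proof. by rewrite invr_gt0. Qed.
Let u1 y : u y <= 1. Proof. by rewrite invf_le1// lerDl sqr_ge0. Qed.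
Let yu y : `|y * u y| <= 1.
Proof.
rewrite normrM (gtr0_norm (u0 y)) ler_pdivrMr// mul1r -(real_normK (num_real y)).
have := normr_ge0 y; set z := `|y| => z0; have := sqr_ge0 (z - 1).
by rewrite (_ : (z - 1) ^+ 2 = z ^+ 2 - 2 * z + 1); [lra|ring].
Qed.

Let du y : is_derive y (1 : R) u (- 2 * y * u y ^+ 2).
Proof.
have h : is_derive y (1 : R) (fun y : R => 1 + y ^+ 2) (2 * y).
  by apply: is_derive_eq; rewrite /GRing.scale /=; ring.
have h2 := @is_deriveV R (fun y : R => 1 + y ^+ 2) y (2 * y) 1 (lt0r_neq0 (den y)) h.
by apply: is_derive_eq h2 _; rewrite /u /GRing.scale /= exprVn; ring.
Qed.

Definition saturate (y : R) : R := 1 - u y.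
Definition saturate1 (y : R) : R := 2 * y * u y ^+ 2.
Definition saturate2 (y : R) : R := 2 * u y ^+ 2 - 8 * y ^+ 2 * u y ^+ 3.
Let k3 (y : R) : R := - 24 * y * u y ^+ 3 + 48 * y ^+ 3 * u y ^+ 4.

Let dk y : is_derive y (1 : R) saturate (saturate1 y).
Proof. rewrite /saturate; have h := du y; apply: is_derive_eq; rewrite /saturate1; ring. Qed.
Let dk1 y : is_derive y (1 : R) saturate1 (saturate2 y).
Proof. rewrite /saturate1; have h := du y; apply: is_derive_eq; rewrite /saturate2 /GRing.scale /=; ring. Qed.
Let dk2 y : is_derive y (1 : R) saturate2 (k3 y).
Proof. rewrite /saturate2; have h := du y; apply: is_derive_eq; rewrite /k3 /GRing.scale /=; ring. Qed.

Let nM (a b A B : R) : `|a| <= A -> `|b| <= B -> `|a * b| <= A * B.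
Proof. by move=> h1 h2; rewrite normrM ler_pM. Qed.

Let uB y : `|u y| <= 1. Proof. by rewrite gtr0_norm. Qed.

Let k3B y : `|k3 y| <= 72.
Proof.
have h1 := yu y; have h2 := uB y; set v := y * u y in h1; set w := u y in h2.
rewrite (_ : k3 y = - (24 * (v * (w * w))) + 48 * (v * (v * (v * w)))); last by rewrite /k3 /v /w; ring.
rewrite (le_trans (ler_normD _ _))// normrN (_ : 72 = 24 * (1 * (1 * 1)) + 48 * (1 * (1 * (1 * 1)))); last by ring.
by apply: lerD; do !apply: nM => //; rewrite normr_nat.
Qed.

(** The derivatives are combinations of products of [y * u y] and [u y], both at most 1 in absolute
    value. The constant 72 = 24 + 48 bounds the third derivative [k3], which gives the Lipschitz
    condition. *)
Lemma smooth3_saturate : smooth3 72 saturate saturate1 saturate2.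
Proof.
split => //.
- move=> y; have h1 := yu y; have h2 := uB y; split.
  + by rewrite ler_norml; have := u0 y; have := u1 y; rewrite /saturate => ? ?; apply/andP; split; lra.
  + rewrite (_ : saturate1 y = 2 * ((y * u y) * u y)); last by rewrite /saturate1; ring.
    apply: (@le_trans _ _ (2 * (1 * 1))); last by lra.
    by do !apply: nM => //; rewrite normr_nat.
  + rewrite (_ : saturate2 y = 2 * (u y * u y) + - (8 * ((y * u y) * ((y * u y) * u y)))); last by rewrite /saturate2; ring.
    apply: (@le_trans _ _ (2 * (1 * 1) + 8 * (1 * (1 * 1)))); last by lra.
    rewrite (le_trans (ler_normD _ _))// normrN.
    by apply: lerD; do !apply: nM => //; rewrite normr_nat.
- move=> x y; have h := is_derive_shift y dk2.
  have := @mean_value_bound _ (fun s => saturate2 (y + s)) _ 72 (x - y) h (fun s _ => k3B _).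
  by rewrite addr0 (addrC y) subrK.
Qed.

Lemma saturate0 : saturate 0 = 0.
Proof. by rewrite /saturate /u expr0n addr0 invr1 subrr. Qed.

Lemma saturate_ge0 y : 0 <= saturate y.
Proof. by rewrite subr_ge0. Qed.

Lemma saturate_ge_half y : 1 <= `|y| -> 1 <= 2 * saturate y.
Proof.
move=> y1; suff : u y <= 2^-1 by rewrite /saturate => h; lra.
rewrite /u lef_pV2 ?posrE// (_ : 2 = 1 + 1 :> R); last by ring.
by rewrite lerD2l -(real_normK (num_real y)) -[leLHS](expr1n _ 2) lerXn2r// nnegrE.
Qed.

End rational_profile.

Section convergence.
Context {R : realType} {N : nat}.
Notation X := (R * 'rV[R]_N)%type.
Context (Q : probability (Borel X) R).
Variables (alpha : R -> R -> R) (alpha_oo : R -> R).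
Variables (u0 mu Pi : R -> narrow R 'rV[R]_N) (p : R -> R -> narrow R 'rV[R]_N).
Hypothesis halpha : standing_alpha alpha alpha_oo.
Hypothesis hQS : Q (@strip R N) = 1%E.
Hypothesis hQ : standing_Q Q.
Hypothesis hmu : delay_solution Q alpha u0 mu.
Hypothesis hp : rescaled (Hshift Q alpha alpha_oo) mu p.
Hypothesis hPi : diffusion_solution ((1 + Gam Q alpha_oo)^-1 *: D0 Q alpha_oo) Pi.
Local Notation G := (Gam Q alpha_oo).
Local Notation ridge_ f zeta l := (rescaled_ridge Q alpha alpha_oo mu f zeta l).
Local Notation qd := (quad Q alpha_oo).

Let G1 : 0 < 1 + G. Proof. by rewrite ltr_pwDl// (Gam_ge0 _ halpha). Qed.

Let m (g : R -> R) : continuous g -> measurable_fun `[(0 : R), +oo[ g.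
Proof. by move=> cg; apply: measurable_funTS; exact: continuous_measurable_fun. Qed.

Section bounded_lipschitz.
Variables (f : R -> R) (B : R).
Hypothesis cf : continuous f.
Hypothesis fB : forall y, `|f y| <= B.
Hypothesis fL : forall x y, `|f x - f y| <= B * `|x - y|.
Lemma measurable_rescaled_ridge zeta l : measurable_fun `[(0 : R), +oo[ (ridge_ f zeta l).
Proof. by apply: m; exact: (continuous_rescaled_ridge halpha hQS hQ hmu cf fB fL). Qed.

Lemma measurable_rescaled_profile zeta (l : R) : 0 < l ->
  measurable_fun `[(0 : R), +oo[ (fun s => \int[p l s]_x f (dot zeta x)).
Proof.
move=> l0; apply: eq_measurable_fun (measurable_rescaled_ridge zeta l) => s.
by rewrite inE /= in_itv /= andbT => s0; rewrite (rescaled_ridgeE hp zeta cf fB).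
Qed.

Lemma lap_rescaled_profile zeta (a l : R) : 0 < l ->
  lap a (fun s => \int[p l s]_x f (dot zeta x)) = lap a (ridge_ f zeta l).
Proof. by move=> l0; apply: eq_lap => s s0; rewrite (rescaled_ridgeE hp zeta cf fB). Qed.

Lemma lap_rescaled_ridgeN zeta (a l : R) : 0 < a ->
  lap a (ridge_ (fun y => - f y) zeta l) = - lap a (ridge_ f zeta l).
Proof.
move=> a0; have E := lapZ (- 1) a0 (measurable_rescaled_ridge zeta l)
  (fun s _ => rescaled_ridge_bound Q alpha alpha_oo mu cf fB zeta l s).
rewrite -[RHS]mulN1r -E; apply: eq_lap => s _; rewrite /rescaled_ridge /ridge.
rewrite -RintegralZl//; last by apply: (ridge_integrable _ cf fB).
by apply: eq_Rintegral => x _; rewrite mulN1r.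
Qed.

End bounded_lipschitz.

Let cosB (y : R) : `|cos y| <= 1. Proof. by rewrite ler_norml cos_geN1 cos_le1. Qed.
Let sinB (y : R) : `|sin y| <= 1. Proof. by rewrite ler_norml sin_geN1 sin_le1. Qed.
Let ccos := @continuous_cos R.
Let csin := @continuous_sin R.
Let cosL := smooth3_lip (@smooth3_cos R).
Let sinL := smooth3_lip (@smooth3_sin R).

Variable lam : R^nat.
Hypothesis lam1 : forall n, 1 <= lam n.
Hypothesis lam_oo : lam n @[n --> \oo] --> +oo.
Let lam0 n : 0 < lam n. Proof. exact: lt_le_trans (lam1 n). Qed.

(** The left side is [c * Y n] with [c] positive, so the relation can be divided by [c]; multiplied
    by [1 + G], the equation for [X] has the same coefficient [c]. *)
Let solve_cvg (a q X : R) (Y : R^nat) (b : R) : 0 < a -> 0 <= q ->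
  (a + q / 2 / (1 + G)) * X = b ->
  a * (1 + G) * Y n - q / 2 * - Y n @[n --> \oo] --> (1 + G) * b -> Y n @[n --> \oo] --> X.
Proof.
move=> a0 q0 E h; set c := a * (1 + G) + q / 2.
have c0 : 0 < c by rewrite ltr_pwDl ?mulr_gt0// divr_ge0.
have G0 : 1 + G != 0 by rewrite gt_eqF.
have XE : X = c^-1 * ((1 + G) * b).
  have cn0 : c != 0 by rewrite gt_eqF.
  by rewrite -E; apply: (mulfI cn0); rewrite [RHS]mulrA divff// mul1r /c; field.
rewrite XE (_ : Y = fun n => c^-1 * (a * (1 + G) * Y n - q / 2 * - Y n)).
  by apply: cvgM => //; exact: cvg_cst.
apply/funext => n; rewrite (_ : _ - _ = c * Y n); last by rewrite /c; ring.
by rewrite mulrA mulVf ?gt_eqF// mul1r.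
Qed.

Lemma lap_cos_cvg zeta (a : R) : 0 < a ->
  lap a (fun s => \int[p (lam n) s]_x cos (dot zeta x)) @[n --> \oo] -->
  lap a (fun s => \int[Pi s]_x cos (dot zeta x)).
Proof.
move=> a0; have [h _] := diffusion_lap_trig hPi zeta a0.
rewrite (half_quad_diffusion halpha hQS hQ) in h.
have L := rescaled_lap_limit halpha hQS hQ hmu a0 lam1 lam_oo (@smooth3_cos R) zeta.
rewrite cos0 in L.
rewrite (_ : (fun n => _) = fun n => lap a (ridge_ cos zeta (lam n))); last first.
  by apply/funext => n; exact: (lap_rescaled_profile ccos cosB).
apply: (solve_cvg a0 (quad_ge0 Q halpha zeta) h).
rewrite (_ : (fun n => _) = fun n => a * (1 + G) * lap a (ridge_ cos zeta (lam n)) -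
  qd zeta / 2 * lap a (ridge_ (fun y => - cos y) zeta (lam n)))//.
by apply/funext => n; have E := lap_rescaled_ridgeN ccos cosB cosL zeta (lam n) a0; rewrite E.
Qed.

Lemma lap_sin_cvg zeta (a : R) : 0 < a ->
  lap a (fun s => \int[p (lam n) s]_x sin (dot zeta x)) @[n --> \oo] -->
  lap a (fun s => \int[Pi s]_x sin (dot zeta x)).
Proof.
move=> a0; have [_ h] := diffusion_lap_trig hPi zeta a0.
rewrite (half_quad_diffusion halpha hQS hQ) in h.
have L := rescaled_lap_limit halpha hQS hQ hmu a0 lam1 lam_oo (@smooth3_sin R) zeta.
rewrite sin0 in L.
rewrite (_ : (fun n => _) = fun n => lap a (ridge_ sin zeta (lam n))); last first.
  by apply/funext => n; exact: (lap_rescaled_profile csin sinB).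
apply: (solve_cvg a0 (quad_ge0 Q halpha zeta) h).
rewrite (_ : (fun n => _) = fun n => a * (1 + G) * lap a (ridge_ sin zeta (lam n)) -
  qd zeta / 2 * lap a (ridge_ (fun y => - sin y) zeta (lam n)))//.
by apply/funext => n; have E := lap_rescaled_ridgeN csin sinB sinL zeta (lam n) a0; rewrite E.
Qed.

Let trig_bound f : trig f -> exists M : R, forall P : probability (Borel 'rV[R]_N) R,
  `|\int[P]_x f x| <= M.
Proof.
by move=> tf; have cf := trig_Cb tf; case: (cf) => _ [M fM]; exists M => P; exact: Cb_prob_bound.
Qed.

Let trig_measurable (l : R) f : 0 < l -> trig f ->
  measurable_fun `[(0 : R), +oo[ (fun s => \int[p l s]_x f x).
Proof.
move=> l0; elim=> [z|z|g h tg mg th mh|c g tg mg].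
- exact: (measurable_rescaled_profile ccos cosB cosL).
- exact: (measurable_rescaled_profile csin sinB sinL).
- rewrite (_ : (fun s => _) = fun s => \int[p l s]_x g x + \int[p l s]_x h x).
    exact: measurable_funD.
  apply/funext => s; apply: (RintegralD measurableT);
    by apply: Cb_prob_integrable; exact: trig_Cb.
- rewrite (_ : (fun s => _) = fun s => c * \int[p l s]_x g x).
    by apply: measurable_funM => //; exact: measurable_cst.
  by apply/funext => s; apply: (RintegralZl c measurableT);
     apply: Cb_prob_integrable; exact: trig_Cb.
Qed.

(** [p] is specified at each time separately, by its integrals; measurability in time comes from the
    continuity of [rescaled_ridge] for cosines and sines, then by linearity and by pointwise limits
    of trigonometric approximations. *)
Lemma measurable_rescaled (l : R) h : 0 < l -> is_Cb h ->
  measurable_fun `[(0 : R), +oo[ (fun s => \int[p l s]_x h x).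
Proof.
move=> l0 [ch [M hM]]; have [q [tq qM qh]] := trig_approx ch hM.
apply: (measurable_fun_cvg (h := fun n s => \int[p l s]_x q n x)) => [n|s _].
  exact: trig_measurable.
apply: (Cb_prob_cvg (P := p l s) _ qM); last exact: trig_approx_pointwise qh.
by move=> n; exact: trig_Cb.
Qed.

Lemma lap_trig_cvg f (a : R) : 0 < a -> trig f ->
  lap a (fun s => \int[p (lam n) s]_x f x) @[n --> \oo] --> lap a (fun s => \int[Pi s]_x f x).
Proof.
move=> a0; elim=> [z|z|g h tg IHg th IHh|c g tg IHg].
- exact: lap_cos_cvg.
- exact: lap_sin_cvg.
- have [Mg gM] := trig_bound tg; have [Mh hM] := trig_bound th.
  have D (P : R -> narrow R 'rV[R]_N) :
      measurable_fun `[(0 : R), +oo[ (fun s => \int[P s]_x g x) ->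
      measurable_fun `[(0 : R), +oo[ (fun s => \int[P s]_x h x) ->
      lap a (fun s => \int[P s]_x (g x + h x)) =
      lap a (fun s => \int[P s]_x g x) + lap a (fun s => \int[P s]_x h x).
    move=> mg mh; have E := lapD a0 mg (fun s _ => gM (P s)) mh (fun s _ => hM (P s)).
    rewrite -E; apply: eq_lap => s _; apply: (RintegralD measurableT);
      by apply: Cb_prob_integrable; exact: trig_Cb.
  have EPi := D Pi (diffusion_measurable hPi (trig_Cb tg)) (diffusion_measurable hPi (trig_Cb th)).
  rewrite EPi (_ : (fun n => _) = fun n => lap a (fun s => \int[p (lam n) s]_x g x) +
    lap a (fun s => \int[p (lam n) s]_x h x)).
    exact: cvgD IHg IHh.
  by apply/funext => n; apply: (D (p (lam n))); exact: trig_measurable.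
- have [Mg gM] := trig_bound tg.
  have D (P : R -> narrow R 'rV[R]_N) :
      measurable_fun `[(0 : R), +oo[ (fun s => \int[P s]_x g x) ->
      lap a (fun s => \int[P s]_x (c * g x)) = c * lap a (fun s => \int[P s]_x g x).
    move=> mg; have E := lapZ c a0 mg (fun s _ => gM (P s)).
    rewrite -E; apply: eq_lap => s _; apply: (RintegralZl c measurableT);
      by apply: Cb_prob_integrable; exact: trig_Cb.
  have EPi := D Pi (diffusion_measurable hPi (trig_Cb tg)).
  rewrite EPi (_ : (fun n => _) = fun n => c * lap a (fun s => \int[p (lam n) s]_x g x)).
    by apply: cvgM; [exact: cvg_cst|exact: IHg].
  by apply/funext => n; apply: (D (p (lam n))); exact: trig_measurable.
Qed.

Let csat := smooth3_continuous (@smooth3_saturate R).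
Let satB (y : R) : `|saturate y| <= 72.
Proof. by case: (@smooth3_saturate R) => _ _ /(_ y)[]. Qed.
Let quadZ (c : R) zeta : qd (c *: zeta) = c ^+ 2 * qd zeta.
Proof.
have Z i : (c *: zeta) 0 i = c * zeta 0 i by rewrite mxE.
rewrite /quad !(D0_quadratic halpha hQS hQ) mulr_sumr; apply: eq_bigr => i _.
rewrite mulr_sumr; apply: eq_bigr => j _; rewrite !Z; ring.
Qed.

(* Tightness, from the limit of the profile y^2 / (1 + y^2), which vanishes at 0. *)
Lemma lap_saturate_small zeta (a e : R) : 0 < a -> 0 < e -> exists2 r : R, 0 < r &
  \forall n \near \oo,
    lap a (fun s => \int[p (lam n) s]_x saturate (dot (r^-1 *: zeta) x)) <= e.
Proof.
move=> a0 e0; set C := qd zeta / 2 * (72 / a) / (a * (1 + G)).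
have aG : 0 < a * (1 + G) by rewrite mulr_gt0.
have C0 : 0 <= C.
  by rewrite /C !mulr_ge0 ?invr_ge0 ?(ltW aG) ?(ltW a0)// (quad_ge0 Q halpha).
have q0 : 0 <= 2 * C / e by apply: divr_ge0; [exact: mulr_ge0|exact: ltW].
(* [quad] is homogeneous of degree 2, so dilating by [r] leaves the bound [e / 2 + r^-1 ^+ 2 * C];
   this [r] is at least 1 and makes the second term at most [e / 2]. *)
exists (1 + 2 * C / e) => [|]; set r := 1 + _; first by rewrite ltr_pwDl.
have r1 : 1 <= r by rewrite lerDl.
have r0 : 0 < r by exact: lt_le_trans r1.
have L := rescaled_lap_limit halpha hQS hQ hmu a0 lam1 lam_oo (@smooth3_saturate R) (r^-1 *: zeta).
rewrite saturate0 mulr0 in L.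
have e20 : 0 < a * (1 + G) * (e / 2) by rewrite mulr_gt0// divr_gt0.
have /cvgrPdist_le/(_ _ e20) := L; apply: filterS => n.
rewrite (lap_rescaled_profile csat satB)//.
have [_ _ hB hL] := @smooth3_saturate R.
set k2 := @saturate2 R in hL *; move=> h.
have k2c := smooth3_continuous2 (@smooth3_saturate R).
have k2B y : `|k2 y| <= 72 by case: (hB y).
have := lap_norm_le a0 (measurable_rescaled_ridge k2c k2B hL (r^-1 *: zeta) (lam n))
  (fun s _ => rescaled_ridge_bound Q alpha alpha_oo mu k2c k2B (r^-1 *: zeta) (lam n) s).
move: h; rewrite sub0r normrN quadZ.
set x := lap a _; set y := lap a _ => h hy.
have {}h : a * (1 + G) * x <= a * (1 + G) * (e / 2) + r^-1 ^+ 2 * qd zeta / 2 * y.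
  by move: (le_trans (ler_norm _) h); lra.
have hr : r^-1 ^+ 2 * C <= e / 2.
  have h1 : r^-1 ^+ 2 * C <= r^-1 * C.
    rewrite ler_wpM2r// expr2 ler_piMl ?invr_ge0 ?(ltW r0)//.
    by rewrite invf_le1.
  apply: (le_trans h1); rewrite mulrC ler_pdivrMr// /r mulrDr mulr1.
  rewrite (_ : e / 2 * (2 * C / e) = C); last by field; rewrite gt_eqF.
  by rewrite lerDr divr_ge0 ?(ltW e0).
have hq : r^-1 ^+ 2 * qd zeta / 2 * y <= a * (1 + G) * (r^-1 ^+ 2 * C).
  rewrite (_ : a * (1 + G) * (r^-1 ^+ 2 * C) = r^-1 ^+ 2 * qd zeta / 2 * (72 / a)); last first.
    by rewrite /C; field; rewrite !gt_eqF.
  rewrite ler_wpM2l ?(le_trans (ler_norm y))//.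
  by rewrite divr_ge0// mulr_ge0 ?sqr_ge0// (quad_ge0 Q halpha).
have : a * (1 + G) * x <= a * (1 + G) * e.
  rewrite (le_trans h)// (_ : a * (1 + G) * e = a * (1 + G) * (e / 2) + a * (1 + G) * (e / 2)); last by field.
  by rewrite lerD2l (le_trans hq)// ler_wpM2l// ltW.
by rewrite ler_pM2l.
Qed.

End convergence.

(** * Time densities *)

Section weierstrass.
Context {R : realType}.

(** The case of one variable and [L = 1] of [mbern_error], after mapping [[-1, 1]] onto [[0, 1]]:
    the points [grid 1 n j] become j/n. *)
Lemma weierstrass_unit (psi : R -> R) (M e : R) : continuous psi ->
  (forall x, `|psi x| <= M) -> 0 < e ->
  exists n F, forall u, 0 <= u <= 1 -> `|bern n u F - psi u| <= e.
Proof.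
move=> cpsi psiM e0.
pose h (y : 'rV[R]_1) : R := psi ((y 0 0 + 1) / 2).
have ch : continuous h.
  apply: (cts_comp cpsi); apply: ctsM; last exact: cts_cst.
  by apply: ctsD; [exact: coord_continuous|exact: cts_cst].
have e20 : 0 < e / 2 by rewrite divr_gt0.
have [d d0 hd] := cube_uniform_continuity 1 ch e20.
have M0 : 0 <= M by apply: le_trans (psiM 0).
pose C := 2 * M / d ^+ 2.
have d20 : 0 < d ^+ 2 by rewrite exprn_gt0.
have C0 : 0 <= C by rewrite divr_ge0 ?mulr_ge0// ltW.
(* The variance term [C * (4 / n%:R)] is then at most [e / 2]. *)
pose n := (Num.truncn (8 * C / e)).+1.
exists n, (fun j => h (setc 0 0 (grid 1 n j))) => u u01.
have -> : bern n u (fun j => h (setc 0 0 (grid 1 n j))) =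
  mbern 1 n (fun=> u) [:: 0] h 0 by [].
pose t : 'rV[R]_1 := \row_j (- 1 + 2 * 1 * u).
have t0 i : t 0 i = - 1 + 2 * 1 * u by rewrite mxE.
have cubet : cube 1 t by move=> i; rewrite t0; have /andP[? ?] := u01; apply/andP; split; lra.
have ht : h t = psi u by rewrite /h t0; congr psi; field.
have bnd y : cube 1 y -> `|h y - psi u| <= e / 2 + C * \sum_i (y 0 i - t 0 i) ^+ 2.
  move=> cy; rewrite big_ord1; have [yt|yt] := ltP `|y 0 0 - t 0 0| d.
    have hyt : `|y - t| < d.
      apply: rV_norm_lt => // i; rewrite !ord1 (_ : (y - t) 0 0 = y 0 0 - t 0 0)//.
      by rewrite mxE; congr (_ + _); rewrite mxE.
    by rewrite -ht (le_trans (hd y t cy cubet hyt))// lerDl mulr_ge0// sqr_ge0.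
  apply: (@le_trans _ _ (2 * M)).
    rewrite (le_trans (ler_normB _ _))// (_ : 2 * M = M + M); last by ring.
    by rewrite lerD//; exact: psiM.
  have h1 : d ^+ 2 <= (y 0 0 - t 0 0) ^+ 2.
    rewrite -[leRHS](real_normK (num_real _)) lerXn2r// nnegrE//; exact: ltW.
  have : C * d ^+ 2 <= C * (y 0 0 - t 0 0) ^+ 2 by rewrite ler_wpM2l.
  rewrite /C mulrVK ?unitfE ?gt_eqF// => h2; lra.
have cube0 : cube 1 (0 : 'rV[R]_1) by move=> i; rewrite mxE; apply/andP; split; lra.
have n0 : (0 < n)%N by [].
have H := mbern_error (@ler01 R) n0 C0 (fun _ => u01) (isT : uniq [:: (0 : 'I_1)]) t0 bnd cube0.
apply: (le_trans H); rewrite big1 => [|i]; last by rewrite !ord1 inE eqxx.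
rewrite add0r /= mul1r expr1n mulr1.
have nC : 8 * C / e < n%:R by exact: truncnS_gt.
have np : 0 < n%:R :> R by rewrite ltr0n.
have : C * (4 / n%:R) <= e / 2.
  rewrite mulrA ler_pdivrMr//.
  have : 8 * C < n%:R * e by rewrite -ltr_pdivrMr.
  by move=> h8; rewrite (_ : e / 2 * n%:R = n%:R * e / 2); [lra|ring].
by move=> h9; lra.
Qed.

End weierstrass.

Section bern_regularity.
Context {R : realType}.

Lemma continuous_bern n (F : nat -> R) : continuous (fun u : R => bern n u F).
Proof.
elim: n F => [|n IH] F /=; first exact: cts_cst.
have cid : continuous (fun u : R => u) by move=> u; exact: cvg_id.
apply: ctsD; apply: ctsM => //.
by apply: ctsB => //; exact: cts_cst.
Qed.

Lemma bern_bounded n (F : nat -> R) : exists2 C, 0 <= C &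
  forall u, 0 <= u <= 1 -> `|bern n u F| <= C.
Proof.
exists (\sum_(j < n.+1) `|F j|); first by apply: sumr_ge0.
move=> u u01; have hF j : (j <= n)%N -> `|F j| <= \sum_(j < n.+1) `|F j|.
  move=> jn; rewrite (bigD1 (Ordinal (jn : (j < n.+1)%N)))//= lerDl.
  by apply: sumr_ge0.
set C := \sum_(j < _) _ in hF *; rewrite ler_norml.
apply/andP; split; [rewrite -(bern_cst n u (- C))|rewrite -[leRHS](bern_cst n u C)];
  by apply: bern_le => // j /hF; rewrite ler_norml => /andP[].
Qed.

End bern_regularity.

(** * From Laplace transforms to integrals over bounded sets of times *)

Section laplace_density.
Context {R : realType}.
Local Notation leb := (@lebesgue_measure R).
Variables (g : nat -> R -> R) (g0 : R -> R) (M : R).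
Hypothesis mg : forall n, measurable_fun `[(0 : R), +oo[ (g n).
Hypothesis mg0 : measurable_fun `[(0 : R), +oo[ g0.
Hypothesis gM : forall n (s : R), 0 <= s -> `|g n s| <= M.
Hypothesis g0M : forall s : R, 0 <= s -> `|g0 s| <= M.
Hypothesis lap_g : forall a : R, 0 < a -> lap a (g n) @[n --> \oo] --> lap a g0.

Let e01 (s : R) : 0 <= s -> 0 <= expR (- s) <= 1.
Proof. by move=> s0; rewrite expR_ge0 -expR0 ler_expR oppr_le0. Qed.

Let cexpN : continuous (fun s : R => expR (- s)).
Proof.
apply: cts_comp; first exact: continuous_expR.
by apply: ctsN => s; exact: cvg_id.
Qed.

Let mM (psi f : R -> R) : continuous psi -> measurable_fun `[(0 : R), +oo[ f ->
  measurable_fun `[(0 : R), +oo[ (fun s => psi (expR (- s)) * f s).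
Proof.
move=> cp mf; apply: measurable_funM => //.
by apply: measurable_funTS; apply: continuous_measurable_fun; exact: cts_comp.
Qed.

Let bM (psi f : R -> R) (C : R) : (forall u, 0 <= u <= 1 -> `|psi u| <= C) ->
  (forall s : R, 0 <= s -> `|f s| <= M) ->
  forall s : R, 0 <= s -> `|psi (expR (- s)) * f s| <= C * M.
Proof. by move=> hp hf s s0; rewrite normrM ler_pM ?hp ?hf// e01. Qed.

(** Multiplication by [expR (- s)] raises the parameter of the transform by 1. The recursion on the
    tosses therefore involves the parameters [a] and [a + 1], and [a] has to vary in the
    induction. *)
Let lap_bern m F (a : R) : 0 < a ->
  lap a (fun s => bern m (expR (- s)) F * g n s) @[n --> \oo] -->
  lap a (fun s => bern m (expR (- s)) F * g0 s).
Proof.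
elim: m F a => [|m IH] F a a0 /=.
  have E0 := lapZ (F 0%N) a0 mg0 g0M; rewrite E0.
  rewrite (_ : (fun n => _) = fun n => F 0%N * lap a (g n)).
    by apply: cvgM; [exact: cvg_cst|exact: lap_g].
  by apply/funext => n; exact: (lapZ (F 0%N) a0 (mg n) (fun s => @gM n s)).
have [C1 C10 hC1] := bern_bounded m (F \o S); have [C2 C20 hC2] := bern_bounded m F.
have a10 : 0 < a + 1 by rewrite addr_gt0.
have D (f : R -> R) : measurable_fun `[(0 : R), +oo[ f -> (forall s : R, 0 <= s -> `|f s| <= M) ->
    lap a (fun s => (expR (- s) * bern m (expR (- s)) (F \o S) +
      (1 - expR (- s)) * bern m (expR (- s)) F) * f s) =
    lap (a + 1) (fun s => bern m (expR (- s)) (F \o S) * f s)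
    - lap (a + 1) (fun s => bern m (expR (- s)) F * f s)
    + lap a (fun s => bern m (expR (- s)) F * f s).
  move=> mf fM.
  have c1 := @continuous_bern R m (F \o S); have c2 := @continuous_bern R m F.
  have m1 := mM c1 mf; have m2 := mM c2 mf.
  have b1 := bM hC1 fM; have b2 := bM hC2 fM.
  have B := lapB a10 m1 b1 m2 b2; rewrite -B.
  have E (h : R -> R) : lap (a + 1) h = lap a (fun s => expR (- s) * h s).
    apply: eq_Rintegral => s _; rewrite mulrA; congr (_ * _).
    by rewrite -expRD; congr expR; ring.
  rewrite E.
  have m3 : measurable_fun `[(0 : R), +oo[ (fun s => expR (- s) *
      (bern m (expR (- s)) (F \o S) * f s - bern m (expR (- s)) F * f s)).
    apply: (@mM id) => //; first by move=> s; exact: cvg_id.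
    exact: measurable_funB.
  have b3 (s : R) : 0 <= s -> `|expR (- s) *
      (bern m (expR (- s)) (F \o S) * f s - bern m (expR (- s)) F * f s)| <= C1 * M + C2 * M.
    move=> s0; rewrite normrM -[leRHS]mul1r; have /andP[h1 h2] := e01 s0.
    by rewrite ler_pM// ?(ger0_norm h1)// (le_trans (ler_normB _ _))// lerD ?b1 ?b2.
  have DD := lapD a0 m3 b3 m2 b2; rewrite -DD; apply: eq_lap => s _; ring.
have D0 := D g0 mg0 g0M; rewrite D0.
rewrite (_ : (fun n => _) = fun n =>
    lap (a + 1) (fun s => bern m (expR (- s)) (F \o S) * g n s)
    - lap (a + 1) (fun s => bern m (expR (- s)) F * g n s)
    + lap a (fun s => bern m (expR (- s)) F * g n s)).
  apply: cvgD; last exact: IH.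
  by apply: cvgB; exact: IH.
by apply/funext => n; exact: (D (g n) (mg n) (fun s => @gM n s)).
Qed.

Let M0 : 0 <= M. Proof. exact: le_trans (g0M (lexx 0)). Qed.

Let lap_psi (psi : R -> R) (C : R) : continuous psi -> (forall x, `|psi x| <= C) ->
  lap 1 (fun s => psi (expR (- s)) * g n s) @[n --> \oo] -->
  lap 1 (fun s => psi (expR (- s)) * g0 s).
Proof.
move=> cpsi psiC; apply/cvgrPdist_le => e e0.
(* The Weierstrass error gets multiplied by [M]; [M + 1] keeps the denominator positive when
   [M = 0]. *)
have d0 : 0 < e / (3 * (M + 1)) by rewrite divr_gt0// mulr_gt0// ltr_wpDl.
have [m [F hF]] := weierstrass_unit cpsi psiC d0.
have [C1 C10 hC1] := bern_bounded m F.
have close (f : R -> R) : measurable_fun `[(0 : R), +oo[ f ->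
    (forall s : R, 0 <= s -> `|f s| <= M) ->
    `|lap 1 (fun s => psi (expR (- s)) * f s) -
      lap 1 (fun s => bern m (expR (- s)) F * f s)| <= e / 3.
  move=> mf fM; rewrite -[leRHS]divr1.
  apply: (lap_dist_le ltr01 (mM cpsi mf) (bM (fun u _ => psiC u) fM)
    (mM (@continuous_bern R m F) mf) (bM hC1 fM)) => s s0.
  rewrite -mulrBl normrM distrC.
  have h1 := hF _ (e01 s0); have h2 := fM _ s0.
  apply: (le_trans (ler_pM _ _ h1 h2)) => //.
  rewrite mulrAC ler_pdivrMr; last by rewrite mulr_gt0// ltr_wpDl.
  rewrite (_ : e / 3 * (3 * (M + 1)) = e * M + e); last by field.
  by rewrite lerDl ltW.
have e30 : 0 < e / 3 by rewrite divr_gt0.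
have /cvgrPdist_le/(_ _ e30) := @lap_bern m F 1 ltr01; apply: filterS => n h.
have h1 := close g0 mg0 g0M; have h2 := close (g n) (mg n) (fun s => @gM n s).
move: h h1 h2; set x := lap 1 _; set y := lap 1 _; set z := lap 1 _; set w := lap 1 _.
rewrite !ler_norml => /andP[? ?] /andP[? ?] /andP[? ?]; apply/andP; split; lra.
Qed.

(** Continuous functions are dense in L1 of [[0, T[]. Clipping to [[0, 1]] brings them no further
    from an indicator, and a steep ramp, equal to 1 except near [T], forces the value 0 at [T] at an
    arbitrarily small cost. *)
Let approx (B : set R) (T e : R) : 0 < e -> measurable B -> B `<=` `[0, T[ ->
  exists c : R -> R, [/\ continuous c, forall s, 0 <= c s <= 1, c T = 0 &
    \int[leb]_(s in `[0, T[) `|\1_B s - c s| <= e].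
Proof.
move=> e0 mB BT.
have Efin : (leb `[(0 : R)%R, T[%classic < +oo)%E.
  by rewrite lebesgue_measure_itv /=; case: ifP => _; rewrite ?ltry// -EFinB ltry.
have i1 (c : R) : leb.-integrable `[0, T[ (EFin \o (fun _ : R => c)).
  apply: measurable_bounded_integrable => //.
  exact: bounded_cst.
have mI : measurable_fun `[(0 : R), T[ (\1_B : R -> R).
  exact: measurable_indic.
have I01 s : 0 <= (\1_B s : R) <= 1 by rewrite indicE; case: (_ \in _); rewrite lexx ler01.
have iB : leb.-integrable `[0, T[ (EFin \o (\1_B : R -> R)).
  apply: (@integrable_bound _ _ _ leb `[0, T[ _ (fun=> 1)) => // s _.
  by have /andP[h1 h2] := I01 s; rewrite ger0_norm.
have [c_ [cc ic hc]] := approximation_continuous_integrable (measurable_itv `[0, T[) Efin iB.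
have e20 : 0 < e / 2 by rewrite divr_gt0.
have [j hj] : exists j, \int[leb]_(s in `[0, T[) `|\1_B s - c_ j s| <= e / 2.
  have h : \int[leb]_(s in `[0, T[) `|\1_B s - c_ n s| @[n --> \oo] --> (0 : R).
    exact: fine_cvg hc.
  have /cvgrPdist_le/(_ _ e20) [j _ /(_ j (leqnn j))] := h.
  by rewrite sub0r normrN => h2; exists j; rewrite (le_trans _ h2)// ler_norm.
pose cl (x : R) := Num.max 0 (Num.min 1 x).
have cl01 x : 0 <= cl x <= 1.
  by rewrite /cl le_max lexx /= ge_max ler01 ge_min lexx.
have ccl : continuous cl.
  apply: cts_max; first exact: cts_cst.
  by apply: cts_min; [exact: cts_cst|move=> x; exact: cvg_id].
have cl_dist (b x : R) : 0 <= b <= 1 -> `|b - cl x| <= `|b - x|.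
  move=> /andP[b0 b1]; rewrite /cl.
  case: (leP 1 x) => h1; first rewrite max_r ?ler01//.
    by rewrite ler0_norm ?subr_le0// ler0_norm ?subr_le0 ?(le_trans b1)//; lra.
  case: (leP 0 x) => h2 //.
  by rewrite ger0_norm ?subr0// ger0_norm; lra.
pose th m (s : R) := cl (m%:R * (T - s)).
have cid : continuous (fun s : R => s) by move=> s; exact: cvg_id.
have cth m : continuous (th m).
  apply: (cts_comp ccl); apply: ctsM; first exact: cts_cst.
  by apply: ctsB => //; exact: cts_cst.
have th1 s : s < T -> th m s @[m --> \oo] --> (1 : R).
  move=> sT; have th_eq : \forall m \near \oo, 1 = th m s.
    near=> m; rewrite /th /cl min_l ?max_r ?ler01//.
    rewrite -ler_pdivrMr ?subr_gt0//; near: m; exact: nbhs_infty_ger.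
  by apply: (cvg_trans (near_eq_cvg th_eq)); exact: cvg_cst.
pose cj m s := cl (c_ j s) * th m s.
have ccj m : continuous (cj m) by apply: ctsM => //; exact: cts_comp.
have cj01 m s : 0 <= cj m s <= 1.
  have /andP[h1 h2] := cl01 (c_ j s); have /andP[h3 h4] := cl01 (m%:R * (T - s)).
  by rewrite /cj mulr_ge0//= -[leRHS]mulr1 ler_pM.
have mabs (f : R -> R) : continuous f -> measurable_fun `[(0 : R), T[ (fun s => `|\1_B s - f s|).
  move=> cf; have mf : measurable_fun `[(0 : R), T[ (fun s => \1_B s - f s).
    apply: measurable_funB => //.
    by apply: measurable_funTS; exact: continuous_measurable_fun.
  exact: (measurableT_comp (@normr_measurable R setT) mf).
have two (b x : R) : 0 <= b <= 1 -> 0 <= x <= 1 -> `|b - x| <= 1.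
  by move=> /andP[? ?] /andP[? ?]; rewrite ler_norml; apply/andP; split; lra.
have L : \int[leb]_(s in `[0, T[) `|\1_B s - cj m s| @[m --> \oo] -->
    \int[leb]_(s in `[0, T[) `|\1_B s - cl (c_ j s)|.
  apply: (@Rdominated_cvg _ _ _ leb `[0, T[ (fun m s => `|\1_B s - cj m s|) _ (fun=> 1)) => //.
  - by move=> m; exact: mabs.
  - move=> s /=; rewrite in_itv /= => /andP[_ sT].
    apply: cvg_norm; apply: cvgB; first exact: cvg_cst.
    rewrite -[X in _ --> X]mulr1; apply: cvgM; [exact: cvg_cst|exact: th1].
  - by move=> m s _; rewrite normr_id; exact: two.
have lim_le : \int[leb]_(s in `[0, T[) `|\1_B s - cl (c_ j s)| <= e / 2.
  apply: le_trans hj; apply: le_Rintegral => //.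
  - apply: (@integrable_bound _ _ _ leb `[0, T[ _ (fun=> 1)) => //.
      by apply: mabs; exact: cts_comp.
    by move=> s _; rewrite normr_id; exact: two.
  - have := integrable_norm (@integrableB _ _ _ leb `[0, T[ (measurable_itv _) _ _ iB (ic j)).
    by apply: eq_integrable => // s _.
  - by move=> s _; exact: cl_dist.
have /cvgrPdist_le/(_ _ e20) [m _ /(_ m (leqnn m)) hm] := L.
exists (cj m); split => //.
  by rewrite /cj (_ : th m T = 0) ?mulr0// /th subrr mulr0 /cl min_r ?ler01// max_l.
have tri (u w : R) : `|w - u| <= e / 2 -> w <= e / 2 -> u <= e.
  by rewrite ler_norml => /andP[? ?] ?; lra.
exact: tri hm lim_le.
Unshelve. all: by end_near.
Qed.

(* A function [c] on [0, T] vanishing at [T] reads e^(-s) psi (e^(-s)) with [psi]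
   continuous; Weierstrass then reduces to Laplace transforms at the integers. *)
Lemma laplace_density (B : set R) (T : R) : measurable B -> B `<=` `[0, T[ ->
  \int[leb]_(s in B) g n s @[n --> \oo] --> \int[leb]_(s in B) g0 s.
Proof.
move=> mB BT; apply/cvgrPdist_le => e e0.
have d0 : 0 < e / (3 * (M + 1)) by rewrite divr_gt0// mulr_gt0// ltr_wpDl.
have [c [cc c01 cT hc]] := approx d0 mB BT.
(* Clamping keeps the logarithm continuous. At times beyond [T] it freezes [psi] at a multiple of
   [c T = 0], and dividing by [v u] in [psi] undoes the weight of [lap 1]. *)
pose v (u : R) := Num.min 1 (Num.max u (expR (- T))).
have cid : continuous (fun s : R => s) by move=> s; exact: cvg_id.
have cv : continuous v.
  apply: cts_min; first exact: cts_cst.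
  by apply: cts_max => //; exact: cts_cst.
have [T0|T0] := leP 0 T; last first.
  have B0 : B = set0.
    apply/seteqP; split => // s /BT; rewrite /= in_itv /= => /andP[h1 h2].
    by have := lt_trans (le_lt_trans h1 h2) T0; rewrite ltxx.
  by near=> n; rewrite B0 !Rintegral_set0 subrr normr0 ltW.
have eT1 : expR (- T) <= 1 by case/andP: (e01 T0).
have v0 u : expR (- T) <= v u.
  by rewrite /v le_min eT1 le_max lexx orbT.
have vpos u : 0 < v u by apply: lt_le_trans (v0 u); exact: expR_gt0.
pose psi u := c (- ln (v u)) / v u.
have cpsi : continuous psi.
  apply: ctsM.
    apply: (cts_comp cc); apply: ctsN => u.
    exact: (continuous_comp (cv u) (continuous_ln (vpos u))).
  move=> u; apply: cvgV; first by rewrite gt_eqF.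
  exact: cv.
have psiC x : `|psi x| <= expR T.
  have /andP[h1 h2] := c01 (- ln (v x)).
  rewrite normrM (ger0_norm h1) normfV (gtr0_norm (vpos x)) -[leRHS]mul1r ler_pM ?invr_ge0 ?(ltW (vpos x))//.
  by rewrite -[leRHS]invrK -expRN lef_pV2 ?posrE ?expR_gt0.
have key (f : R -> R) : lap 1 (fun s => psi (expR (- s)) * f s) =
    \int[leb]_(s in `[0, T[) (c s * f s).
  have -> : `[0, T[%classic = `[0, +oo[ `&` `]-oo, T[%classic :> set R.
    apply/seteqP; split => s /=; rewrite !in_itv /= ?andbT.
      by move=> /andP[].
    by move=> [-> ->].
  rewrite Rintegral_mkcondr; apply: eq_Rintegral => s; rewrite inE /= in_itv /= andbT => s0.
  rewrite /patch; have [sT|Ts] := ltP s T.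
    rewrite mem_set /=; last by rewrite in_itv.
    have vs : v (expR (- s)) = expR (- s).
      by rewrite /v max_l ?min_r ?ler_expR ?lerN2 ?(ltW sT)//; case/andP: (e01 s0).
    rewrite /psi vs expRK opprK mulN1r; field.
    by rewrite gt_eqF ?expR_gt0.
  rewrite memNset /=; last by rewrite in_itv /= => h; move: (lt_le_trans h Ts); rewrite ltxx.
  have vs : v (expR (- s)) = expR (- T).
    by rewrite /v max_r ?min_r ?ler_expR ?lerN2.
  by rewrite /psi vs expRK opprK cT mul0r mul0r mulr0.
have BE (f : R -> R) : \int[leb]_(s in B) f s = \int[leb]_(s in `[0, T[) (\1_B s * f s).
  rewrite -[in LHS](setIidr BT) Rintegral_mkcondr; apply: eq_Rintegral => s _.
  by rewrite /patch indicE; case: (_ \in _); rewrite ?mul1r ?mul0r.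
have sub : `[0, T[ `<=` `[(0 : R), +oo[.
  by move=> x /=; rewrite !in_itv /= andbT => /andP[].
have Efin : (leb `[(0 : R)%R, T[%classic < +oo)%E.
  by rewrite lebesgue_measure_itv /=; case: ifP => _; rewrite ?ltry// -EFinB ltry.
have i1 (r : R) : leb.-integrable `[0, T[ (EFin \o (fun _ : R => r)).
  apply: measurable_bounded_integrable => //.
  exact: bounded_cst.
have mI : measurable_fun `[(0 : R), T[ (\1_B : R -> R) by exact: measurable_indic.
have I1 s : `|(\1_B s : R)| <= 1 by rewrite indicE; case: (_ \in _); rewrite ?normr0 ?normr1 ?ler01.
have c1 s : `|c s| <= 1 by have /andP[h1 h2] := c01 s; rewrite ger0_norm.
have mc : measurable_fun `[(0 : R), T[ c.
  by apply: measurable_funTS; exact: continuous_measurable_fun.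
have close (f : R -> R) : measurable_fun `[(0 : R), +oo[ f ->
    (forall s : R, 0 <= s -> `|f s| <= M) ->
    `|\int[leb]_(s in B) f s - lap 1 (fun s => psi (expR (- s)) * f s)| <= e / 3.
  move=> mf fM; rewrite key BE.
  have mfT : measurable_fun `[(0 : R), T[ f by apply: measurable_funS sub mf.
  have fMT s : s \in `[0, T[ -> `|f s| <= M.
    by rewrite in_itv /= => /andP[s0 _]; exact: fM.
  have ib (h : R -> R) : measurable_fun `[(0 : R), T[ h -> (forall s, `|h s| <= 1) ->
      leb.-integrable `[0, T[ (EFin \o (fun s => h s * f s)).
    move=> mh h1; apply: (@integrable_bound _ _ _ leb `[0, T[ _ (fun=> M)) => //.
      exact: measurable_funM.
    by move=> s sT; rewrite normrM -[leRHS]mul1r ler_pM// fMT.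
  have Bq := @RintegralB _ _ _ leb `[0, T[ _ _ (measurable_itv _) (ib _ mI I1) (ib _ mc c1).
  have {Bq} <- := Bq.
  have iabs : leb.-integrable `[0, T[ (EFin \o (fun s => `|\1_B s - c s|)).
    apply: (@integrable_bound _ _ _ leb `[0, T[ _ (fun=> 1 + 1)) => //.
    - have mh : measurable_fun `[(0 : R), T[ (fun s => \1_B s - c s) by exact: measurable_funB.
      exact: (measurableT_comp (@normr_measurable R setT) mh).
    - by move=> s _; rewrite normr_id (le_trans (ler_normB _ _))// lerD.
  apply: (@le_trans _ _ (\int[leb]_(s in `[0, T[) (M * `|\1_B s - c s|))).
    apply: le_normr_Rintegral_bound => //.
    - by apply: measurable_funB; apply: measurable_funM.
    - exact: (@integrableZl _ _ _ leb `[0, T[ (measurable_itv _) M _ iabs).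
    - by move=> s sT; rewrite -mulrBl normrM mulrC ler_wpM2r// fMT.
  have Z := @RintegralZl _ _ _ leb `[0, T[ _ M (measurable_itv _) iabs.
  have {Z} -> := Z.
  apply: (le_trans (ler_wpM2l M0 hc)).
  rewrite mulrCA ler_wpM2l ?(ltW e0)// invfM mulrCA -[leRHS]mulr1 ler_wpM2l//.
  by rewrite ler_pdivrMr ?mul1r ?lerDl// ltr_wpDl.
have e30 : 0 < e / 3 by rewrite divr_gt0.
have /cvgrPdist_le/(_ _ e30) := lap_psi cpsi psiC; apply: filterS => n h.
have h1 := close g0 mg0 g0M; have h2 := close (g n) (mg n) (fun s => @gM n s).
move: h h1 h2; set x := lap 1 _; set y := lap 1 _; set z := Rintegral _ _ _; set w := Rintegral _ _ _.
rewrite !ler_norml => /andP[? ?] /andP[? ?] /andP[? ?]; apply/andP; split; lra.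
Unshelve. all: by end_near.
Qed.

End laplace_density.

Lemma lap_sum {R : realType} (a M : R) (I : Type) (r : seq I) (F : I -> R -> R) : 0 < a ->
  (forall i, measurable_fun `[(0 : R), +oo[ (F i)) ->
  (forall i s, 0 <= s -> `|F i s| <= M) ->
  lap a (fun s => \sum_(i <- r) F i s) = \sum_(i <- r) lap a (F i).
Proof.
move=> a0 mF FM.
have i1 i := lap_integrable a0 (mF i) (FM i).
have S := @Rintegral_sum _ _ _ (@lebesgue_measure R) `[0, +oo[ _ r _ (measurable_itv _) i1.
apply: etrans S; apply: eq_Rintegral => s _; exact: mulr_sumr.
Qed.

(** * Convergence of Laplace transforms for bounded continuous functions *)

Section Cb_convergence.
Context {R : realType} {N : nat}.
Notation X := (R * 'rV[R]_N)%type.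
Context (Q : probability (Borel X) R).
Variables (alpha : R -> R -> R) (alpha_oo : R -> R).
Variables (u0 mu Pi : R -> narrow R 'rV[R]_N) (p : R -> R -> narrow R 'rV[R]_N).
Hypothesis halpha : standing_alpha alpha alpha_oo.
Hypothesis hQS : Q (@strip R N) = 1%E.
Hypothesis hQ : standing_Q Q.
Hypothesis hmu : delay_solution Q alpha u0 mu.
Hypothesis hp : rescaled (Hshift Q alpha alpha_oo) mu p.
Hypothesis hPi : diffusion_solution ((1 + Gam Q alpha_oo)^-1 *: D0 Q alpha_oo) Pi.
Variable lam : R^nat.
Hypothesis lam1 : forall n, 1 <= lam n.
Hypothesis lam_oo : lam n @[n --> \oo] --> +oo.
Let lam0 n : 0 < lam n. Proof. exact: lt_le_trans (lam1 n). Qed.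

Let mp n h : is_Cb h -> measurable_fun `[(0 : R), +oo[ (fun s => \int[p (lam n) s]_x h x).
Proof. exact: (measurable_rescaled halpha hQS hQ hmu hp (lam0 n)). Qed.

Let satB (y : R) : `|saturate y| <= 72.
Proof. by case: (@smooth3_saturate R) => _ _ /(_ y)[]. Qed.

Let sat_Cb (zeta : 'rV[R]_N) : is_Cb (fun x => saturate (dot zeta x)).
Proof.
split; last by exists 72 => x.
by apply: cts_comp; [exact: smooth3_continuous (@smooth3_saturate R)|exact: continuous_dot].
Qed.

Lemma lap_rescaled_cvg h (a : R) : 0 < a -> is_Cb h ->
  lap a (fun s => \int[p (lam n) s]_x h x) @[n --> \oo] --> lap a (fun s => \int[Pi s]_x h x).
Proof.
move=> a0 [ch [M hM]]; have hCb : is_Cb h by split => //; exists M.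
have M0 : 0 <= M by apply: le_trans (hM 0).
have [q [tq qM hq]] := trig_approx ch hM.
have qCb m : is_Cb (q m) by exact: trig_Cb.
have bnd f (P : R -> narrow R 'rV[R]_N) C : is_Cb f -> (forall x, `|f x| <= C) ->
    forall s : R, 0 <= s -> `|\int[P s]_x f x| <= C.
  by move=> fCb fC s _; exact: Cb_prob_bound.
have LPi : lap a (fun s => \int[Pi s]_x q m x) @[m --> \oo] --> lap a (fun s => \int[Pi s]_x h x).
  apply: (@lap_cvg _ a (fun m s => \int[Pi s]_x q m x) _ M) => //.
  - by move=> m; exact: (diffusion_measurable hPi (qCb m)).
  - by move=> m; exact: bnd.
  - move=> s _; apply: (Cb_prob_cvg (P := Pi s) qCb qM).
    exact: trig_approx_pointwise hq.
apply/cvgrPdist_le => e e0.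
have e60 : 0 < e / 6 by rewrite divr_gt0.
have d0 : 0 < e / 6 * a by rewrite mulr_gt0.
(* Chosen so that [4 * M * (N%:R * (e / 6 / W))] is at most [e / 6]; the added 1 keeps [W]
   positive. *)
pose W := 4 * M * N%:R + 1.
have W0 : 0 < W by rewrite ltr_wpDl ?mulr_ge0.
have w0 : 0 < e / 6 / W by rewrite divr_gt0.
pose e_ i : 'rV[R]_N := delta_mx 0 i.
have /choice[r hr] : forall i, exists r : R, 0 < r /\ \forall n \near \oo,
    lap a (fun s => \int[p (lam n) s]_x saturate (dot (r^-1 *: e_ i) x)) <= e / 6 / W.
  move=> i; have [r r0 h1] := lap_saturate_small halpha hQS hQ hmu hp lam1 lam_oo (e_ i) a0 w0.
  by exists r.
have r0 i : 0 < r i by case: (hr i).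
(* A common radius: the sum dominates each [r i]. *)
pose rr := \sum_i r i.
have rle i : r i <= rr.
  rewrite /rr (bigD1 i)//= lerDl; apply: sumr_ge0 => j _; exact: ltW.
have [m0 hm0] := hq _ rr d0.
have /cvgrPdist_le/(_ _ e60) [m1 _ hm1] := LPi.
pose m := maxn m0 m1.
have c1 := hm1 m (leq_maxr _ _).
(* Outside the box some coordinate exceeds its [r i], and there [2 * saturate] is at least 1; the
   trivial bound [2 * M] is thus at most [4 * M] times the sum. *)
have close x : `|q m x - h x| <= e / 6 * a + 4 * M * \sum_i saturate (dot ((r i)^-1 *: e_ i) x).
  have S0 : 0 <= \sum_i saturate (dot ((r i)^-1 *: e_ i) x).
    by apply: sumr_ge0 => i _; exact: saturate_ge0.
  have [hx|/existsNP[i hi]] := pselect (forall i, `|x 0 i| <= rr).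
    rewrite (le_trans (hm0 _ _ (leq_maxl _ _) hx))// lerDl mulr_ge0// mulr_ge0//.
  have {hi} hi : rr < `|x 0 i| by rewrite ltNge; apply/negP.
  have h2 : 1 <= 2 * saturate (dot ((r i)^-1 *: e_ i) x).
    apply: saturate_ge_half; rewrite dotZl.
    have -> : dot (e_ i) x = x 0 i.
      rewrite /dot (bigD1 i)//= mxE !eqxx mul1r big1 ?addr0// => j ji.
      by rewrite mxE eqxx (negPf ji) mul0r.
    rewrite normrM gtr0_norm ?invr_gt0// mulrC ler_pdivlMr// mul1r.
    by rewrite (le_trans (rle i))// ltW.
  have h3 : saturate (dot ((r i)^-1 *: e_ i) x) <= \sum_i saturate (dot ((r i)^-1 *: e_ i) x).
    by rewrite (bigD1 i)//= lerDl; apply: sumr_ge0 => j _; exact: saturate_ge0.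
  have h4 : `|q m x - h x| <= M + M by rewrite (le_trans (ler_normB _ _))// lerD.
  move: h2 h3 h4 S0; set S := \sum_i _; set t := saturate _; set D := `|_| => h2 h3 h4 S0.
  have : M * 1 <= M * (2 * S) by rewrite ler_wpM2l//; lra.
  by rewrite mulr1 (_ : M * (2 * S) = 2 * (M * S)); [rewrite -(mulrA 4); lra|ring].
have near_sat : \forall n \near \oo, forall i,
    lap a (fun s => \int[p (lam n) s]_x saturate (dot ((r i)^-1 *: e_ i) x)) <= e / 6 / W.
  apply: filter_forall => i; exact: (hr i).2.
have e30 : 0 < e / 3 by rewrite divr_gt0.
have /cvgrPdist_le/(_ _ e60) near_q := lap_trig_cvg halpha hQS hQ hmu hp hPi lam1 lam_oo a0 (tq m).
near=> n.
have c2 : `|lap a (fun s => \int[Pi s]_x q m x) - lap a (fun s => \int[p (lam n) s]_x q m x)| <= e / 6.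
  by near: n; exact: near_q.
have c3 : forall i,
    lap a (fun s => \int[p (lam n) s]_x saturate (dot ((r i)^-1 *: e_ i) x)) <= e / 6 / W.
  by near: n; exact: near_sat.
have c4 : `|lap a (fun s => \int[p (lam n) s]_x q m x) - lap a (fun s => \int[p (lam n) s]_x h x)| <= e / 3.
  have B := lapB a0 (mp n (qCb m)) (bnd _ (p (lam n)) M (qCb m) (qM m)) (mp n hCb) (bnd _ (p (lam n)) M hCb hM).
  rewrite -B.
  pose Sn i s := \int[p (lam n) s]_x saturate (dot ((r i)^-1 *: e_ i) x).
  have mS i : measurable_fun `[(0 : R), +oo[ (Sn i) by exact: mp.
  have bS i (s : R) : 0 <= s -> `|Sn i s| <= 72 by exact: bnd.
  have mSS : measurable_fun `[(0 : R), +oo[ (fun s => \sum_i Sn i s) by exact: measurable_sum.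
  have bSS (s : R) : 0 <= s -> `|\sum_i Sn i s| <= \sum_(i < N) 72.
    by move=> s0; rewrite (le_trans (ler_norm_sum _ _ _))// ler_sum// => i _; exact: bS.
  have mG : measurable_fun `[(0 : R), +oo[ (fun s => 4 * M * \sum_i Sn i s).
    by apply: measurable_funM => //; exact: measurable_cst.
  have bG (s : R) : 0 <= s -> `|4 * M * \sum_i Sn i s| <= `|4 * M| * \sum_(i < N) 72.
    by move=> s0; rewrite normrM ler_wpM2l// bSS.
  have mc : measurable_fun `[(0 : R), +oo[ (fun _ : R => e / 6 * a) by exact: measurable_cst.
  have bc (s : R) : 0 <= s -> `|e / 6 * a| <= `|e / 6 * a| by [].
  have LG := lapD a0 mc bc mG bG.
  have LZ := lapZ (4 * M) a0 mSS bSS.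
  have LS := lap_sum (index_enum _) a0 mS bS.
  apply: (@le_trans _ _ (lap a (fun s => e / 6 * a + 4 * M * \sum_i Sn i s))).
    apply: le_normr_Rintegral_bound => //.
    - apply: measurable_funM; first exact: measurable_expRM.
      by apply: measurable_funB; exact: mp.
    - apply: (@lap_integrable _ a _ (`|e / 6 * a| + `|4 * M| * \sum_(i < N) 72) a0).
        exact: measurable_funD.
      by move=> s s0; rewrite (le_trans (ler_normD _ _))// lerD// bG.
    move=> s _; rewrite normrM (ger0_norm (expR_ge0 _)) ler_wpM2l ?expR_ge0//.
    have iq := Cb_prob_integrable (p (lam n) s) (qCb m).
    have ih := Cb_prob_integrable (p (lam n) s) hCb.
    have is_ i := Cb_prob_integrable (p (lam n) s) (sat_Cb ((r i)^-1 *: e_ i)).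
    have iss := integrable_Rsum (index_enum _) measurableT is_.
    have Bq := RintegralB measurableT iq ih; rewrite -Bq.
    have E1 := Rintegral_sum (index_enum _) measurableT is_.
    have E2 := RintegralZl (4 * M) measurableT iss.
    have i3 := integrableZl measurableT (4 * M) iss.
    have i4 : (p (lam n) s).-integrable setT (EFin \o (fun _ : 'rV[R]_N => e / 6 * a)).
      by apply: (@prob_integrable _ _ _ _ _ `|e / 6 * a|) => //; exact: measurable_cst.
    have E3 := RintegralD measurableT i4 i3.
    have -> : e / 6 * a + 4 * M * \sum_i Sn i s =
      \int[p (lam n) s]_x (e / 6 * a + 4 * M * \sum_i saturate (dot ((r i)^-1 *: e_ i) x)).
      apply/esym/(etrans E3); congr (_ + _); first exact: prob_cst.
      by apply: (etrans E2); congr (_ * _).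
    apply: le_normr_Rintegral_bound => //.
    - by apply: measurable_funB; apply: borel_measurable; [case: (qCb m)|].
    - exact: (integrableD measurableT i4 i3).
  rewrite LG LZ LS lap_cst// mulfK ?gt_eqF//.
  have : 4 * M * \sum_i lap a (Sn i) <= 4 * M * (N%:R * (e / 6 / W)).
    rewrite ler_wpM2l ?mulr_ge0// (le_trans (ler_sum _ (fun i _ => c3 i)))//.
    by rewrite sumr_const card_ord mulr_natl.
  have : 4 * M * (N%:R * (e / 6 / W)) <= e / 6.
    rewrite (_ : 4 * M * (N%:R * (e / 6 / W)) = (4 * M * N%:R) * (e / 6) / W); last by ring.
    rewrite ler_pdivrMr// mulrC ler_wpM2l ?(ltW e60)// /W lerDl//.
  by move: (4 * M * _) (4 * M * _) => x y; lra.
have tri (x y z w : R) : `|x - y| <= e / 6 -> `|y - z| <= e / 6 -> `|z - w| <= e / 3 ->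
    `|x - w| <= e.
  by rewrite !ler_norml => /andP[? ?] /andP[? ?] /andP[? ?]; apply/andP; split; lra.
exact: tri c1 c2 c4.
Unshelve. all: by end_near.
Qed.

End Cb_convergence.

(** * Integrands with values in bounded continuous functions *)

Section null_sets.
Context {R : realType} d (T : measurableType d) (m : {measure set T -> \bar R}).
Import HBNNSimple.
Local Open Scope ereal_scope.

(** The integral of a nonnegative function is a supremum over the simple functions below it, and
    cutting a simple function off on the null set [E] does not change its integral. *)
Let ge0_null_integral (D E : set T) (f : T -> \bar R) : measurable D -> measurable E ->
  m E = 0 -> (forall x, 0 <= f x) ->
  \int[m]_(x in D) f x = \int[m]_(x in D `\` E) f x.
Proof.
move=> mD mE E0 f0; rewrite !ge0_integralE//; apply/eqP; rewrite eq_le; apply/andP; split.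
  apply/ge_ereal_sup => _ /= [h hf <-].
  have mEC := measurableC mE.
  have -> : sintegral m h = sintegral m (proj_nnsfun h mEC).
    rewrite -integralT_nnsfun (ge0_negligible_integral mE measurableT _ _ E0).
    - by rewrite setTD integral_nnsfun// mrestrict.
    - by apply/measurable_EFinP; exact: measurable_funTS.
    - by move=> x _; rewrite lee_fin.
  apply: ereal_sup_ubound; exists (proj_nnsfun h mEC) => //= x.
  rewrite mindicE; have := hf x; rewrite /patch.
  have [xE|xE] := boolP (x \in ~` E); last first.
    by move=> _; rewrite mulr0; case: ifP => _; [exact: f0|exact: lexx].
  rewrite mulr1; case: ifPn => [xD|xD] h1; last first.
    by rewrite (le_trans h1)//; case: ifP.
  rewrite ifT//; apply/mem_set; split; first exact: set_mem.
  exact: (set_mem xE).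
apply/ge_ereal_sup => _ /= [h hf <-].
apply: ereal_sup_ubound; exists h => //= x; rewrite (le_trans (hf x))// /patch.
case: ifPn => [/set_mem[xD _]|_]; first by rewrite mem_set.
by case: ifP.
Qed.

(* [f] is not assumed measurable: in the theorem, the inner integrals are only
   known to be measurable off a null set. *)
Lemma null_integral (D E : set T) (f : T -> \bar R) : measurable D -> measurable E ->
  m E = 0 -> \int[m]_(x in D) f x = \int[m]_(x in D `\` E) f x.
Proof.
move=> mD mE E0; rewrite integralE [RHS]integralE.
by rewrite (ge0_null_integral mD mE E0)// (ge0_null_integral mD mE E0 (f := f^\-)).
Qed.

End null_sets.

Section Cb_norm.
Context {R : realType} {T : ptopologicalType}.
Implicit Types f g : T -> R.

Let ubd f : is_Cb f -> has_ubound (range (fun x => `|f x|)).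
Proof. by move=> [_ [M fM]]; exists M => _ [x _ <-]. Qed.

Lemma Cb_norm_ub f x : is_Cb f -> `|f x| <= Cb_norm f.
Proof. by move=> /ubd h; apply: ub_le_sup => //; exists x. Qed.

Lemma Cb_norm_le f c : (forall x, `|f x| <= c) -> Cb_norm f <= c.
Proof.
by move=> h; apply: ge_sup => [|_ [x _ <-]//]; exists `|f point|; exists point.
Qed.

Lemma is_CbB f g : is_Cb f -> is_Cb g -> is_Cb (f \- g).
Proof.
move=> [cf [A fA]] [cg [B gB]]; split; first exact: ctsB.
by exists (A + B) => x; rewrite (le_trans (ler_normB _ _))// lerD.
Qed.

Lemma Cb_norm_ge0 f : is_Cb f -> 0 <= Cb_norm f.
Proof. by move=> h; rewrite (le_trans _ (Cb_norm_ub point h)). Qed.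

Lemma Cb_norm_distl f g : is_Cb f -> is_Cb g ->
  `|Cb_norm f - Cb_norm g| <= Cb_norm (f \- g).
Proof.
move=> hf hg; have hfg := is_CbB hf hg.
rewrite ler_norml; apply/andP; split.
  rewrite lerNl opprB lerBlDr; apply: Cb_norm_le => x.
  rewrite -(subKr (f x) (g x)) (le_trans (ler_normB _ _))// addrC lerD//; exact: Cb_norm_ub.
rewrite lerBlDr; apply: Cb_norm_le => x.
by rewrite -(subrK (g x) (f x)) (le_trans (ler_normD _ _))// lerD//;
  [exact: (Cb_norm_ub x hfg)|exact: Cb_norm_ub].
Qed.

End Cb_norm.

Section simple_measurable.
Context {R : realType} {T : ptopologicalType}.

(** The indicator of one cell of the partition generated by the sets [A i], labelled by the pattern
    of memberships. *)
Let atom k (A : 'I_k -> set R) (b : {ffun 'I_k -> bool}) (t : R) : R :=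
  \prod_i (if b i then \1_(A i) t else 1 - \1_(A i) t).

Let measurable_atom k (A : 'I_k -> set R) b : (forall i, measurable (A i)) ->
  measurable_fun [set: R] (atom A b).
Proof.
move=> mA; apply: measurable_prod => i _; case: (b i).
  exact: measurable_indic.
by apply: measurable_funB; [exact: measurable_cst|exact: measurable_indic].
Qed.

Let atomE k (A : 'I_k -> set R) (t : R) (Psi : {ffun 'I_k -> bool} -> R) :
  \sum_b Psi b * atom A b t = Psi [ffun i => t \in A i].
Proof.
rewrite (bigD1 [ffun i => t \in A i])//= {1}/atom big1 => [|i _]; last first.
  by rewrite ffunE indicE; case: (t \in A i); rewrite ?subr0.
rewrite mulr1 big1 ?addr0// => b /eqP bt.
have [i bi] : exists i, b i != (t \in A i).
  apply/existsP; rewrite -negb_forall; apply/negP => /forallP h; apply: bt.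
  by apply/ffunP => i; rewrite ffunE; exact/eqP.
rewrite /atom (bigD1 i)//= indicE; move: bi; case: (b i); case: (t \in A i) => //= _.
  by rewrite mul0r mulr0.
by rewrite subrr mul0r mulr0.
Qed.

(** A simple function takes finitely many values among the functions of [x], one per cell. So an
    arbitrary functional [Phi] of two of them is a finite combination of measurable cell indicators;
    it is applied to the sup norm and to the distance. *)
Lemma measurable_simple (s s' : R -> T -> R) (Phi : (T -> R) -> (T -> R) -> R) :
  simple_Cb s -> simple_Cb s' -> measurable_fun [set: R] (fun t => Phi (s t) (s' t)).
Proof.
move=> [k [A [h [mA _ sE]]]] [k' [A' [h' [mA' _ sE']]]].
pose S (b : {ffun 'I_k -> bool}) x : R := \sum_i (b i)%:R * h i x.
pose S' (b : {ffun 'I_k' -> bool}) x : R := \sum_i (b i)%:R * h' i x.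
rewrite (_ : (fun t => _) = fun t => \sum_b (\sum_b' Phi (S b) (S' b') * atom A' b' t) * atom A b t).
  apply: measurable_sum => b; apply: measurable_funM; last exact: measurable_atom.
  apply: measurable_sum => b'; apply: measurable_funM; last exact: measurable_atom.
  exact: measurable_cst.
apply/funext => t.
under eq_bigr => b _ do rewrite atomE.
rewrite atomE; congr Phi; apply/funext => x.
  by rewrite sE; apply: eq_bigr => i _; rewrite ffunE indicE.
by rewrite sE'; apply: eq_bigr => i _; rewrite ffunE indicE.
Qed.

Lemma simple_is_Cb (s : R -> T -> R) t : simple_Cb s -> is_Cb (s t).
Proof.
move=> [k [A [h [_ hC sE]]]]; split.
  rewrite (_ : s t = fun x => \sum_(i < k) \1_(A i) t * h i x); last exact/funext.
  by apply: cts_sum => i _; apply: ctsM; [exact: cts_cst|case: (hC i)].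
have /choice[M hM] : forall i, exists M, forall x, `|h i x| <= M by move=> i; case: (hC i).
exists (\sum_(i < k) `|(\1_(A i) t : R)| * M i) => x; rewrite sE.
rewrite (le_trans (ler_norm_sum _ _ _))// ler_sum// => i _.
by rewrite normrM ler_wpM2l.
Qed.

End simple_measurable.

(** * From sets of times to integrable functions with values in bounded continuous functions *)

Section L1_convergence.
Context {R : realType} {N : nat}.
Local Notation leb := (@lebesgue_measure R).
Local Notation D := (`]0, +oo[%classic : set R).
Variables (P : nat -> R -> narrow R 'rV[R]_N) (P0 : R -> narrow R 'rV[R]_N).
Hypothesis mP : forall n h, is_Cb h -> measurable_fun `[(0 : R), +oo[ (fun s => \int[P n s]_x h x).
Hypothesis mP0 : forall h, is_Cb h -> measurable_fun `[(0 : R), +oo[ (fun s => \int[P0 s]_x h x).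
Hypothesis hB : forall h, is_Cb h -> forall (B : set R) (T : R), measurable B -> B `<=` `[0, T[ ->
  \int[leb]_(s in B) \int[P n s]_x h x @[n --> \oo] --> \int[leb]_(s in B) \int[P0 s]_x h x.

Let Cb_norm_prob (Z : probability (Borel 'rV[R]_N) R) f g : is_Cb f -> is_Cb g ->
  `|\int[Z]_x f x - \int[Z]_x g x| <= Cb_norm (f \- g).
Proof.
move=> hf hg; apply: prob_dist_le; [exact: Cb_prob_integrable..|move=> x].
exact: (Cb_norm_ub x (is_CbB hf hg)).
Qed.

Section fixed_function.
Variables (f : R -> 'rV[R]_N -> R) (s : nat -> R -> 'rV[R]_N -> R) (E : set R).
Hypothesis fC : forall t, D t -> is_Cb (f t).
Hypothesis sS : forall n, simple_Cb (s n).
Hypothesis mE : measurable E.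
Hypothesis E0 : leb E = 0%E.
Hypothesis sf : forall t, D t -> ~ E t -> Cb_norm (s n t \- f t) @[n --> \oo] --> (0 : R).
Hypothesis fint : (\int[leb]_(t in D) (Cb_norm (f t))%:E < +oo)%E.

Let D' : set R := D `\` E.
Let mD' : measurable D'. Proof. by apply: measurableD. Qed.
Let sC n t : is_Cb (s n t). Proof. exact: simple_is_Cb. Qed.
Let D'0 t : D' t -> 0 <= t.
Proof. by move=> [] /=; rewrite in_itv /= andbT => /ltW. Qed.
Let D'sub : D' `<=` `[(0 : R), +oo[.
Proof. by move=> t /D'0 t0; rewrite /= in_itv /= t0. Qed.

Let norm_f_cvg t : D' t -> Cb_norm (s n t) @[n --> \oo] --> Cb_norm (f t).
Proof.
move=> [Dt Et]; apply/cvgrPdistC_le => e e0.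
have /cvgrPdist_le/(_ _ e0) := sf Dt Et; apply: filterS => n.
rewrite sub0r normrN => h; apply: le_trans (Cb_norm_distl (sC n t) (fC Dt)) _.
by rewrite (le_trans _ h)// ler_norm.
Qed.

Lemma measurable_norm_f : measurable_fun D' (fun t => Cb_norm (f t)).
Proof.
apply: (measurable_fun_cvg (h := fun n t => Cb_norm (s n t))) => [n|t Dt].
  by apply: measurable_funTS; exact: (measurable_simple (fun u _ => Cb_norm u) (sS n) (sS n)).
exact: norm_f_cvg.
Qed.

(** The distance between two simple functions is measurable, and off [E] the distance to [f t] is
    the limit of the distances to [s k t]. *)
Let measurable_dist n : measurable_fun D' (fun t => Cb_norm (s n t \- f t)).
Proof.
apply: (measurable_fun_cvg (h := fun k t => Cb_norm (s n t \- s k t))) => [k|t [Dt Et]].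
  by apply: measurable_funTS; exact: (measurable_simple (fun u v => Cb_norm (u \- v)) (sS n) (sS k)).
apply/cvgrPdistC_le => e e0.
have /cvgrPdist_le/(_ _ e0) := sf Dt Et; apply: filterS => k.
rewrite sub0r normrN => h.
have h1 := Cb_norm_distl (is_CbB (sC n t) (sC k t)) (is_CbB (sC n t) (fC Dt)).
rewrite (le_trans h1)// (le_trans _ h)// (le_trans _ (ler_norm _))//.
apply: Cb_norm_le => x /=.
rewrite (_ : _ - _ = - (s k t x - f t x)); last by ring.
by rewrite normrN; exact: (Cb_norm_ub x (is_CbB (sC k t) (fC Dt))).
Qed.

Lemma norm_f_integrable : leb.-integrable D' (EFin \o (fun t => Cb_norm (f t))).
Proof.
apply/integrableP; split; first by apply/measurable_EFinP; exact: measurable_norm_f.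
have fint' := fint.
rewrite (@null_integral _ _ _ leb D E _ (measurable_itv _) mE E0) in fint'.
apply: le_lt_trans fint'; rewrite le_eqVlt; apply/orP; left; apply/eqP.
apply: eq_integral => t; rewrite inE => -[Dt _].
by rewrite /= ger0_norm// Cb_norm_ge0//; exact: fC.
Qed.

Let measurable_simple_prob (Z : R -> narrow R 'rV[R]_N) n :
  (forall h, is_Cb h -> measurable_fun `[(0 : R), +oo[ (fun t => \int[Z t]_x h x)) ->
  measurable_fun D' (fun t => \int[Z t]_x s n t x).
Proof.
move=> mZ; have [k [A [h [mA hC sE]]]] := sS n.
rewrite (_ : (fun t => _) = fun t => \sum_(i < k) \1_(A i) t * \int[Z t]_x h i x).
  apply: measurable_sum => i; apply: measurable_funM; first exact: measurable_indic.
  exact: (measurable_funS (measurable_itv _) D'sub (mZ _ (hC i))).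
apply/funext => t; have ih i := Cb_prob_integrable (Z t) (hC i).
have i1 i : (Z t).-integrable setT (EFin \o (fun x => \1_(A i) t * h i x)).
  exact: (integrableZl measurableT _ (ih i)).
have S := Rintegral_sum (index_enum _) measurableT i1.
apply: etrans (etrans S _); first by apply: eq_Rintegral => x _; rewrite sE.
by apply: eq_bigr => i _; exact: (RintegralZl (\1_(A i) t) measurableT (ih i)).
Qed.

Let measurable_prob_f (Z : R -> narrow R 'rV[R]_N) :
  (forall h, is_Cb h -> measurable_fun `[(0 : R), +oo[ (fun t => \int[Z t]_x h x)) ->
  measurable_fun D' (fun t => \int[Z t]_x f t x).
Proof.
move=> mZ; apply: (measurable_fun_cvg (h := fun n t => \int[Z t]_x s n t x)) => [n|t [Dt Et]].
  exact: measurable_simple_prob.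
apply/cvgrPdistC_le => e e0.
have /cvgrPdist_le/(_ _ e0) := sf Dt Et; apply: filterS => n.
rewrite sub0r normrN => h; apply: le_trans (Cb_norm_prob _ (sC n t) (fC Dt)) _.
by rewrite (le_trans _ h)// ler_norm.
Qed.

Variables (d : R) (j : nat).
Hypothesis d0 : 0 < d.

(** The weight [expR (- t)] turns the tolerance at each time into an error of total integral at most
    [d] on the half-line, and the cut at [j] confines the set to bounded times. *)
Definition good_times : set R :=
  [set t | [/\ D' t, t < j%:R & Cb_norm (s j t \- f t) <= d * expR (- t)]].
Local Notation A := good_times.

Lemma good_times_measurable : measurable A.
Proof.
have m1 : measurable_fun D' (fun t : R => t < j%:R).
  by apply: measurable_fun_ltr; [exact: measurable_id|exact: measurable_cst].
have m2 : measurable_fun D' (fun t => Cb_norm (s j t \- f t) <= d * expR (- t)).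
  apply: measurable_fun_ler; first exact: measurable_dist.
  apply: measurable_funTS; apply: continuous_measurable_fun.
  apply: ctsM; first exact: cts_cst.
  apply: cts_comp; first exact: continuous_expR.
  by apply: ctsN => t; exact: cvg_id.
have -> : A = (D' `&` (fun t : R => t < j%:R) @^-1` [set true]) `&`
    (D' `&` (fun t => Cb_norm (s j t \- f t) <= d * expR (- t)) @^-1` [set true]).
  apply/seteqP; split => t /=; first by move=> [h1 h2 h3].
  by move=> [[h1 h2] [_ h3]].
by apply: measurableI; [exact: m1|exact: m2].
Qed.

Let mA := good_times_measurable.
Let rest : R := \int[leb]_(t in D') ((1 - \1_A t) * Cb_norm (f t)).
Let R1 (t : R) : R := \1_A t * (d * expR (- t)).

Let exp_integrable (c : R) : leb.-integrable D' (EFin \o (fun t : R => expR (- t) * c)).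
Proof.
have h := integrable_expRN_cst c (@ltr01 R).
apply: (@integrableS _ _ _ leb _ _ _ (measurable_itv _) mD' D'sub).
by apply: eq_integrable h => // t _ /=; rewrite mulN1r.
Qed.

Let m1A : measurable_fun D' (\1_A : R -> R). Proof. exact: measurable_indic. Qed.

Let I01 t : 0 <= (\1_A t : R) <= 1.
Proof. by rewrite indicE; case: (_ \in _); rewrite lexx ler01. Qed.

Let R1_bound t : `|R1 t| <= expR (- t) * d.
Proof.
have /andP[h1 h2] := I01 t; have q0 : 0 <= d * expR (- t) by rewrite mulr_ge0 ?expR_ge0 ?(ltW d0).
rewrite /R1 ger0_norm; last exact: mulr_ge0.
by rewrite [leRHS]mulrC ler_piMl.
Qed.

Let R1_integrable : leb.-integrable D' (EFin \o R1).
Proof.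
have mR1 : measurable_fun D' R1; last first.
  exact: (@integrable_bound _ _ _ leb D' _ _ mD' mR1 (exp_integrable d) (fun t _ => R1_bound t)).
apply: measurable_funM => //; apply: measurable_funTS; apply: continuous_measurable_fun.
apply: ctsM; first exact: cts_cst.
apply: cts_comp; first exact: continuous_expR.
by apply: ctsN => t; exact: cvg_id.
Qed.

Let R1_int : \int[leb]_(t in D') R1 t <= d.
Proof.
have h := integrable_expRN_cst d (@ltr01 R).
have lc := lap_cst d (@ltr01 R); rewrite divr1 in lc.
rewrite -[leRHS]lc /lap.
rewrite -[in leLHS](setIidr D'sub) Rintegral_mkcondr.
apply: le_Rintegral => //.
  have mR1 := (@integrable_mkcond _ _ _ leb D' (EFin \o R1) mD').1 R1_integrable.
  apply: (@integrableS _ _ _ leb setT) => //.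
  by apply: eq_integrable mR1 => // t _; rewrite restrict_EFin.
move=> t _; rewrite /patch; case: ifP => _.
  by rewrite mulN1r (le_trans (ler_norm _))// R1_bound.
by rewrite mulr_ge0 ?expR_ge0 ?(ltW d0).
Qed.

Let rest_integrable : leb.-integrable D' (EFin \o (fun t => (1 - \1_A t) * Cb_norm (f t))).
Proof.
have mf : measurable_fun D' (fun t => (1 - \1_A t) * Cb_norm (f t)).
  apply: measurable_funM; last exact: measurable_norm_f.
  by apply: measurable_funB; [exact: measurable_cst|exact: m1A].
apply: (@integrable_bound _ _ _ leb D' _ _ mD' mf norm_f_integrable).
move=> t [Dt _]; have /andP[h1 h2] := I01 t; have h3 := Cb_norm_ge0 (fC Dt).
by rewrite ger0_norm ?mulr_ge0 ?subr_ge0// ler_piMl// gerBl.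
Qed.

(** On the good times [f t] is replaced by [s j t], elsewhere by 0. The bound does not involve the
    laws [Z], so the truncation is uniform along the sequence. *)
Lemma truncation_error (Z : R -> narrow R 'rV[R]_N) :
  (forall h, is_Cb h -> measurable_fun `[(0 : R), +oo[ (fun t => \int[Z t]_x h x)) ->
  `|\int[leb]_(t in D) \int[Z t]_x f t x -
    \int[leb]_(t in D') (\1_A t * \int[Z t]_x s j t x)| <= d + rest.
Proof.
move=> mZ.
have -> : \int[leb]_(t in D) \int[Z t]_x f t x = \int[leb]_(t in D') \int[Z t]_x f t x.
  by rewrite /Rintegral (@null_integral _ _ _ leb D E _ (measurable_itv _) mE E0).
have mF := measurable_prob_f mZ; have mS := measurable_simple_prob j mZ.
have bF t : D' t -> `|\int[Z t]_x f t x| <= Cb_norm (f t).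
  move=> [Dt _]; apply: Cb_prob_bound; first exact: fC.
  by move=> x; exact: Cb_norm_ub (fC Dt).
have iF : leb.-integrable D' (EFin \o (fun t => \int[Z t]_x f t x)).
  exact: (@integrable_bound _ _ _ leb D' _ _ mD' mF norm_f_integrable bF).
have dist t : D' t -> `|\int[Z t]_x f t x - \1_A t * \int[Z t]_x s j t x| <=
    R1 t + (1 - \1_A t) * Cb_norm (f t).
  move=> D't; have [Dt Et] := D't; rewrite /R1 indicE.
  have [tA|tA] := boolP (t \in A); last first.
    by rewrite !mul0r !subr0 add0r mul1r bF.
  rewrite !mul1r subrr mul0r addr0 distrC.
  have [_ _ h] := set_mem tA.
  exact: le_trans (Cb_norm_prob _ (sC j t) (fC Dt)) h.
have iR := @integrableD _ _ _ leb D' mD' _ _ R1_integrable rest_integrable.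
have mW : measurable_fun D' (fun t => \1_A t * \int[Z t]_x s j t x).
  exact: measurable_funM.
have iW : leb.-integrable D' (EFin \o (fun t => \1_A t * \int[Z t]_x s j t x)).
  have iFR := @integrableD _ _ _ leb D' mD' _ _ norm_f_integrable iR.
  apply: (@integrable_bound _ _ _ leb D' _ _ mD' mW iFR) => t Dt.
  rewrite -(subKr (\int[Z t]_x f t x) (\1_A t * _)) (le_trans (ler_normB _ _))//.
  by rewrite lerD ?bF ?dist.
have B := @RintegralB _ _ _ leb D' _ _ mD' iF iW; rewrite -B.
apply: (@le_trans _ _ (\int[leb]_(t in D') (R1 t + (1 - \1_A t) * Cb_norm (f t)))).
  apply: le_normr_Rintegral_bound => //; exact: measurable_funB.
have S := @RintegralD _ _ _ leb D' _ _ mD' R1_integrable rest_integrable.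
by rewrite S lerD// R1_int.
Qed.

Lemma truncated_cvg :
  \int[leb]_(t in D') (\1_A t * \int[P n t]_x s j t x) @[n --> \oo] -->
  \int[leb]_(t in D') (\1_A t * \int[P0 t]_x s j t x).
Proof.
have [k [Ai [h [mAi hC sE]]]] := sS j.
have E1 (Z : R -> narrow R 'rV[R]_N) :
    (forall h, is_Cb h -> measurable_fun `[(0 : R), +oo[ (fun t => \int[Z t]_x h x)) ->
    \int[leb]_(t in D') (\1_A t * \int[Z t]_x s j t x) =
    \sum_(i < k) \int[leb]_(t in A `&` Ai i) \int[Z t]_x h i x.
  move=> mZ.
  have AD' i : A `&` Ai i `<=` D' by move=> t [[]].
  have mI i : measurable_fun D' (\1_(A `&` Ai i) : R -> R).
    by apply: measurable_indic; exact: measurableI.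
  have mh i : measurable_fun D' (fun t => \int[Z t]_x h i x).
    exact: (measurable_funS (measurable_itv _) D'sub (mZ _ (hC i))).
  have ii i : leb.-integrable D' (EFin \o (fun t => \1_(A `&` Ai i) t * \int[Z t]_x h i x)).
    have [M hM] := (hC i).2.
    have M0 : 0 <= M by apply: le_trans (hM 0).
    (* Good times satisfy [t < j%:R], hence [1 <= expR (- t) * expR j%:R]. *)
    apply: (@integrable_bound _ _ _ leb D' _ _ mD' (measurable_funM (mI i) (mh i))
      (exp_integrable (expR j%:R * M))) => t Dt.
    have b := Cb_prob_bound (Z t) (hC i) hM.
    rewrite normrM mulrA; apply: ler_pM => //.
    rewrite indicE; have [/set_mem[[_ tj _] _]|_] := boolP (t \in _).
      rewrite normr1 -expRD -[leLHS](expR0 R) ler_expR addrC subr_ge0; exact: ltW.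
    by rewrite normr0 mulr_ge0 ?expR_ge0.
  transitivity (\int[leb]_(t in D') \sum_(i < k) \1_(A `&` Ai i) t * \int[Z t]_x h i x).
    apply: eq_Rintegral => t _.
    have ih i := Cb_prob_integrable (Z t) (hC i).
    have i1 i : (Z t).-integrable setT (EFin \o (fun x => \1_(Ai i) t * h i x)).
      exact: (integrableZl measurableT _ (ih i)).
    have S := Rintegral_sum (index_enum _) measurableT i1.
    have -> : \int[Z t]_x s j t x = \sum_(i < k) \1_(Ai i) t * \int[Z t]_x h i x.
      apply: etrans (etrans S _); first by apply: eq_Rintegral => x _; rewrite sE.
      by apply: eq_bigr => i _; exact: (RintegralZl (\1_(Ai i) t) measurableT (ih i)).
    by rewrite mulr_sumr; apply: eq_bigr => i _; rewrite mulrA indicI.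
  have S := @Rintegral_sum _ _ _ leb D' _ (index_enum _) _ mD' ii.
  apply: (etrans S); apply: eq_bigr => i _.
  rewrite -[in RHS](setIidr (AD' i)) [RHS]Rintegral_mkcondr; apply: eq_Rintegral => t _.
  by rewrite /patch indicE; case: (_ \in _); rewrite ?mul1r ?mul0r.
have E2 := E1 P0 mP0; rewrite E2.
rewrite (_ : (fun n => _) = fun n => \sum_(i < k) \int[leb]_(t in A `&` Ai i) \int[P n t]_x h i x).
  elim: (index_enum _) => [|i r IH].
    under eq_fun do rewrite big_nil.
    by rewrite big_nil; exact: cvg_cst.
  under eq_fun do rewrite big_cons.
  rewrite big_cons; apply: cvgD; last exact: IH.
  apply: (hB (hC i) (T := j%:R)); first by apply: measurableI => //; exact: good_times_measurable.
  by move=> t [[D't tj _] _]; rewrite /= in_itv /= tj D'0.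
by apply/funext => n; exact: E1 (mP n).
Qed.

End fixed_function.

(** Every time off [E] is eventually good, so the integrand vanishes from some [j] on, under the
    dominating function [Cb_norm (f t)]. *)
Lemma rest_cvg f s E (d : R) : (forall t, D t -> is_Cb (f t)) ->
  (forall n, simple_Cb (s n)) -> measurable E -> leb E = 0%E ->
  (forall t, D t -> ~ E t -> Cb_norm (s n t \- f t) @[n --> \oo] --> (0 : R)) ->
  (\int[leb]_(t in D) (Cb_norm (f t))%:E < +oo)%E -> 0 < d ->
  \int[leb]_(t in D `\` E) ((1 - \1_(good_times f s E d j) t) * Cb_norm (f t)) @[j --> \oo]
  --> (0 : R).
Proof.
move=> fC sS mE E0 sf fint d0.
have mD' : measurable (D `\` E) by exact: measurableD.
have mN := measurable_norm_f fC sS sf; have iN := norm_f_integrable fC sS mE E0 sf fint.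
have z : \int[leb]_(t in D `\` E) (0 : R) = 0 by rewrite Rintegral_cst// mul0r.
suff : \int[leb]_(t in D `\` E) ((1 - \1_(good_times f s E d j) t) * Cb_norm (f t)) @[j --> \oo]
  --> \int[leb]_(t in D `\` E) (0 : R) by rewrite z.
apply: (@Rdominated_cvg _ _ _ leb (D `\` E)
  (fun j t => (1 - \1_(good_times f s E d j) t) * Cb_norm (f t)) (fun=> 0)
  (fun t => Cb_norm (f t))) => //.
- move=> j; apply: measurable_funM; last exact: mN.
  apply: measurable_funB; first exact: measurable_cst.
  by apply: measurable_indic; exact: good_times_measurable.
- move=> t [Dt Et].
  have q0 : 0 < d * expR (- t) by rewrite mulr_gt0 ?expR_gt0.
  have ev : \forall j \near \oo, (0 : R) = (1 - \1_(good_times f s E d j) t) * Cb_norm (f t).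
    near=> j; rewrite indicE mem_set ?subrr ?mul0r//; split => //.
      by near: j; exact: nbhs_infty_gtr.
    near: j; have /cvgrPdist_le/(_ _ q0) := sf t Dt Et; apply: filterS => n.
    by rewrite sub0r normrN; apply: le_trans; exact: ler_norm.
  by apply: (cvg_trans (near_eq_cvg ev)); exact: cvg_cst.
- move=> j t [Dt _]; have h3 := Cb_norm_ge0 (fC t Dt).
  rewrite indicE; case: (_ \in _); first by rewrite subrr mul0r normr0.
  by rewrite subr0 mul1r ger0_norm.
Unshelve. all: by end_near.
Qed.

Theorem L1_Cb_cvg f : L1_Cb D f ->
  \int[leb]_(t in D) \int[P n t]_x f t x @[n --> \oo] -->
  \int[leb]_(t in D) \int[P0 t]_x f t x.
Proof.
move=> [fC [s [sS [E [mE E0 hE]]]] fint].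
have sf t : D t -> ~ E t -> Cb_norm (s n t \- f t) @[n --> \oo] --> (0 : R).
  move=> Dt Et; apply: contrapT => h; apply: Et; apply: hE => /= h2.
  exact: (h (h2 Dt)).
apply/cvgrPdist_le => e e0.
(* Two truncation errors of at most [d + d] each, and one [d] for the truncated integrals. *)
pose d := e / 5; have d0 : 0 < d by rewrite divr_gt0.
have [j hj] : exists j, \int[leb]_(t in D `\` E)
    ((1 - \1_(good_times f s E d j) t) * Cb_norm (f t)) <= d.
  have L := rest_cvg fC sS mE E0 sf fint d0.
  have /cvgrPdist_le/(_ _ d0) [j _ /(_ j (leqnn j))] := L.
  by rewrite sub0r normrN => h; exists j; rewrite (le_trans _ h)// ler_norm.
have err Z mZ := truncation_error fC sS mE E0 sf fint j d0 (Z := Z) mZ.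
have errP0 := le_trans (err P0 mP0) (lerD (lexx d) hj).
have errP n := le_trans (err (P n) (mP n)) (lerD (lexx d) hj).
have L := @truncated_cvg f s E fC sS mE sf d j.
have /cvgrPdist_le/(_ _ d0) := L; apply: filterS => n h.
have tri (x y z w : R) : `|x - y| <= d + d -> `|w - z| <= d + d -> `|y - z| <= d ->
    `|x - w| <= e.
  have -> : e = 5 * d by rewrite /d; field.
  by rewrite !ler_norml => /andP[? ?] /andP[? ?] /andP[? ?]; apply/andP; split; lra.
exact: tri errP0 (errP n) h.
Qed.

End L1_convergence.

Theorem theorem9 (R : realType) (N : nat) (hN : (1 <= N)%N)
    (alpha : R -> R -> R) (alpha_oo : R -> R)
    (Q : probability (Borel (R * 'rV[R]_N)%type) R)
    (u0 mu Pi : R -> narrow R 'rV[R]_N)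
    (p : R -> R -> narrow R 'rV[R]_N)
    (halpha : standing_alpha alpha alpha_oo)
    (hQS : Q (@strip R N) = 1%E)
    (hQ : standing_Q Q)
    (hu0 : {within `[-1, 0], continuous u0})
    (hmu : delay_solution Q alpha u0 mu)
    (hp : rescaled (Hshift Q alpha alpha_oo) mu p)
    (hPi : diffusion_solution
             ((1 + Gam Q alpha_oo)^-1 *: D0 Q alpha_oo) Pi)
    (f : R -> 'rV[R]_N -> R) (hf : L1_Cb `]0, +oo[ f) :
  (\int[@lebesgue_measure R]_(t in `]0, +oo[) \int[p lambda t]_x f t x)
    @[lambda --> +oo] -->
  \int[@lebesgue_measure R]_(t in `]0, +oo[) \int[Pi t]_x f t x.
Proof.
(* The limit in [lambda] is tested along sequences; raising the terms to at least 1 changes only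
   finitely many of them and gives [1 <= lam n] throughout. *)
apply/cvg_pinftyP => v v_oo; pose lam n := Num.max 1 (v n).
have lam1 n : 1 <= lam n by rewrite le_max lexx.
have lam0 n : 0 < lam n by exact: lt_le_trans (lam1 n).
have lamE : \forall n \near \oo, lam n = v n.
  near=> n; rewrite /lam max_r//; near: n.
  by move/cvgryPge : v_oo; exact.
have lam_oo : lam n @[n --> \oo] --> +oo.
  by apply: cvg_trans v_oo; apply: near_eq_cvg; apply: filterS lamE => n ->.
have mp n h : is_Cb h ->
    measurable_fun `[(0 : R), +oo[ (fun s => \int[p (lam n) s]_x h x).
  exact: (measurable_rescaled halpha hQS hQ hmu hp (lam0 n)).
have mPi h : is_Cb h -> measurable_fun `[(0 : R), +oo[ (fun s => \int[Pi s]_x h x).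
  exact: (diffusion_measurable hPi).
have hB h : is_Cb h -> forall (B : set R) (T : R), measurable B -> B `<=` `[0, T[ ->
    \int[@lebesgue_measure R]_(s in B) \int[p (lam n) s]_x h x @[n --> \oo] -->
    \int[@lebesgue_measure R]_(s in B) \int[Pi s]_x h x.
  move=> hC B T; have [M hM] := hC.2.
  apply: (laplace_density (g := fun n s => \int[p (lam n) s]_x h x) (M := M)).
  - by move=> n; exact: mp.
  - exact: mPi.
  - by move=> n s _; exact: (Cb_prob_bound (p (lam n) s) hC hM).
  - by move=> s _; exact: (Cb_prob_bound (Pi s) hC hM).
  - by move=> a a0; exact: (lap_rescaled_cvg halpha hQS hQ hmu hp hPi lam1 lam_oo a0 hC).
have := L1_Cb_cvg (P := fun n => p (lam n)) mp mPi hB hf.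
apply: cvg_trans; apply: near_eq_cvg; apply: filterS lamE => n nv.
by rewrite nv.
Unshelve. all: by end_near.
Qed.
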